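(* Let $\mathcal S$ be a ribbon category, $H$ a Hopf algebra in $\mathcal S$ (with invertible antipode), $\mathcal C=\mathcal C_0+\mathcal C_1$ with $\mathcal C_0=\mathrm{Rep}_{\mathcal S}(H)$, $\mathcal C_1=\mathcal S$, and $\otimes_{\mathcal C}$ the tensor product functor given in the context. (i) Let $\Gamma:H^\vee\to H$ and $\lambda:H\to\mathbf 1$ be two morphisms in $\mathcal S$ such that a) $\Gamma$ is a Hopf algebra isomorphism; b) $\lambda$ is a right cointegral for $H$ such that there exists $g:\mathbf 1\to H$ with $(\mathrm{id}_H\otimes\lambda)\circ\Delta=g\circ\lambda$, and such that $(\lambda\otimes\lambda)\circ(\mathrm{id}_H\otimes\Gamma)\circ\mathrm{coev}_H=\mathrm{id}_{\mathbf 1}$ (such a $g$ is then unique and has a multiplicative inverse); c) $\Gamma^\vee=j_H\circ\theta_H^{-1}\circ S^2\circ\mathrm{Ad}_{g^{-1}}\circ\Gamma$. Set $$\gamma=(S^{-1}\otimes\Gamma)\circ\mathrm{coev}_H,\qquad \delta=(S\otimes(M_g\circ\Gamma))\circ\mathrm{coev}_H,\qquad \phi=(\mathrm{id}_H\otimes(\lambda\circ\mu))\circ\big(((\mathrm{id}_H\otimes\Gamma)\circ\mathrm{coev}_H)\otimes\mathrm{id}_H\big).$$ Then the family of natural isomorphisms $\alpha_{A,B,C}:A\otimes_{\mathcal C}(B\otimes_{\mathcal C}C)\to(A\otimes_{\mathcal C}B)\otimes_{\mathcal C}C$ built from $\gamma,\delta,\phi$ as described in the context are associativity isomorphisms for $\otimes_{\mathcal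 C}$ (i.e. they satisfy the pentagon axiom). (ii) Denote by $\mathcal C(H,\Gamma,\lambda)$ the monoidal category resulting via (i) from $H,\Gamma,\lambda$. Given a Hopf algebra $H'$ in $\mathcal S$ and a Hopf algebra isomorphism $\varphi:H'\to H$, there is a monoidal equivalence $\mathcal C(H,\Gamma,\lambda)\cong\mathcal C(H',\Gamma',\lambda')$, where $\Gamma'=\varphi^{-1}\circ\Gamma\circ(\varphi^{-1})^\vee$ and $\lambda'=\lambda\circ\varphi$.
   Context: **Base category.** $\mathcal S$ is a ribbon category, assumed strict as a monoidal category, with tensor product $\otimes$, unit $\mathbf 1$, braiding $c_{U,V}:U\otimes V\to V\otimes U$, twist $\theta_U$, duals $U^\vee$ with $\mathrm{ev}_U:U^\vee\otimes U\to\mathbf 1$, $\mathrm{coev}_U:\mathbf 1\to U\otimes U^\vee$, and the natural monoidal isomorphism $j_U:U\to U^{\vee\vee}$ of the ribbon structure. For $f:U\to V$, $f^\vee:V^\vee\to U^\vee$ is the dual morphism. **Hopf algebras.** A Hopf algebra in $\mathcal S$ is an object $H$ with morphisms $\mu,\eta,\Delta,\varepsilon,S$ such that $(H,\mu,\eta)$ is an algebra, $(H,\Delta,\varepsilon)$ a coalgebra, $\Delta$ is an algebra map $H\to H\otimes H$ where $\mu_{H\otimes H}=(\mu\otimes\mu)\circ(\mathrm{id}\otimes c_{H,H}\otimes\mathrm{id})$, $\varepsilon$ is an algebra map, and $\mu\circ(S\otimes\mathrm{id})\circ\Delta=\eta\circ\varepsilon=\mu\circ(\mathrm{id}\otimes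 S)\circ\Delta$. Throughout, ''Hopf algebra'' means Hopf algebra with invertible antipode $S$. The dual Hopf algebra $H^\vee$ has $\mu_{H^\vee},\Delta_{H^\vee}$ determined by $\mathrm{ev}_H\circ(\mu_{H^\vee}\otimes\mathrm{id}_H)=\mathrm{ev}_H\circ(\mathrm{id}\otimes\mathrm{ev}_H\otimes\mathrm{id})\circ(\mathrm{id}_{H^\vee\otimes H^\vee}\otimes\Delta)$ and $\mathrm{ev}_H\circ(\mathrm{id}\otimes\mathrm{ev}_H\otimes\mathrm{id})\circ(\Delta_{H^\vee}\otimes\mathrm{id}_{H\otimes H})=\mathrm{ev}_H\circ(\mathrm{id}_{H^\vee}\otimes\mu)$, and $\eta_{H^\vee}=\varepsilon^\vee$, $\varepsilon_{H^\vee}=\eta^\vee$, $S_{H^\vee}=S^\vee$. For $x:\mathbf 1\to H$ put ${}_xM=\mu\circ(x\otimes\mathrm{id})$, $M_x=\mu\circ(\mathrm{id}\otimes x)$. A multiplicative inverse of $x$ is $x^{-1}:\mathbf 1\to H$ with $\mu\circ(x\otimes x^{-1})=\eta=\mu\circ(x^{-1}\otimes x)$; then $\mathrm{Ad}_x={}_xM\circ M_{x^{-1}}$. A right cointegral is $\lambda:H\to\mathbf 1$ with $(\lambda\otimes\mathrm{id})\circ\Delta=\eta\circ\lambda$. **Modules.** $\mathrm{Rep}_{\mathcal S}(H)$ is the category of left $H$-modules $(M,\rho_M:H\otimes M\to M)$ in $\mathcal S$. Put $\rho^{H\otimes H}_{M\otimes N}=(\rho_M\otimes\rho_N)\circ(\mathrm{id}_H\otimes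 c_{H,M}\otimes\mathrm{id}_N)$; the action on $M\otimes N$ is $\rho^{H\otimes H}_{M\otimes N}\circ(\Delta\otimes\mathrm{id}_{M\otimes N})$. **The category $\mathcal C$.** $\mathcal C=\mathcal C_0+\mathcal C_1$ ($+$ is disjoint union of categories, or direct sum when $\mathcal S$ is additive), $\mathcal C_0=\mathrm{Rep}_{\mathcal S}(H)$, $\mathcal C_1=\mathcal S$. The tensor product $\otimes_{\mathcal C}$ is (forgetful functor suppressed): $A\otimes B$ in $\mathrm{Rep}_{\mathcal S}(H)$ for $A,B\in\mathcal C_0$; $A\otimes B\in\mathcal C_1$ if exactly one of $A,B$ is in $\mathcal C_1$; and $H\otimes A\otimes B\in\mathcal C_0$ with $H$ acting by multiplication on the factor $H$ if $A,B\in\mathcal C_1$; on morphisms $f\otimes g$, respectively $\mathrm{id}_H\otimes f\otimes g$ in the last case. The unit is $\mathbf 1\in\mathcal C_0$ with action via $\varepsilon$, with identity unit isomorphisms. **The isomorphisms $\alpha$ built from $\gamma,\delta:\mathbf 1\to H\otimes H$ and $\phi:H\to H$.** Superscripts indicate the degree of the objects. - $\alpha_{A^0,B^0,C^0},\ \alpha_{A^0,B^0,C^1},\ \alpha_{A^1,B^0,C^0}$ are identities. - $\alpha_{A^0,B^1,C^0}=(\mathrm{id}_A\otimes c_{C,B})\circ\big[(\rho^{H\otimes H}_{A\otimes C}\circ(\gamma\otimes\mathrm{id}_{A\otimes C}))\otimes\mathrm{id}_B\big]\circ(\mathrm{id}_A\otimes c_{C,B}^{-1})$. - $\alpha_{A^0,B^1,C^1}=\big[(\mathrm{id}_H\otimes\rho_A)\circ\big(((\mathrm{id}_H\otimes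 S^{-1})\circ c_{H,H}^{-1}\circ\Delta)\otimes\mathrm{id}_A\big)\circ c_{H,A}^{-1}\big]\otimes\mathrm{id}_{B\otimes C}:A\otimes H\otimes B\otimes C\to H\otimes A\otimes B\otimes C$. - $\alpha_{A^1,B^0,C^1}=\big[(\mu\otimes\mathrm{id}_A\otimes\rho_B)\circ(\mathrm{id}_{H\otimes H}\otimes c_{H,A}\otimes\mathrm{id}_B)\circ(\mathrm{id}_H\otimes\delta\otimes\mathrm{id}_{A\otimes B})\big]\otimes\mathrm{id}_C$ on $H\otimes A\otimes B\otimes C$. - $\alpha_{A^1,B^1,C^0}=(\mathrm{id}_{H\otimes A\otimes B}\otimes\rho_C)\circ(\mathrm{id}_H\otimes c_{H,A\otimes B}\otimes\mathrm{id}_C)\circ(\Delta\otimes\mathrm{id}_{A\otimes B\otimes C})$. - $\alpha_{A^1,B^1,C^1}=\big[(\phi\otimes\mathrm{id}_A)\circ c_{H,A}^{-1}\big]\otimes\mathrm{id}_{B\otimes C}:A\otimes H\otimes B\otimes C\to H\otimes A\otimes B\otimes C$. *)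

(* Defs.v *)
From mathcomp Require Import ssreflect ssrfun ssrbool.
From Stdlib Require Import ProofIrrelevance.

Set Implicit Arguments.
Unset Strict Implicit.
Unset Printing Implicit Defensive.

(** * Strict ribbon categories

    The strict base category is presented by one type of objects and one type
    of arrows with domain and codomain maps.  In this form strictness is plain
    equality, [A ⊗ (B ⊗ C) = A ⊗ B ⊗ C] and [f ⊠ (g ⊠ h) = f ⊠ g ⊠ h], and no
    transport occurs in any formula.  [comp g f] is a total function which is
    only constrained when [cod f = dom g]; its value on other pairs is
    irrelevant. *)

Record strictMonCat := StrictMonCat {
  ob : Type;
  arr : Type;
  dom : arr -> ob;
  cod : arr -> ob;
  idm : ob -> arr;
  comp : arr -> arr -> arr;
  unit : ob;
  tob : ob -> ob -> ob;
  tarr : arr -> arr -> arr;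
  dom_idm : forall A, dom (idm A) = A;
  cod_idm : forall A, cod (idm A) = A;
  dom_comp : forall g f, cod f = dom g -> dom (comp g f) = dom f;
  cod_comp : forall g f, cod f = dom g -> cod (comp g f) = cod g;
  comp_idl : forall f, comp (idm (cod f)) f = f;
  comp_idr : forall f, comp f (idm (dom f)) = f;
  comp_assoc : forall h g f, cod f = dom g -> cod g = dom h ->
    comp h (comp g f) = comp (comp h g) f;
  dom_tarr : forall f g, dom (tarr f g) = tob (dom f) (dom g);
  cod_tarr : forall f g, cod (tarr f g) = tob (cod f) (cod g);
  tarr_idm : forall A B, tarr (idm A) (idm B) = idm (tob A B);
  tarr_comp : forall g f g' f', cod f = dom g -> cod f' = dom g' ->
    tarr (comp g f) (comp g' f') = comp (tarr g g') (tarr f f');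
  tob_assoc : forall A B C, tob A (tob B C) = tob (tob A B) C;
  tob_unitl : forall A, tob unit A = A;
  tob_unitr : forall A, tob A unit = A;
  tarr_assoc : forall f g h, tarr f (tarr g h) = tarr (tarr f g) h;
  tarr_unitl : forall f, tarr (idm unit) f = f;
  tarr_unitr : forall f, tarr f (idm unit) = f
}.

Arguments idm {s} _.
Arguments unit {s}.

Declare Scope ribbon_scope.
Delimit Scope ribbon_scope with rib.
Open Scope ribbon_scope.

Notation "A ⊗ B" := (tob A B) (at level 36, left associativity) : ribbon_scope.
Notation "f ⊠ g" := (tarr f g) (at level 36, left associativity) : ribbon_scope.
Notation "g ∘ f" := (comp g f) (at level 40, left associativity) : ribbon_scope.
Notation "'𝟏'" := unit : ribbon_scope.

Definition is_hom (S : strictMonCat) (A B : ob S) (f : arr S) : Prop :=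
  dom f = A /\ cod f = B.

Notation "f ∈ A ⇒ B" := (is_hom A B f)
  (at level 70, A at level 69, B at level 69) : ribbon_scope.

Definition inverse_arrows (S : strictMonCat) (A B : ob S) (f h : arr S) : Prop :=
  [/\ f ∈ A ⇒ B, h ∈ B ⇒ A, h ∘ f = idm A & f ∘ h = idm B].

Record rigidCat := RigidCat {
  rigid_mon :> strictMonCat;
  dual : ob rigid_mon -> ob rigid_mon;
  ev : ob rigid_mon -> arr rigid_mon;
  coev : ob rigid_mon -> arr rigid_mon;
  ev_hom : forall U, ev U ∈ dual U ⊗ U ⇒ 𝟏;
  coev_hom : forall U, coev U ∈ 𝟏 ⇒ U ⊗ dual U;
  zigzag : forall U, (idm U ⊠ ev U) ∘ (coev U ⊠ idm U) = idm U;
  zigzag_dual : forall U,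
    (ev U ⊠ idm (dual U)) ∘ (idm (dual U) ⊠ coev U) = idm (dual U)
}.

Notation "U ^∨" := (dual U) (at level 1, format "U ^∨") : ribbon_scope.

Definition dualarr (S : rigidCat) (f : arr S) : arr S :=
  (ev (cod f) ⊠ idm (dom f)^∨)
    ∘ (idm (cod f)^∨ ⊠ f ⊠ idm (dom f)^∨)
    ∘ (idm (cod f)^∨ ⊠ coev (dom f)).

Record ribbonCat := RibbonCat {
  ribbon_rigid :> rigidCat;
  br : ob ribbon_rigid -> ob ribbon_rigid -> arr ribbon_rigid;
  brV : ob ribbon_rigid -> ob ribbon_rigid -> arr ribbon_rigid;
  tw : ob ribbon_rigid -> arr ribbon_rigid;
  twV : ob ribbon_rigid -> arr ribbon_rigid;
  br_inverse : forall U V, inverse_arrows (U ⊗ V) (V ⊗ U) (br U V) (brV U V);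
  br_nat : forall f g,
    br (cod f) (cod g) ∘ (f ⊠ g) = (g ⊠ f) ∘ br (dom f) (dom g);
  br_hexl : forall U V W,
    br (U ⊗ V) W = (br U W ⊠ idm V) ∘ (idm U ⊠ br V W);
  br_hexr : forall U V W,
    br U (V ⊗ W) = (idm V ⊠ br U W) ∘ (br U V ⊠ idm W);
  tw_inverse : forall U, inverse_arrows U U (tw U) (twV U);
  tw_nat : forall f, tw (cod f) ∘ f = f ∘ tw (dom f);
  tw_tensor : forall U V, tw (U ⊗ V) = br V U ∘ br U V ∘ (tw U ⊠ tw V);
  tw_dual : forall U, tw U^∨ = dualarr (tw U)
}.

(** The pivotal isomorphism [U -> U^∨^∨] of a ribbon category: the unique arrow
    with [ev U^∨ ∘ (piv U ⊠ id) = ev U ∘ br U U^∨ ∘ (tw U ⊠ id)], i.e. it turns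
    the left duality into the right duality coming from braiding and twist. *)
Definition piv (S : ribbonCat) (U : ob S) : arr S :=
  ((ev U ∘ br U U^∨ ∘ (tw U ⊠ idm U^∨)) ⊠ idm U^∨^∨) ∘ (idm U ⊠ coev U^∨).

(** ** Typing of composite arrows *)

Section Typing.
Variable S : strictMonCat.
Implicit Types (A B C D : ob S) (f g h : arr S).

Lemma idm_hom A : idm A ∈ A ⇒ A.
Proof. by split; rewrite ?dom_idm ?cod_idm. Qed.

Lemma comp_hom_eq A B B' C f g :
  g ∈ B' ⇒ C -> f ∈ A ⇒ B -> B = B' -> g ∘ f ∈ A ⇒ C.
Proof.
by move=> [dg cg] [df cf] e; split; rewrite ?dom_comp ?cod_comp // cf dg.
Qed.

Lemma tarr_hom A B C D f g : f ∈ A ⇒ B -> g ∈ C ⇒ D -> f ⊠ g ∈ A ⊗ C ⇒ B ⊗ D.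
Proof. by move=> [df cf] [dg cg]; split; rewrite ?dom_tarr ?cod_tarr ?df ?dg ?cf ?cg. Qed.

Lemma hom_eq A B A' B' f : f ∈ A ⇒ B -> A = A' -> B = B' -> f ∈ A' ⇒ B'.
Proof. by move=> H <- <-. Qed.

Lemma hom_composable A B B' C f g :
  f ∈ A ⇒ B -> g ∈ B' ⇒ C -> B = B' -> cod f = dom g.
Proof. by move=> [_ ->] [-> _]. Qed.

Lemma idl_hom A B C f : f ∈ A ⇒ B -> B = C -> idm C ∘ f = f.
Proof. by move=> [_ <-] <-; rewrite comp_idl. Qed.

Lemma idr_hom A B C f : f ∈ A ⇒ B -> A = C -> f ∘ idm C = f.
Proof. by move=> [<- _] <-; rewrite comp_idr. Qed.

Lemma whiskerl A f g : cod f = dom g -> idm A ⊠ (g ∘ f) = (idm A ⊠ g) ∘ (idm A ⊠ f).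
Proof. by move=> e; rewrite -tarr_comp ?dom_idm ?cod_idm // (idl_hom (idm_hom A)). Qed.

Lemma whiskerr A f g : cod f = dom g -> (g ∘ f) ⊠ idm A = (g ⊠ idm A) ∘ (f ⊠ idm A).
Proof. by move=> e; rewrite -tarr_comp ?dom_idm ?cod_idm // (idl_hom (idm_hom A)). Qed.

Lemma tarr_lr A B C D f g : f ∈ A ⇒ B -> g ∈ C ⇒ D ->
  f ⊠ g = (f ⊠ idm D) ∘ (idm A ⊠ g).
Proof.
move=> [df cf] [dg cg]; rewrite -tarr_comp ?dom_idm ?cod_idm //.
by rewrite -df -cg comp_idl comp_idr.
Qed.

Lemma tarr_rl A B C D f g : f ∈ A ⇒ B -> g ∈ C ⇒ D ->
  f ⊠ g = (idm B ⊠ g) ∘ (f ⊠ idm C).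
Proof.
move=> [df cf] [dg cg]; rewrite -tarr_comp ?dom_idm ?cod_idm //.
by rewrite -dg -cf comp_idl comp_idr.
Qed.

Lemma tarr_slide A B C D f g : f ∈ A ⇒ B -> g ∈ C ⇒ D ->
  (f ⊠ idm D) ∘ (idm A ⊠ g) = (idm B ⊠ g) ∘ (f ⊠ idm C).
Proof. by move=> hf hg; rewrite -(tarr_lr hf hg) -(tarr_rl hf hg). Qed.

End Typing.

Create HintDb hom discriminated.
#[export] Hint Resolve idm_hom tarr_hom ev_hom coev_hom : hom.

Ltac obeq := by rewrite ?tob_unitl ?tob_unitr ?tob_assoc.
Ltac infer_hom :=
  lazymatch goal with
  | |- is_hom _ _ (comp _ _) => eapply comp_hom_eq; [infer_hom | infer_hom | obeq]
  | |- is_hom _ _ (tarr _ _) => eapply tarr_hom; [infer_hom | infer_hom]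
  | |- _ => solve [eauto 2 with hom nocore]
  end.
(** [hom] proves [f ∈ A ⇒ B]; [typ] proves [cod f = dom g]. *)
Ltac hom := eapply hom_eq; [infer_hom | obeq | obeq].
Ltac typ := eapply hom_composable; [infer_hom | infer_hom | obeq].
Ltac compid := first
  [ eapply idl_hom; [infer_hom | obeq] | eapply idr_hom; [infer_hom | obeq] ].

Lemma br_hom (S : ribbonCat) (U V : ob S) : br U V ∈ U ⊗ V ⇒ V ⊗ U.
Proof. by case: (br_inverse U V). Qed.

Lemma brV_hom (S : ribbonCat) (U V : ob S) : brV U V ∈ V ⊗ U ⇒ U ⊗ V.
Proof. by case: (br_inverse U V). Qed.

Lemma tw_hom (S : ribbonCat) (U : ob S) : tw U ∈ U ⇒ U.
Proof. by case: (tw_inverse U). Qed.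

#[export] Hint Resolve br_hom brV_hom tw_hom : hom.

(** * Hopf algebras *)

Record hopfData (S : strictMonCat) := HopfData {
  carrier : ob S;
  mu : arr S;
  eta : arr S;
  Delta : arr S;
  eps : arr S;
  antip : arr S
}.

Definition mu2 (S : ribbonCat) (H : hopfData S) : arr S :=
  (mu H ⊠ mu H) ∘ (idm (carrier H) ⊠ br (carrier H) (carrier H) ⊠ idm (carrier H)).

Record hopfAlg (S : ribbonCat) := HopfAlg {
  hopf_data :> hopfData S;
  antipV : arr S;
  mu_hom : mu hopf_data ∈ carrier hopf_data ⊗ carrier hopf_data ⇒ carrier hopf_data;
  eta_hom : eta hopf_data ∈ 𝟏 ⇒ carrier hopf_data;
  Delta_hom :
    Delta hopf_data ∈ carrier hopf_data ⇒ carrier hopf_data ⊗ carrier hopf_data;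
  eps_hom : eps hopf_data ∈ carrier hopf_data ⇒ 𝟏;
  antip_inverse :
    inverse_arrows (carrier hopf_data) (carrier hopf_data) (antip hopf_data) antipV;
  mu_assoc : mu hopf_data ∘ (mu hopf_data ⊠ idm (carrier hopf_data))
    = mu hopf_data ∘ (idm (carrier hopf_data) ⊠ mu hopf_data);
  mu_etal : mu hopf_data ∘ (eta hopf_data ⊠ idm (carrier hopf_data))
    = idm (carrier hopf_data);
  mu_etar : mu hopf_data ∘ (idm (carrier hopf_data) ⊠ eta hopf_data)
    = idm (carrier hopf_data);
  Delta_coassoc : (Delta hopf_data ⊠ idm (carrier hopf_data)) ∘ Delta hopf_data
    = (idm (carrier hopf_data) ⊠ Delta hopf_data) ∘ Delta hopf_data;
  Delta_epsl : (eps hopf_data ⊠ idm (carrier hopf_data)) ∘ Delta hopf_data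
    = idm (carrier hopf_data);
  Delta_epsr : (idm (carrier hopf_data) ⊠ eps hopf_data) ∘ Delta hopf_data
    = idm (carrier hopf_data);
  Delta_mu : Delta hopf_data ∘ mu hopf_data
    = mu2 hopf_data ∘ (Delta hopf_data ⊠ Delta hopf_data);
  Delta_eta : Delta hopf_data ∘ eta hopf_data = eta hopf_data ⊠ eta hopf_data;
  eps_mu : eps hopf_data ∘ mu hopf_data = eps hopf_data ⊠ eps hopf_data;
  eps_eta : eps hopf_data ∘ eta hopf_data = idm 𝟏;
  antip_left : mu hopf_data ∘ (antip hopf_data ⊠ idm (carrier hopf_data))
    ∘ Delta hopf_data = eta hopf_data ∘ eps hopf_data;
  antip_right : mu hopf_data ∘ (idm (carrier hopf_data) ⊠ antip hopf_data)
    ∘ Delta hopf_data = eta hopf_data ∘ eps hopf_data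
}.

#[export] Hint Resolve mu_hom eta_hom Delta_hom eps_hom : hom.

Lemma antip_hom (S : ribbonCat) (H : hopfAlg S) : antip H ∈ carrier H ⇒ carrier H.
Proof. by case: (antip_inverse H). Qed.

Lemma antipV_hom (S : ribbonCat) (H : hopfAlg S) : antipV H ∈ carrier H ⇒ carrier H.
Proof. by case: (antip_inverse H). Qed.

#[export] Hint Resolve antip_hom antipV_hom : hom.

(** The dual Hopf algebra.  Multiplication and comultiplication are written
    explicitly; [dual_mu_pairing] and [dual_Delta_pairing] below are the
    equations which determine them.  Unit and counit are the dual arrows of
    [eps] and [eta] up to the canonical isomorphism [coev 𝟏 : 𝟏 -> 𝟏^∨] and its
    inverse [ev 𝟏]. *)
Definition dualHopf (S : ribbonCat) (H : hopfAlg S) : hopfData S :=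
  let H0 := carrier H in
  {| carrier := H0^∨;
     mu := ((ev H0 ∘ (idm H0^∨ ⊠ ev H0 ⊠ idm H0) ∘ (idm (H0^∨ ⊗ H0^∨) ⊠ Delta H))
              ⊠ idm H0^∨)
           ∘ (idm (H0^∨ ⊗ H0^∨) ⊠ coev H0);
     eta := dualarr (eps H) ∘ coev 𝟏;
     Delta := ((ev H0 ∘ (idm H0^∨ ⊠ mu H)) ⊠ idm (H0^∨ ⊗ H0^∨))
           ∘ (idm H0^∨ ⊠ ((idm H0 ⊠ coev H0 ⊠ idm H0^∨) ∘ coev H0));
     eps := ev 𝟏 ∘ dualarr (eta H);
     antip := dualarr (antip H) |}.


Section DualPairing.
Variables (S : ribbonCat) (H : hopfAlg S).
Let H0 := carrier H.

Lemma dual_mu_pairing :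
  ev H0 ∘ (mu (dualHopf H) ⊠ idm H0)
  = ev H0 ∘ (idm H0^∨ ⊠ ev H0 ⊠ idm H0) ∘ (idm (H0^∨ ⊗ H0^∨) ⊠ Delta H).
Proof.
rewrite /=; set P := ev _ ∘ _ ∘ _.
have hP : P ∈ H0^∨ ⊗ H0^∨ ⊗ H0 ⇒ 𝟏 by rewrite /P; hom.
move: P hP => P hP; rewrite -/H0.
rewrite whiskerr; last by typ.
rewrite comp_assoc; [|typ|typ].
have -> : ev H0 ∘ (P ⊠ idm H0^∨ ⊠ idm H0)
    = P ∘ (idm (H0^∨ ⊗ H0^∨ ⊗ H0) ⊠ ev H0).
  have := tarr_slide hP (ev_hom H0).
  by rewrite tarr_unitl tarr_unitr -tarr_assoc tarr_idm => ->.
rewrite -comp_assoc; [|typ|typ].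
rewrite -!tarr_idm -!tarr_assoc -!whiskerl; try typ.
by rewrite zigzag !tarr_idm; compid.
Qed.

Lemma dual_Delta_pairing :
  ev H0 ∘ (idm H0^∨ ⊠ ev H0 ⊠ idm H0) ∘ (Delta (dualHopf H) ⊠ idm (H0 ⊗ H0))
  = ev H0 ∘ (idm H0^∨ ⊠ mu H).
Proof.
rewrite /=; set P := ev _ ∘ (_ ⊠ mu H).
have hP : P ∈ H0^∨ ⊗ H0 ⊗ H0 ⇒ 𝟏 by rewrite /P; hom.
move: P hP => P hP; rewrite -/H0.
set E := ev H0 ∘ (idm H0^∨ ⊠ ev H0 ⊠ idm H0).
set K := _ ∘ coev H0.
have hE : E ∈ H0^∨ ⊗ H0^∨ ⊗ H0 ⊗ H0 ⇒ 𝟏 by rewrite /E; hom.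
have hK : K ∈ 𝟏 ⇒ H0 ⊗ H0 ⊗ H0^∨ ⊗ H0^∨ by rewrite /K; hom.
have KE : (idm (H0 ⊗ H0) ⊠ E) ∘ (K ⊠ idm (H0 ⊗ H0)) = idm (H0 ⊗ H0).
  rewrite /E /K.
  rewrite whiskerr; last by typ.
  rewrite whiskerl; last by typ.
  rewrite comp_assoc; [|typ|typ].
  rewrite -[X in X ∘ _ = _]comp_assoc; [|typ|typ].
  have -> : (idm (H0 ⊗ H0) ⊠ (idm H0^∨ ⊠ ev H0 ⊠ idm H0))
     ∘ (idm H0 ⊠ coev H0 ⊠ idm H0^∨ ⊠ idm (H0 ⊗ H0))
   = (idm H0 ⊠ coev H0 ⊠ idm H0) ∘ (idm H0 ⊠ ev H0 ⊠ idm H0).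
    rewrite -!tarr_idm !tarr_assoc -!whiskerr; try typ.
    rewrite -!tarr_assoc -!whiskerl; try typ.
    congr (_ ⊠ _ ⊠ _).
    rewrite !tarr_assoc -(tarr_assoc (coev H0)) !tarr_idm.
    have := tarr_slide (coev_hom H0) (ev_hom H0).
    by rewrite tarr_unitl tarr_unitr => <-.
  rewrite comp_assoc; [|typ|typ].
  have -> : (idm (H0 ⊗ H0) ⊠ ev H0) ∘ (idm H0 ⊠ coev H0 ⊠ idm H0) = idm (H0 ⊗ H0).
    rewrite -tarr_idm -!tarr_assoc -whiskerl; last by typ.
    by rewrite zigzag.
  have e : (idm H0 ⊠ ev H0 ⊠ idm H0) ∘ (coev H0 ⊠ idm (H0 ⊗ H0)) = idm (H0 ⊗ H0).
    rewrite -tarr_idm !tarr_assoc -whiskerr; last by typ.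
    by rewrite zigzag.
  rewrite -comp_assoc; [|typ|typ].
  by rewrite e; compid.
rewrite whiskerr; last by typ.
rewrite comp_assoc; [|typ|typ].
have -> : E ∘ (P ⊠ idm (H0^∨ ⊗ H0^∨) ⊠ idm (H0 ⊗ H0))
    = P ∘ (idm (H0^∨ ⊗ H0 ⊗ H0) ⊠ E).
  have := tarr_slide hP hE.
  by rewrite tarr_unitl tarr_unitr -tarr_assoc tarr_idm !tob_assoc => ->.
rewrite -comp_assoc; [|typ|typ].
rewrite -[_ ⊗ _ ⊗ _]tob_assoc -!(tarr_idm H0^∨) -!tarr_assoc -whiskerl; last by typ.
by rewrite KE tarr_idm; compid.
Qed.

End DualPairing.

Lemma piv_hom (S : ribbonCat) (U : ob S) : piv U ∈ U ⇒ U^∨^∨.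
Proof. by rewrite /piv; hom. Qed.

Lemma piv_ev (S : ribbonCat) (U : ob S) :
  ev U^∨ ∘ (piv U ⊠ idm U^∨) = ev U ∘ br U U^∨ ∘ (tw U ⊠ idm U^∨).
Proof.
rewrite /piv; set P := ev _ ∘ _ ∘ _.
have hP : P ∈ U ⊗ U^∨ ⇒ 𝟏 by rewrite /P; hom.
move: P hP => P hP.
rewrite whiskerr; last by typ.
rewrite comp_assoc; [|typ|typ].
have -> : ev U^∨ ∘ (P ⊠ idm U^∨^∨ ⊠ idm U^∨) = P ∘ (idm (U ⊗ U^∨) ⊠ ev U^∨).
  have := tarr_slide hP (ev_hom U^∨).
  by rewrite tarr_unitl tarr_unitr -tarr_assoc tarr_idm => ->.
rewrite -comp_assoc; [|typ|typ].
rewrite -!tarr_idm -!tarr_assoc -!whiskerl; try typ.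
by rewrite zigzag !tarr_idm; compid.
Qed.

Lemma br_natE (S : ribbonCat) (A B C D : ob S) (f g : arr S) :
  f ∈ A ⇒ B -> g ∈ C ⇒ D -> br B D ∘ (f ⊠ g) = (g ⊠ f) ∘ br A C.
Proof. by move=> [<- <-] [<- <-]; rewrite br_nat. Qed.

Lemma br_unitl (S : ribbonCat) (U : ob S) : br 𝟏 U = idm U.
Proof.
have [h hV e _] := br_inverse 𝟏 U.
rewrite tob_unitl tob_unitr in h hV e.
have := br_hexl 𝟏 𝟏 U; rewrite tarr_unitl tarr_unitr tob_unitl => ee.
have : brV 𝟏 U ∘ br 𝟏 U = brV 𝟏 U ∘ (br 𝟏 U ∘ br 𝟏 U) by rewrite -ee.
rewrite comp_assoc; [|by typ|by typ].
by rewrite e => ->; symmetry; compid.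
Qed.

(** * Modules over a Hopf algebra *)

Record hmod (S : ribbonCat) (H : hopfAlg S) := HMod {
  mob : ob S;
  act : arr S;
  act_hom : act ∈ carrier H ⊗ mob ⇒ mob;
  act_mu : act ∘ (mu H ⊠ idm mob) = act ∘ (idm (carrier H) ⊠ act);
  act_eta : act ∘ (eta H ⊠ idm mob) = idm mob
}.

#[export] Hint Resolve act_hom : hom.

Section Modules.
Variables (S : ribbonCat) (H : hopfAlg S).
Local Notation H0 := (carrier H).
Implicit Types M N : hmod H.

Definition act2 M N : arr S := (act M ⊠ act N) ∘ (idm H0 ⊠ br H0 (mob M) ⊠ idm (mob N)).

Lemma act2_hom M N : act2 M N ∈ H0 ⊗ H0 ⊗ mob M ⊗ mob N ⇒ mob M ⊗ mob N.
Proof. by rewrite /act2; hom. Qed.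

Lemma mu2_hom : mu2 H ∈ H0 ⊗ H0 ⊗ H0 ⊗ H0 ⇒ H0 ⊗ H0.
Proof. by rewrite /mu2; hom. Qed.

Lemma act2_mu2 M N : act2 M N ∘ (mu2 H ⊠ idm (mob M ⊗ mob N))
  = act2 M N ∘ (idm (H0 ⊗ H0) ⊠ act2 M N).
Proof.
have tc3 (f1 f2 f3 g1 g2 g3 : arr S) : cod f1 = dom g1 -> cod f2 = dom g2 -> cod f3 = dom g3 ->
   (g1 ⊠ g2 ⊠ g3) ∘ (f1 ⊠ f2 ⊠ f3) = (g1 ∘ f1) ⊠ (g2 ∘ f2) ⊠ (g3 ∘ f3).
  by move=> e1 e2 e3; rewrite !tarr_comp // ?dom_tarr ?cod_tarr ?e1 ?e2.
have e1 : (idm H0 ⊠ br H0 (mob M) ⊠ idm (mob N)) ∘ (mu H ⊠ mu H ⊠ idm (mob M ⊗ mob N))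
   = (mu H ⊠ idm (mob M) ⊠ (mu H ⊠ idm (mob N)))
     ∘ (idm (H0 ⊗ H0) ⊠ br (H0 ⊗ H0) (mob M) ⊠ idm (mob N)).
  rewrite -tarr_idm !tarr_assoc -(tarr_assoc _ (mu H)) -(tarr_assoc _ _ (mu H)).
  rewrite tc3; [|typ|typ|typ]. rewrite tc3; [|typ|typ|typ].
  rewrite (br_natE (mu_hom H) (idm_hom (mob M))).
  congr (_ ⊠ _ ⊠ _). by rewrite (idl_hom (mu_hom H)) // (idr_hom (mu_hom H)).
have e2 : (act M ⊠ act N) ∘ (mu H ⊠ idm (mob M) ⊠ (mu H ⊠ idm (mob N)))
   = (act M ⊠ act N) ∘ (idm H0 ⊠ act M ⊠ (idm H0 ⊠ act N)).
  by rewrite -!tarr_comp; try typ; rewrite !act_mu.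
have e3 : (idm H0 ⊠ br H0 (mob M) ⊠ idm (mob N)) ∘ (idm (H0 ⊗ H0) ⊠ (act M ⊠ act N))
   = (idm H0 ⊠ act M ⊠ (idm H0 ⊠ act N))
     ∘ (idm H0 ⊠ br H0 (H0 ⊗ mob M) ⊠ idm (H0 ⊗ mob N)).
  rewrite -tarr_idm !tarr_assoc -(tarr_assoc _ _ (act M)) -(tarr_assoc _ _ (idm H0)).
  rewrite tc3; [|typ|typ|typ]. rewrite tc3; [|typ|typ|typ].
  rewrite (br_natE (idm_hom H0) (act_hom M)).
  congr (_ ⊠ _ ⊠ _).
  by rewrite (idl_hom (act_hom N)) // (idr_hom (act_hom N)).
have e4 : (idm (H0 ⊗ H0) ⊠ br (H0 ⊗ H0) (mob M) ⊠ idm (mob N))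
     ∘ (idm H0 ⊠ br H0 H0 ⊠ idm H0 ⊠ idm (mob M ⊗ mob N))
   = (idm H0 ⊠ br H0 (H0 ⊗ mob M) ⊠ idm (H0 ⊗ mob N))
     ∘ (idm (H0 ⊗ H0) ⊠ (idm H0 ⊠ br H0 (mob M) ⊠ idm (mob N))).
  rewrite -!tarr_idm !tarr_assoc -!whiskerr; try typ.
  rewrite -!tarr_assoc -!whiskerl; try typ.
  congr (_ ⊠ _ ⊠ _).
  rewrite br_hexl br_hexr whiskerl; last by typ.
  rewrite whiskerr; last by typ.
  rewrite -!comp_assoc; try typ.
  have := tarr_slide (br_hom H0 H0) (br_hom H0 (mob M)).
  rewrite -!tarr_idm !tarr_assoc => e.
  by rewrite e.
rewrite /act2 /mu2 whiskerr; last by typ.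
rewrite comp_assoc; [|typ|typ].
rewrite -[_ ∘ (mu H ⊠ mu H ⊠ _)]comp_assoc; [|typ|typ].
rewrite e1 comp_assoc; [|typ|typ].
rewrite e2 -comp_assoc; [|typ|typ].
rewrite e4 whiskerl; last by typ.
rewrite -[RHS]comp_assoc; [|typ|typ].
rewrite [(_ ⊠ br _ _ ⊠ _) ∘ (_ ∘ (idm (H0 ⊗ H0) ⊠ _))]comp_assoc; [|typ|typ].
rewrite e3.
by rewrite -!comp_assoc //; typ.
Qed.

Hint Resolve act2_hom mu2_hom : hom.

Lemma tensor_act_hom M N :
  act2 M N ∘ (Delta H ⊠ idm (mob M ⊗ mob N)) ∈ H0 ⊗ (mob M ⊗ mob N) ⇒ mob M ⊗ mob N.
Proof. by hom. Qed.

Lemma tensor_act_mu M N (r := act2 M N ∘ (Delta H ⊠ idm (mob M ⊗ mob N))) :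
  r ∘ (mu H ⊠ idm (mob M ⊗ mob N)) = r ∘ (idm H0 ⊠ r).
Proof.
rewrite /r; have e := act2_mu2 M N; have h := act2_hom M N.
move: {r} (act2 M N) h e => a h e.
rewrite -comp_assoc; [|typ|typ].
rewrite -whiskerr; last by typ.
rewrite Delta_mu whiskerr; last by typ.
rewrite comp_assoc; [|typ|typ].
rewrite e -!comp_assoc; try typ.
rewrite whiskerl; last by typ.
rewrite [(Delta H ⊠ _) ∘ (_ ∘ _)]comp_assoc; [|typ|typ].
rewrite (tarr_slide (Delta_hom H) h) -!comp_assoc; try typ.
congr (_ ∘ (_ ∘ _)).
rewrite (tarr_lr (Delta_hom H) (Delta_hom H)) whiskerr; last by typ.
by rewrite -!tarr_idm !tarr_assoc.
Qed.

Lemma tensor_act_eta M N (r := act2 M N ∘ (Delta H ⊠ idm (mob M ⊗ mob N))) :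
  r ∘ (eta H ⊠ idm (mob M ⊗ mob N)) = idm (mob M ⊗ mob N).
Proof.
rewrite /r -comp_assoc; [|typ|typ].
rewrite -whiskerr; last by typ.
rewrite Delta_eta /act2 -comp_assoc; [|typ|typ].
have -> : (idm H0 ⊠ br H0 (mob M) ⊠ idm (mob N))
    ∘ (eta H ⊠ eta H ⊠ idm (mob M ⊗ mob N))
  = eta H ⊠ idm (mob M) ⊠ (eta H ⊠ idm (mob N)).
  rewrite -tarr_idm !tarr_assoc -whiskerr; last by typ.
  rewrite -!tarr_assoc -tarr_comp; [|typ|typ].
  rewrite (br_natE (eta_hom H) (idm_hom (mob M))) br_unitl.
  rewrite (idl_hom (eta_hom H)) // (idr_hom (tarr_hom (idm_hom (mob M)) (eta_hom H))) ?tob_unitr //.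
  by rewrite !tarr_assoc.
rewrite -tarr_comp; [|typ|typ].
by rewrite !act_eta tarr_idm.
Qed.

Definition tensor_mod M N : hmod H :=
  HMod (tensor_act_hom M N) (tensor_act_mu M N) (tensor_act_eta M N).

Lemma unit_act_hom : eps H ∈ H0 ⊗ 𝟏 ⇒ 𝟏.
Proof. by hom. Qed.

Lemma unit_act_mu : eps H ∘ (mu H ⊠ idm 𝟏) = eps H ∘ (idm H0 ⊠ eps H).
Proof.
rewrite tarr_unitr eps_mu (tarr_lr (eps_hom H) (eps_hom H)).
by rewrite tarr_unitr.
Qed.

Lemma unit_act_eta : eps H ∘ (eta H ⊠ idm 𝟏) = idm 𝟏.
Proof. by rewrite tarr_unitr eps_eta. Qed.

Definition unit_mod : hmod H := HMod unit_act_hom unit_act_mu unit_act_eta.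

Lemma free_act_hom (X : ob S) : mu H ⊠ idm X ∈ H0 ⊗ (H0 ⊗ X) ⇒ H0 ⊗ X.
Proof. by hom. Qed.

Lemma free_act_mu (X : ob S) :
  (mu H ⊠ idm X) ∘ (mu H ⊠ idm (H0 ⊗ X)) = (mu H ⊠ idm X) ∘ (idm H0 ⊠ (mu H ⊠ idm X)).
Proof.
rewrite -tarr_idm !tarr_assoc -!whiskerr; try typ.
by rewrite mu_assoc.
Qed.

Lemma free_act_eta (X : ob S) : (mu H ⊠ idm X) ∘ (eta H ⊠ idm (H0 ⊗ X)) = idm (H0 ⊗ X).
Proof.
rewrite -!tarr_idm !tarr_assoc -!whiskerr; last by typ.
by rewrite mu_etal.
Qed.

Definition free_mod (X : ob S) : hmod H :=
  HMod (free_act_hom X) (free_act_mu X) (free_act_eta X).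

Definition is_modhom M N (f : arr S) : Prop :=
  f ∈ mob M ⇒ mob N /\ f ∘ act M = act N ∘ (idm H0 ⊠ f).

Lemma idm_modhom M : is_modhom M M (idm (mob M)).
Proof.
by split; [hom | rewrite tarr_idm (idl_hom (act_hom M)) // (idr_hom (act_hom M))].
Qed.

Lemma comp_modhom M N P f g : is_modhom N P g -> is_modhom M N f -> is_modhom M P (g ∘ f).
Proof.
move=> [hg eg] [hf ef]; split; first by hom.
rewrite -comp_assoc; [|typ|typ].
rewrite ef comp_assoc; [|typ|typ].
rewrite eg whiskerl; last by typ.
by rewrite -comp_assoc //; typ.
Qed.

Lemma tensor_modhom M M' N N' f g : is_modhom M M' f -> is_modhom N N' g ->
  is_modhom (tensor_mod M N) (tensor_mod M' N') (f ⊠ g).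
Proof.
move=> [hf ef] [hg eg]; split; rewrite /=; first by hom.
rewrite /act2.
have e1 : (f ⊠ g) ∘ (act M ⊠ act N) = (act M' ⊠ act N') ∘ (idm H0 ⊠ f ⊠ idm H0 ⊠ g).
  rewrite -tarr_comp; [|typ|typ].
  by rewrite ef eg tarr_comp ?tarr_assoc //; typ.
have e2 : (idm H0 ⊠ f ⊠ idm H0 ⊠ g) ∘ (idm H0 ⊠ br H0 (mob M) ⊠ idm (mob N))
    = (idm H0 ⊠ br H0 (mob M') ⊠ idm (mob N')) ∘ (idm (H0 ⊗ H0) ⊠ (f ⊠ g)).
  rewrite -tarr_idm -!tarr_assoc (tarr_assoc f) (tarr_assoc _ f).
  rewrite -tarr_comp; [|typ|typ].
  rewrite -[in RHS]tarr_comp; [|typ|typ].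
  rewrite -tarr_comp; [|typ|typ].
  rewrite -[in RHS]tarr_comp; [|typ|typ].
  rewrite (br_natE (idm_hom H0) hf).
  by rewrite (idl_hom hg) // (idr_hom hg).
have e3 : (idm (H0 ⊗ H0) ⊠ (f ⊠ g)) ∘ (Delta H ⊠ idm (mob M ⊗ mob N))
    = (Delta H ⊠ idm (mob M' ⊗ mob N')) ∘ (idm H0 ⊠ (f ⊠ g)).
  by rewrite (tarr_slide (Delta_hom H) (tarr_hom hf hg)).
rewrite !comp_assoc; try typ.
rewrite e1 -[_ ∘ (idm H0 ⊠ br _ _ ⊠ _)]comp_assoc; [|typ|typ].
rewrite e2 -!comp_assoc; try typ.
by rewrite e3.
Qed.

Lemma free_modhom (X Y : ob S) (f : arr S) : f ∈ X ⇒ Y ->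
  is_modhom (free_mod X) (free_mod Y) (idm H0 ⊠ f).
Proof.
move=> hf; split; rewrite /=; first by hom.
by rewrite tarr_assoc tarr_idm (tarr_slide (mu_hom H) hf).
Qed.

End Modules.

#[export] Hint Resolve act2_hom : hom.

(** * Additive structure on the base category

    [add] and [opp] are only constrained on arrows with common domain and
    codomain.  Biadditivity of the tensor product ([tarr_addl], [tarr_addr]) is
    part of the usual notion of an additive monoidal category, and in the
    presence of duals it is automatic. *)

Record additiveStr (S : strictMonCat) := AdditiveStr {
  add : arr S -> arr S -> arr S;
  opp : arr S -> arr S;
  zero : ob S -> ob S -> arr S;
  zob : ob S;
  bip : ob S -> ob S -> ob S;
  in1 : ob S -> ob S -> arr S;
  in2 : ob S -> ob S -> arr S;
  pr1 : ob S -> ob S -> arr S;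
  pr2 : ob S -> ob S -> arr S;
  add_hom : forall A B f g, f ∈ A ⇒ B -> g ∈ A ⇒ B -> add f g ∈ A ⇒ B;
  opp_hom : forall A B f, f ∈ A ⇒ B -> opp f ∈ A ⇒ B;
  zero_hom : forall A B, zero A B ∈ A ⇒ B;
  addA : forall A B f g h, f ∈ A ⇒ B -> g ∈ A ⇒ B -> h ∈ A ⇒ B ->
    add f (add g h) = add (add f g) h;
  addC : forall A B f g, f ∈ A ⇒ B -> g ∈ A ⇒ B -> add f g = add g f;
  add0 : forall A B f, f ∈ A ⇒ B -> add (zero A B) f = f;
  addN : forall A B f, f ∈ A ⇒ B -> add (opp f) f = zero A B;
  comp_addl : forall A B C f g h, f ∈ A ⇒ B -> g ∈ A ⇒ B -> h ∈ B ⇒ C ->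
    h ∘ add f g = add (h ∘ f) (h ∘ g);
  comp_addr : forall A B C f g h, f ∈ B ⇒ C -> g ∈ B ⇒ C -> h ∈ A ⇒ B ->
    add f g ∘ h = add (f ∘ h) (g ∘ h);
  tarr_addl : forall A B f g h, f ∈ A ⇒ B -> g ∈ A ⇒ B ->
    h ⊠ add f g = add (h ⊠ f) (h ⊠ g);
  tarr_addr : forall A B f g h, f ∈ A ⇒ B -> g ∈ A ⇒ B ->
    add f g ⊠ h = add (f ⊠ h) (g ⊠ h);
  idm_zob : idm zob = zero zob zob;
  in1_hom : forall A B, in1 A B ∈ A ⇒ bip A B;
  in2_hom : forall A B, in2 A B ∈ B ⇒ bip A B;
  pr1_hom : forall A B, pr1 A B ∈ bip A B ⇒ A;
  pr2_hom : forall A B, pr2 A B ∈ bip A B ⇒ B;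
  pr1_in1 : forall A B, pr1 A B ∘ in1 A B = idm A;
  pr2_in2 : forall A B, pr2 A B ∘ in2 A B = idm B;
  pr1_in2 : forall A B, pr1 A B ∘ in2 A B = zero B A;
  pr2_in1 : forall A B, pr2 A B ∘ in1 A B = zero A B;
  bip_idm : forall A B,
    add (in1 A B ∘ pr1 A B) (in2 A B ∘ pr2 A B) = idm (bip A B)
}.

#[export] Hint Resolve add_hom zero_hom in1_hom in2_hom pr1_hom pr2_hom : hom.

Section Biproduct.
Variables (S : strictMonCat) (a : additiveStr S).
Implicit Types (A B C D : ob S) (f g h : arr S).

Definition bsum f g : arr S :=
  add a (in1 a (cod f) (cod g) ∘ f ∘ pr1 a (dom f) (dom g))
        (in2 a (cod f) (cod g) ∘ g ∘ pr2 a (dom f) (dom g)).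

Lemma bsumE A B C D f g : f ∈ A ⇒ B -> g ∈ C ⇒ D ->
  bsum f g = add a (in1 a B D ∘ f ∘ pr1 a A C) (in2 a B D ∘ g ∘ pr2 a A C).
Proof. by move=> [<- <-] [<- <-]. Qed.

Lemma bsum_hom A B C D f g : f ∈ A ⇒ B -> g ∈ C ⇒ D -> bsum f g ∈ bip a A C ⇒ bip a B D.
Proof. by move=> hf hg; rewrite (bsumE hf hg); apply: add_hom; hom. Qed.

Lemma bsum_idm A B : bsum (idm A) (idm B) = idm (bip a A B).
Proof.
rewrite (bsumE (idm_hom A) (idm_hom B)) -bip_idm.
by rewrite (idr_hom (in1_hom a A B)) // (idr_hom (in2_hom a A B)).
Qed.

Lemma comp_zerol A B C f : f ∈ A ⇒ B -> zero a B C ∘ f = zero a A C.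
Proof.
move=> hf; have h0 := zero_hom a B C.
have hz : zero a B C ∘ f ∈ A ⇒ C by hom.
have := comp_addr a h0 h0 hf; rewrite (add0 a h0) => e.
have := addN a hz; rewrite {2}e (addA a (opp_hom a hz) hz hz) (addN a hz) => <-.
by rewrite (add0 a hz).
Qed.

Lemma comp_zeror A B C f : f ∈ B ⇒ C -> f ∘ zero a A B = zero a A C.
Proof.
move=> hf; have h0 := zero_hom a A B.
have hz : f ∘ zero a A B ∈ A ⇒ C by hom.
have := comp_addl a h0 h0 hf; rewrite (add0 a h0) => e.
have := addN a hz; rewrite {2}e (addA a (opp_hom a hz) hz hz) (addN a hz) => <-.
by rewrite (add0 a hz).
Qed.

Lemma addr0 A B f : f ∈ A ⇒ B -> add a f (zero a A B) = f.
Proof. by move=> hf; rewrite (addC a hf (zero_hom a A B)) add0. Qed.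

Lemma bsum_in1 A B C D f g : f ∈ A ⇒ B -> g ∈ C ⇒ D ->
  bsum f g ∘ in1 a A C = in1 a B D ∘ f.
Proof.
move=> hf hg; rewrite (bsumE hf hg).
have h1 : in1 a B D ∘ f ∘ pr1 a A C ∈ bip a A C ⇒ bip a B D by hom.
have h2 : in2 a B D ∘ g ∘ pr2 a A C ∈ bip a A C ⇒ bip a B D by hom.
rewrite (comp_addr a h1 h2 (in1_hom a A C)) -!comp_assoc; try typ.
rewrite pr1_in1 pr2_in1 (comp_zeror _ hg) (comp_zeror _ (in2_hom a B D)).
by rewrite (idr_hom hf) // addr0 //; hom.
Qed.

Lemma bsum_in2 A B C D f g : f ∈ A ⇒ B -> g ∈ C ⇒ D ->
  bsum f g ∘ in2 a A C = in2 a B D ∘ g.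
Proof.
move=> hf hg; rewrite (bsumE hf hg).
have h1 : in1 a B D ∘ f ∘ pr1 a A C ∈ bip a A C ⇒ bip a B D by hom.
have h2 : in2 a B D ∘ g ∘ pr2 a A C ∈ bip a A C ⇒ bip a B D by hom.
rewrite (comp_addr a h1 h2 (in2_hom a A C)) -!comp_assoc; try typ.
rewrite pr1_in2 pr2_in2 (comp_zeror _ hf) (comp_zeror _ (in1_hom a B D)).
by rewrite (idr_hom hg) // add0 //; hom.
Qed.

(** Arrows out of [X ⊗ (A ⊕ B)] are determined on the two summands. *)
Lemma bip_ext A B C X f g : f ∈ X ⊗ bip a A B ⇒ C -> g ∈ X ⊗ bip a A B ⇒ C ->
  f ∘ (idm X ⊠ in1 a A B) = g ∘ (idm X ⊠ in1 a A B) ->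
  f ∘ (idm X ⊠ in2 a A B) = g ∘ (idm X ⊠ in2 a A B) -> f = g.
Proof.
move=> hf hg e1 e2.
have h1 : in1 a A B ∘ pr1 a A B ∈ bip a A B ⇒ bip a A B by hom.
have h2 : in2 a A B ∘ pr2 a A B ∈ bip a A B ⇒ bip a A B by hom.
have ee : idm (X ⊗ bip a A B)
    = add a ((idm X ⊠ in1 a A B) ∘ (idm X ⊠ pr1 a A B))
            ((idm X ⊠ in2 a A B) ∘ (idm X ⊠ pr2 a A B)).
  by rewrite -tarr_idm -bip_idm (tarr_addl a _ h1 h2) !whiskerl //; typ.
have k1 : (idm X ⊠ in1 a A B) ∘ (idm X ⊠ pr1 a A B) ∈ X ⊗ bip a A B ⇒ X ⊗ bip a A B.
  by hom.
have k2 : (idm X ⊠ in2 a A B) ∘ (idm X ⊠ pr2 a A B) ∈ X ⊗ bip a A B ⇒ X ⊗ bip a A B.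
  by hom.
rewrite -(idr_hom hf erefl) -(idr_hom hg erefl) ee.
rewrite (comp_addl a k1 k2 hf) (comp_addl a k1 k2 hg) !comp_assoc; try typ.
by rewrite e1 e2.
Qed.

Lemma bip_ext0 A B C f g : f ∈ bip a A B ⇒ C -> g ∈ bip a A B ⇒ C ->
  f ∘ in1 a A B = g ∘ in1 a A B -> f ∘ in2 a A B = g ∘ in2 a A B -> f = g.
Proof.
move=> hf hg e1 e2.
apply: (bip_ext (X := 𝟏) (C := C) (A := A) (B := B)); rewrite ?tob_unitl //;
by rewrite !tarr_unitl.
Qed.

Lemma bsum_comp A B C A' B' C' f g f' g' :
  g ∈ B ⇒ C -> f ∈ A ⇒ B -> g' ∈ B' ⇒ C' -> f' ∈ A' ⇒ B' ->
  bsum (g ∘ f) (g' ∘ f') = bsum g g' ∘ bsum f f'.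
Proof.
move=> hg hf hg' hf'.
have k : g ∘ f ∈ A ⇒ C by hom.
have k' : g' ∘ f' ∈ A' ⇒ C' by hom.
have b1 := bsum_hom hf hf'; have b2 := bsum_hom hg hg'; have b3 := bsum_hom k k'.
apply: (bip_ext0 b3); first by hom.
  rewrite (bsum_in1 k k') -[RHS]comp_assoc; [|typ|typ].
  rewrite (bsum_in1 hf hf') [RHS]comp_assoc; [|typ|typ].
  by rewrite (bsum_in1 hg hg') -comp_assoc //; typ.
rewrite (bsum_in2 k k') -[RHS]comp_assoc; [|typ|typ].
rewrite (bsum_in2 hf hf') [RHS]comp_assoc; [|typ|typ].
by rewrite (bsum_in2 hg hg') -comp_assoc //; typ.
Qed.

End Biproduct.

Section BiproductModule.
Variables (S : ribbonCat) (a : additiveStr S) (H : hopfAlg S).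
Local Notation H0 := (carrier H).
Implicit Types M N : hmod H.

Lemma tarr_zeror (X A B : ob S) : idm X ⊠ zero a A B = zero a (X ⊗ A) (X ⊗ B).
Proof.
have h0 := zero_hom a A B.
have hz : idm X ⊠ zero a A B ∈ X ⊗ A ⇒ X ⊗ B by hom.
have := tarr_addl a (idm X) h0 h0; rewrite (add0 a h0) => e.
have := addN a hz; rewrite {2}e (addA a (opp_hom a hz) hz hz) (addN a hz) => <-.
by rewrite (add0 a hz).
Qed.

Definition bip_act M N : arr S :=
  add a (in1 a (mob M) (mob N) ∘ act M ∘ (idm H0 ⊠ pr1 a (mob M) (mob N)))
        (in2 a (mob M) (mob N) ∘ act N ∘ (idm H0 ⊠ pr2 a (mob M) (mob N))).

Lemma bip_act_hom M N : bip_act M N ∈ H0 ⊗ bip a (mob M) (mob N) ⇒ bip a (mob M) (mob N).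
Proof. by rewrite /bip_act; apply: add_hom; hom. Qed.

Lemma bip_act_in1 M N :
  bip_act M N ∘ (idm H0 ⊠ in1 a (mob M) (mob N)) = in1 a (mob M) (mob N) ∘ act M.
Proof.
rewrite /bip_act; set x := in1 a _ _; set y := in2 a _ _.
set p := pr1 a _ _; set q := pr2 a _ _.
have hx : x ∈ _ ⇒ _ := in1_hom a _ _; have hy : y ∈ _ ⇒ _ := in2_hom a _ _.
have hp : p ∈ _ ⇒ _ := pr1_hom a _ _; have hq : q ∈ _ ⇒ _ := pr2_hom a _ _.
have h1 : x ∘ act M ∘ (idm H0 ⊠ p) ∈ H0 ⊗ bip a (mob M) (mob N) ⇒ bip a (mob M) (mob N).
  by hom.
have h2 : y ∘ act N ∘ (idm H0 ⊠ q) ∈ H0 ⊗ bip a (mob M) (mob N) ⇒ bip a (mob M) (mob N).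
  by hom.
have h3 : idm H0 ⊠ x ∈ H0 ⊗ mob M ⇒ H0 ⊗ bip a (mob M) (mob N) by hom.
rewrite (comp_addr a h1 h2 h3) -!comp_assoc; try typ.
rewrite -!whiskerl; try typ.
rewrite /p /q /x pr1_in1 pr2_in1 tarr_idm tarr_zeror.
rewrite (comp_zeror a _ (act_hom N)) (comp_zeror a _ hy).
by rewrite (idr_hom (act_hom M)) // addr0 //; hom.
Qed.

Lemma bip_act_in2 M N :
  bip_act M N ∘ (idm H0 ⊠ in2 a (mob M) (mob N)) = in2 a (mob M) (mob N) ∘ act N.
Proof.
rewrite /bip_act; set x := in1 a _ _; set y := in2 a _ _.
set p := pr1 a _ _; set q := pr2 a _ _.
have hx : x ∈ _ ⇒ _ := in1_hom a _ _; have hy : y ∈ _ ⇒ _ := in2_hom a _ _.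
have hp : p ∈ _ ⇒ _ := pr1_hom a _ _; have hq : q ∈ _ ⇒ _ := pr2_hom a _ _.
have h1 : x ∘ act M ∘ (idm H0 ⊠ p) ∈ H0 ⊗ bip a (mob M) (mob N) ⇒ bip a (mob M) (mob N).
  by hom.
have h2 : y ∘ act N ∘ (idm H0 ⊠ q) ∈ H0 ⊗ bip a (mob M) (mob N) ⇒ bip a (mob M) (mob N).
  by hom.
have h3 : idm H0 ⊠ y ∈ H0 ⊗ mob N ⇒ H0 ⊗ bip a (mob M) (mob N) by hom.
rewrite (comp_addr a h1 h2 h3) -!comp_assoc; try typ.
rewrite -!whiskerl; try typ.
rewrite /p /q /y pr1_in2 pr2_in2 tarr_idm tarr_zeror.
rewrite (comp_zeror a _ (act_hom M)) (comp_zeror a _ hx).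
by rewrite (idr_hom (act_hom N)) // add0 //; hom.
Qed.

Hint Resolve bip_act_hom : hom.

Lemma bip_act_mu M N : bip_act M N ∘ (mu H ⊠ idm (bip a (mob M) (mob N)))
  = bip_act M N ∘ (idm H0 ⊠ bip_act M N).
Proof.
have h := bip_act_hom M N.
apply: (bip_ext (X := H0 ⊗ H0) (A := mob M) (B := mob N) (C := bip a (mob M) (mob N)));
  [by hom | by hom | |].
- have e := bip_act_in1 M N; move: (bip_act M N) h e => r h e.
  rewrite -comp_assoc; [|typ|typ].
  rewrite (tarr_slide (mu_hom H) (in1_hom a _ _)) comp_assoc; [|typ|typ].
  rewrite e -[RHS]comp_assoc; [|typ|typ].
  rewrite -tarr_idm -tarr_assoc -whiskerl; last by typ.
  rewrite e whiskerl; last by typ.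
  rewrite [RHS]comp_assoc; [|typ|typ].
  by rewrite e -!comp_assoc; try typ; rewrite act_mu.
- have e := bip_act_in2 M N; move: (bip_act M N) h e => r h e.
  rewrite -comp_assoc; [|typ|typ].
  rewrite (tarr_slide (mu_hom H) (in2_hom a _ _)) comp_assoc; [|typ|typ].
  rewrite e -[RHS]comp_assoc; [|typ|typ].
  rewrite -tarr_idm -tarr_assoc -whiskerl; last by typ.
  rewrite e whiskerl; last by typ.
  rewrite [RHS]comp_assoc; [|typ|typ].
  by rewrite e -!comp_assoc; try typ; rewrite act_mu.
Qed.

Lemma bip_act_eta M N :
  bip_act M N ∘ (eta H ⊠ idm (bip a (mob M) (mob N))) = idm (bip a (mob M) (mob N)).
Proof.
have h := bip_act_hom M N.
apply: (bip_ext0 (A := mob M) (B := mob N) (C := bip a (mob M) (mob N)));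
  [by hom | by hom | |].
- have e := bip_act_in1 M N; move: (bip_act M N) h e => r h e.
  rewrite -comp_assoc; [|typ|typ].
  have := tarr_slide (eta_hom H) (in1_hom a (mob M) (mob N)).
  rewrite tarr_unitl => ->; rewrite comp_assoc; [|typ|typ].
  rewrite e -comp_assoc; [|typ|typ].
  rewrite act_eta (idr_hom (in1_hom a _ _)) //.
  by rewrite (idl_hom (in1_hom a _ _)).
- have e := bip_act_in2 M N; move: (bip_act M N) h e => r h e.
  rewrite -comp_assoc; [|typ|typ].
  have := tarr_slide (eta_hom H) (in2_hom a (mob M) (mob N)).
  rewrite tarr_unitl => ->; rewrite comp_assoc; [|typ|typ].
  rewrite e -comp_assoc; [|typ|typ].
  rewrite act_eta (idr_hom (in2_hom a _ _)) //.
  by rewrite (idl_hom (in2_hom a _ _)).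
Qed.

Definition bip_mod M N : hmod H :=
  HMod (bip_act_hom M N) (bip_act_mu M N) (bip_act_eta M N).

Lemma bsum_modhom M M' N N' f g : is_modhom M M' f -> is_modhom N N' g ->
  is_modhom (bip_mod M N) (bip_mod M' N') (bsum a f g).
Proof.
move=> [hf ef] [hg eg].
have hb := bsum_hom a hf hg; split=> //=.
have i1 := bsum_in1 a hf hg; have i2 := bsum_in2 a hf hg.
move: (bsum a f g) hb i1 i2 => b hb i1 i2.
have h := bip_act_hom M N; have h' := bip_act_hom M' N'.
apply: (bip_ext (X := H0) (A := mob M) (B := mob N) (C := bip a (mob M') (mob N')));
  [by hom | by hom | |].
- have e := bip_act_in1 M N; have e' := bip_act_in1 M' N'.
  move: (bip_act M N) h e (bip_act M' N') h' e' => r h e r' h' e'.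
  rewrite -comp_assoc; [|typ|typ].
  rewrite e comp_assoc; [|typ|typ].
  rewrite i1 -comp_assoc; [|typ|typ].
  rewrite ef -[RHS]comp_assoc; [|typ|typ].
  rewrite -whiskerl; last by typ.
  rewrite i1 whiskerl; last by typ.
  rewrite !comp_assoc; try typ.
  by rewrite e'.
- have e := bip_act_in2 M N; have e' := bip_act_in2 M' N'.
  move: (bip_act M N) h e (bip_act M' N') h' e' => r h e r' h' e'.
  rewrite -comp_assoc; [|typ|typ].
  rewrite e comp_assoc; [|typ|typ].
  rewrite i2 -comp_assoc; [|typ|typ].
  rewrite eg -[RHS]comp_assoc; [|typ|typ].
  rewrite -whiskerl; last by typ.
  rewrite i2 whiskerl; last by typ.
  rewrite !comp_assoc; try typ.
  by rewrite e'.
Qed.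

End BiproductModule.

(** * Categories, tensor functors and monoidal categories *)

Record category := Category {
  cob : Type;
  chom : cob -> cob -> Type;
  cid : forall X, chom X X;
  ccomp : forall X Y Z, chom Y Z -> chom X Y -> chom X Z;
  ccomp_idl : forall X Y (f : chom X Y), ccomp (cid Y) f = f;
  ccomp_idr : forall X Y (f : chom X Y), ccomp f (cid X) = f;
  ccomp_assoc : forall X Y Z W (h : chom Z W) (g : chom Y Z) (f : chom X Y),
    ccomp h (ccomp g f) = ccomp (ccomp h g) f
}.

Notation "g ∘c f" := (ccomp g f) (at level 40, left associativity) : ribbon_scope.

Arguments cid {c} X.

Definition is_iso (C : category) (X Y : cob C) (f : chom X Y) : Prop :=
  exists g : chom Y X, g ∘c f = cid X /\ f ∘c g = cid Y.

Record functor (C D : category) := Functor {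
  fob :> cob C -> cob D;
  fmap : forall X Y, chom X Y -> chom (fob X) (fob Y);
  fmap_id : forall X, fmap (cid X) = cid (fob X);
  fmap_comp : forall X Y Z (g : chom Y Z) (f : chom X Y),
    fmap (g ∘c f) = fmap g ∘c fmap f
}.

Definition is_equivalence (C D : category) (F : functor C D) : Prop :=
  exists (G : functor D C)
    (u : forall X : cob C, chom X (G (F X)))
    (v : forall Y : cob D, chom (F (G Y)) Y),
  [/\ forall X, is_iso (u X), forall Y, is_iso (v Y),
      forall X X' (f : chom X X'), u X' ∘c f = fmap G (fmap F f) ∘c u X
    & forall Y Y' (f : chom Y Y'), v Y' ∘c fmap F (fmap G f) = f ∘c v Y].

Record tensorCat := TensorCat {
  tcat :> category;
  tten : cob tcat -> cob tcat -> cob tcat;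
  tmap : forall X X' Y Y', chom X X' -> chom Y Y' -> chom (tten X Y) (tten X' Y');
  tone : cob tcat;
  tmap_id : forall X Y, tmap (cid X) (cid Y) = cid (tten X Y);
  tmap_comp : forall X X' X'' Y Y' Y'' (g : chom X' X'') (f : chom X X')
    (g' : chom Y' Y'') (f' : chom Y Y'),
    tmap (g ∘c f) (g' ∘c f') = tmap g g' ∘c tmap f f'
}.

Arguments tone {t}.

Notation "X ⊗c Y" := (tten X Y) (at level 36, left associativity) : ribbon_scope.
Notation "f ⊠c g" := (tmap f g) (at level 36, left associativity) : ribbon_scope.

Record monoidalStr (C : tensorCat) := MonoidalStr {
  assoc : forall X Y Z : cob C, chom (X ⊗c (Y ⊗c Z)) (X ⊗c Y ⊗c Z);
  lunit : forall X : cob C, chom (tone ⊗c X) X;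
  runit : forall X : cob C, chom (X ⊗c tone) X;
  assoc_iso : forall X Y Z, is_iso (assoc X Y Z);
  lunit_iso : forall X, is_iso (lunit X);
  runit_iso : forall X, is_iso (runit X);
  assoc_nat : forall X X' Y Y' Z Z'
    (f : chom X X') (g : chom Y Y') (h : chom Z Z'),
    assoc X' Y' Z' ∘c (f ⊠c (g ⊠c h)) = (f ⊠c g ⊠c h) ∘c assoc X Y Z;
  lunit_nat : forall X Y (f : chom X Y), lunit Y ∘c (cid tone ⊠c f) = f ∘c lunit X;
  runit_nat : forall X Y (f : chom X Y), runit Y ∘c (f ⊠c cid tone) = f ∘c runit X;
  pentagon : forall X Y Z W,
    assoc (X ⊗c Y) Z W ∘c assoc X Y (Z ⊗c W)
    = (assoc X Y Z ⊠c cid W) ∘c assoc X (Y ⊗c Z) W ∘c (cid X ⊠c assoc Y Z W);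
  triangle : forall X Y,
    (runit X ⊠c cid Y) ∘c assoc X tone Y = cid X ⊠c lunit Y
}.

Record monFunctor (C D : tensorCat) (M : monoidalStr C) (N : monoidalStr D) := MonFunctor {
  mfun :> functor C D;
  mf0 : chom tone (mfun tone);
  mf2 : forall X Y, chom (mfun X ⊗c mfun Y) (mfun (X ⊗c Y));
  mf0_iso : is_iso mf0;
  mf2_iso : forall X Y, is_iso (mf2 X Y);
  mf2_nat : forall X X' Y Y' (f : chom X X') (g : chom Y Y'),
    mf2 X' Y' ∘c (fmap mfun f ⊠c fmap mfun g) = fmap mfun (f ⊠c g) ∘c mf2 X Y;
  mf_assoc : forall X Y Z,
    fmap mfun (assoc M X Y Z) ∘c mf2 X (Y ⊗c Z) ∘c (cid (mfun X) ⊠c mf2 Y Z)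
    = mf2 (X ⊗c Y) Z ∘c (mf2 X Y ⊠c cid (mfun Z)) ∘c assoc N (mfun X) (mfun Y) (mfun Z);
  mf_lunit : forall X,
    fmap mfun (lunit M X) ∘c mf2 tone X ∘c (mf0 ⊠c cid (mfun X)) = lunit N (mfun X);
  mf_runit : forall X,
    fmap mfun (runit M X) ∘c mf2 X tone ∘c (cid (mfun X) ⊠c mf0) = runit N (mfun X)
}.

Definition monoidally_equivalent (C D : tensorCat) (M : monoidalStr C) (N : monoidalStr D) :
  Prop := exists F : monFunctor M N, is_equivalence F.

(** Disjoint union and direct sum (objects and arrows are pairs) of two
    categories. *)

Section SumCat.
Variables C D : category.

Definition sum_hom (X Y : cob C + cob D) : Type :=
  match X, Y with
  | inl A, inl B => chom A B
  | inr A, inr B => chom A B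
  | _, _ => False
  end.

Definition sum_id (X : cob C + cob D) : sum_hom X X :=
  match X with inl A => cid A | inr A => cid A end.

Definition sum_comp (X Y Z : cob C + cob D) : sum_hom Y Z -> sum_hom X Y -> sum_hom X Z :=
  match X, Y, Z return sum_hom Y Z -> sum_hom X Y -> sum_hom X Z with
  | inl A, inl B, inl E => fun g f => g ∘c f
  | inr A, inr B, inr E => fun g f => g ∘c f
  | inl _, inr _, _ | inr _, inl _, _ => fun _ f => False_rect _ f
  | _, inl _, inr _ | _, inr _, inl _ => fun g _ => False_rect _ g
  end.

Lemma sum_comp_idl X Y (f : sum_hom X Y) : sum_comp (sum_id Y) f = f.
Proof. by case: X f => A; case: Y => B //= f; rewrite ccomp_idl. Qed.

Lemma sum_comp_idr X Y (f : sum_hom X Y) : sum_comp f (sum_id X) = f.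
Proof. by case: X f => A; case: Y => B //= f; rewrite ccomp_idr. Qed.

Lemma sum_comp_assoc X Y Z W (h : sum_hom Z W) (g : sum_hom Y Z) (f : sum_hom X Y) :
  sum_comp h (sum_comp g f) = sum_comp (sum_comp h g) f.
Proof.
case: X f => A; case: Y g => B; case: Z h => E; case: W => K //= h g f;
by rewrite ?ccomp_assoc.
Qed.

Definition sum_cat : category := Category sum_comp_idl sum_comp_idr sum_comp_assoc.

Lemma prod_comp_idl (X Y : cob C * cob D) (f : chom X.1 Y.1 * chom X.2 Y.2) :
  (cid Y.1 ∘c f.1, cid Y.2 ∘c f.2) = f.
Proof. by case: f => f0 f1; rewrite !ccomp_idl. Qed.

Lemma prod_comp_idr (X Y : cob C * cob D) (f : chom X.1 Y.1 * chom X.2 Y.2) :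
  (f.1 ∘c cid X.1, f.2 ∘c cid X.2) = f.
Proof. by case: f => f0 f1; rewrite !ccomp_idr. Qed.

Lemma prod_comp_assoc (X Y Z W : cob C * cob D) (h : chom Z.1 W.1 * chom Z.2 W.2)
    (g : chom Y.1 Z.1 * chom Y.2 Z.2) (f : chom X.1 Y.1 * chom X.2 Y.2) :
  (h.1 ∘c (g.1 ∘c f.1), h.2 ∘c (g.2 ∘c f.2)) = (h.1 ∘c g.1 ∘c f.1, h.2 ∘c g.2 ∘c f.2).
Proof. by rewrite !ccomp_assoc. Qed.

Definition dsum_cat : category :=
  {| cob := cob C * cob D;
     chom := fun X Y => (chom X.1 Y.1 * chom X.2 Y.2)%type;
     cid := fun X => (cid X.1, cid X.2);
     ccomp := fun X Y Z g f => (g.1 ∘c f.1, g.2 ∘c f.2);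
     ccomp_idl := prod_comp_idl;
     ccomp_idr := prod_comp_idr;
     ccomp_assoc := prod_comp_assoc |}.

End SumCat.

(** * The categories [S] and [Rep H] *)

Lemma sig_ext (T : Type) (P : T -> Prop) (x y : {z | P z}) : sval x = sval y -> x = y.
Proof.
case: x y => [x px] [y py] /= e; case: y / e py => py.
by rewrite (proof_irrelevance _ px py).
Qed.

Section BaseCat.
Variable S : strictMonCat.

Definition base_hom (A B : ob S) : Type := {f : arr S | f ∈ A ⇒ B}.

Definition base_id A : base_hom A A := exist _ (idm A) (idm_hom A).

Definition base_comp A B C (g : base_hom B C) (f : base_hom A B) : base_hom A C :=
  exist _ (sval g ∘ sval f) (comp_hom_eq (svalP g) (svalP f) erefl).

Definition base_cat : category.
Proof.
refine (@Category (ob S) base_hom base_id base_comp _ _ _).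
- by abstract (move=> A B [f hf]; apply: sig_ext => /=; compid).
- by abstract (move=> A B [f hf]; apply: sig_ext => /=; compid).
- by abstract (move=> A B C D [h hh] [g hg] [f hf]; apply: sig_ext => /=;
    rewrite comp_assoc //; typ).
Defined.

End BaseCat.

Section RepCat.
Variables (S : ribbonCat) (H : hopfAlg S).

Definition mod_hom (M N : hmod H) : Type := {f : arr S | is_modhom M N f}.

Definition mod_id M : mod_hom M M := exist _ (idm (mob M)) (idm_modhom M).

Definition mod_comp M N P (g : mod_hom N P) (f : mod_hom M N) : mod_hom M P :=
  exist _ (sval g ∘ sval f) (comp_modhom (svalP g) (svalP f)).

Definition rep_cat : category.
Proof.
refine (@Category (hmod H) mod_hom mod_id mod_comp _ _ _).
- by abstract (move=> A B [f [hf ef]]; apply: sig_ext => /=; compid).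
- by abstract (move=> A B [f [hf ef]]; apply: sig_ext => /=; compid).
- by abstract (move=> A B C D [h [hh eh]] [g [hg eg]] [f [hf ef]]; apply: sig_ext => /=;
    rewrite comp_assoc //; typ).
Defined.

End RepCat.

(** * The tensor product on [C0 + C1]

    [C0 = rep_cat H] and [C1 = base_cat S].  [Cdisj H] is the disjoint union,
    where [inl] marks degree 0 and [inr] degree 1; [Cdsum a H] is the direct sum
    for an additive base category, with the tensor product extended
    biadditively. *)

Section Zesting.
Variables (S : ribbonCat) (H : hopfAlg S).
Local Notation H0 := (carrier H).

Definition disj_ten (X Y : hmod H + ob S) : hmod H + ob S :=
  match X, Y with
  | inl M, inl N => inl (tensor_mod M N)
  | inl M, inr B => inr (mob M ⊗ B)
  | inr A, inl N => inr (A ⊗ mob N)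
  | inr A, inr B => inl (free_mod H (A ⊗ B))
  end.

Local Notation disj_hom := (@sum_hom (rep_cat H) (base_cat S)).

Definition disj_map (X X' Y Y' : hmod H + ob S) :
    disj_hom X X' -> disj_hom Y Y' -> disj_hom (disj_ten X Y) (disj_ten X' Y') :=
  match X, X', Y, Y'
    return disj_hom X X' -> disj_hom Y Y' -> disj_hom (disj_ten X Y) (disj_ten X' Y') with
  | inl M, inl M', inl N, inl N' => fun f g =>
      exist _ (sval f ⊠ sval g) (tensor_modhom (svalP f) (svalP g))
  | inl M, inl M', inr B, inr B' => fun f g =>
      exist _ (sval f ⊠ sval g) (tarr_hom (proj1 (svalP f)) (svalP g))
  | inr A, inr A', inl N, inl N' => fun f g =>
      exist _ (sval f ⊠ sval g) (tarr_hom (svalP f) (proj1 (svalP g)))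
  | inr A, inr A', inr B, inr B' => fun f g =>
      exist _ (idm H0 ⊠ (sval f ⊠ sval g))
        (free_modhom H (tarr_hom (svalP f) (svalP g)))
  | inl _, inr _, _, _ | inr _, inl _, _, _ => fun f _ => False_rect _ f
  | _, _, inl _, inr _ | _, _, inr _, inl _ => fun _ g => False_rect _ g
  end.

Lemma base_composable (A B C : ob S) (g : base_hom B C) (f : base_hom A B) :
  cod (sval f) = dom (sval g).
Proof. exact: hom_composable (svalP f) (svalP g) erefl. Qed.

Lemma mod_composable (M N P : hmod H) (g : mod_hom N P) (f : mod_hom M N) :
  cod (sval f) = dom (sval g).
Proof. exact: hom_composable (proj1 (svalP f)) (proj1 (svalP g)) erefl. Qed.

Lemma tarr_composable (f g f' g' : arr S) :
  cod f = dom g -> cod f' = dom g' -> cod (f ⊠ f') = dom (g ⊠ g').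
Proof. by move=> e e'; rewrite cod_tarr dom_tarr e e'. Qed.

Lemma disj_map_id (X Y : hmod H + ob S) :
  disj_map (sum_id (C := rep_cat H) (D := base_cat S) X) (sum_id (C := rep_cat H) (D := base_cat S) Y)
  = sum_id (C := rep_cat H) (D := base_cat S) (disj_ten X Y).
Proof. by case: X => [M|A]; case: Y => [N|B] /=; apply: sig_ext; rewrite /= !tarr_idm. Qed.

Lemma disj_map_comp (X X' X'' Y Y' Y'' : hmod H + ob S)
    (g : disj_hom X' X'') (f : disj_hom X X') (g' : disj_hom Y' Y'') (f' : disj_hom Y Y') :
  disj_map (sum_comp g f) (sum_comp g' f') = sum_comp (disj_map g g') (disj_map f f').
Proof.
have b := base_composable; have m := mod_composable; have t := tarr_composable.
move: X X' X'' Y Y' Y'' g f g' f' => [M|A] [M'|A'] [M''|A''] [N|B] [N'|B'] [N''|B''] //=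
  g f g' f'; apply: sig_ext => /=; rewrite tarr_comp ?whiskerl; eauto.
Qed.

Definition Cdisj : tensorCat :=
  @TensorCat (sum_cat (rep_cat H) (base_cat S)) disj_ten disj_map (inl (unit_mod H))
    disj_map_id disj_map_comp.

Definition dsum_ten (a : additiveStr S) (X Y : hmod H * ob S) : hmod H * ob S :=
  (bip_mod a (tensor_mod X.1 Y.1) (free_mod H (X.2 ⊗ Y.2)),
   bip a (mob X.1 ⊗ Y.2) (X.2 ⊗ mob Y.1)).

Definition dsum_map (a : additiveStr S) (X X' Y Y' : hmod H * ob S)
    (f : mod_hom X.1 X'.1 * base_hom X.2 X'.2) (g : mod_hom Y.1 Y'.1 * base_hom Y.2 Y'.2) :
    mod_hom (dsum_ten a X Y).1 (dsum_ten a X' Y').1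
    * base_hom (dsum_ten a X Y).2 (dsum_ten a X' Y').2 :=
  (exist _ (bsum a (sval f.1 ⊠ sval g.1) (idm H0 ⊠ (sval f.2 ⊠ sval g.2)))
     (bsum_modhom a (tensor_modhom (svalP f.1) (svalP g.1))
        (free_modhom H (tarr_hom (svalP f.2) (svalP g.2)))),
   exist _ (bsum a (sval f.1 ⊠ sval g.2) (sval f.2 ⊠ sval g.1))
     (bsum_hom a (tarr_hom (proj1 (svalP f.1)) (svalP g.2))
        (tarr_hom (svalP f.2) (proj1 (svalP g.1))))).

Lemma dsum_map_id (a : additiveStr S) (X Y : hmod H * ob S) :
  dsum_map a (cid (X : cob (dsum_cat (rep_cat H) (base_cat S))))
    (cid (Y : cob (dsum_cat (rep_cat H) (base_cat S))))
  = cid (dsum_ten a X Y : cob (dsum_cat (rep_cat H) (base_cat S))).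
Proof.
case: X Y => [M A] [N B]; rewrite /dsum_map /=.
by congr (_, _); apply: sig_ext; rewrite /= !tarr_idm bsum_idm.
Qed.

Lemma dsum_map_comp (a : additiveStr S)
    (X X' X'' Y Y' Y'' : cob (dsum_cat (rep_cat H) (base_cat S)))
    (g : chom X' X'') (f : chom X X') (g' : chom Y' Y'') (f' : chom Y Y') :
  dsum_map a (g ∘c f) (g' ∘c f')
  = (dsum_map a g g' : @chom (dsum_cat (rep_cat H) (base_cat S)) _ _) ∘c dsum_map a f f'.
Proof.
have b := base_composable; have m := mod_composable; have t := tarr_composable.
have hm (M N : hmod H) (k : mod_hom M N) : sval k ∈ mob M ⇒ mob N := proj1 (svalP k).
have hb (A B : ob S) (k : base_hom A B) : sval k ∈ A ⇒ B := svalP k.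
move: X X' X'' Y Y' Y'' g f g' f' => [M A] [M' A'] [M'' A''] [N B] [N' B'] [N'' B''] /=.
move=> [g0 g1] [f0 f1] [g0' g1'] [f0' f1']; rewrite /dsum_map /=.
have hf0 := hm _ _ f0; have hg0 := hm _ _ g0; have hf0' := hm _ _ f0'.
have hg0' := hm _ _ g0'; have hf1 := hb _ _ f1; have hg1 := hb _ _ g1.
have hf1' := hb _ _ f1'; have hg1' := hb _ _ g1'.
have hI := idm_hom H0.
by congr (_, _); apply: sig_ext => /=; rewrite !tarr_comp ?whiskerl; eauto;
  apply: bsum_comp; eauto using tarr_hom.
Qed.

Definition Cdsum (a : additiveStr S) : tensorCat :=
  @TensorCat (dsum_cat (rep_cat H) (base_cat S)) (dsum_ten a) (@dsum_map a)
    (unit_mod H, zob a) (dsum_map_id a) (@dsum_map_comp a).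

(** * The associativity isomorphisms

    Underlying arrows in [S] for given [gam del : 𝟏 -> H ⊗ H], [phi : H -> H];
    the digits are the degrees of the three objects, and [alpha] is the identity
    in degrees 000, 001 and 100. *)

Section Alpha.
Variables (gam del phi : arr S).
Local Notation I := idm.

Definition alpha010 (M : hmod H) (B : ob S) (P : hmod H) : arr S :=
  (I (mob M) ⊠ br (mob P) B)
  ∘ ((act2 M P ∘ (gam ⊠ I (mob M ⊗ mob P))) ⊠ I B)
  ∘ (I (mob M) ⊠ brV (mob P) B).

Definition alpha011 (M : hmod H) (B C : ob S) : arr S :=
  ((I H0 ⊠ act M)
   ∘ (((I H0 ⊠ antipV H) ∘ brV H0 H0 ∘ Delta H) ⊠ I (mob M))
   ∘ brV H0 (mob M))
  ⊠ I (B ⊗ C).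

Definition alpha101 (A : ob S) (N : hmod H) (C : ob S) : arr S :=
  ((mu H ⊠ I A ⊠ act N)
   ∘ (I (H0 ⊗ H0) ⊠ br H0 A ⊠ I (mob N))
   ∘ (I H0 ⊠ del ⊠ I (A ⊗ mob N)))
  ⊠ I C.

Definition alpha110 (A B : ob S) (P : hmod H) : arr S :=
  (I (H0 ⊗ A ⊗ B) ⊠ act P)
  ∘ (I H0 ⊠ br H0 (A ⊗ B) ⊠ I (mob P))
  ∘ (Delta H ⊠ I (A ⊗ B ⊗ mob P)).

Definition alpha111 (A B C : ob S) : arr S :=
  ((phi ⊠ I A) ∘ brV H0 A) ⊠ I (B ⊗ C).

Definition disj_alpha (X Y Z : hmod H + ob S) : arr S :=
  match X, Y, Z with
  | inl M, inl N, inl P => I (mob M ⊗ mob N ⊗ mob P)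
  | inl M, inl N, inr C => I (mob M ⊗ mob N ⊗ C)
  | inr A, inl N, inl P => I (A ⊗ mob N ⊗ mob P)
  | inl M, inr B, inl P => alpha010 M B P
  | inl M, inr B, inr C => alpha011 M B C
  | inr A, inl N, inr C => alpha101 A N C
  | inr A, inr B, inl P => alpha110 A B P
  | inr A, inr B, inr C => alpha111 A B C
  end.

(** In the direct sum, [alpha] is the sum over the homogeneous components of
    [inclusion ∘ alpha ∘ projection]; [dsum_alpha0] and [dsum_alpha1] are its
    parts of degree 0 and 1. *)

Section DirectSum.
Variable a : additiveStr S.
Local Notation "f +' g" := (add a f g) (at level 50, left associativity).

Definition dsum_alpha0 (X Y Z : hmod H * ob S) : arr S :=
  let: (M, A) := X in let: (N, B) := Y in let: (P, C) := Z in
  let m := mob M in let n := mob N in let p := mob P in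
  let q1 := pr1 a (m ⊗ bip a (n ⊗ p) (H0 ⊗ (B ⊗ C)))
                  (H0 ⊗ (A ⊗ bip a (n ⊗ C) (B ⊗ p))) in
  let q2 := pr2 a (m ⊗ bip a (n ⊗ p) (H0 ⊗ (B ⊗ C)))
                  (H0 ⊗ (A ⊗ bip a (n ⊗ C) (B ⊗ p))) in
  let i1 := in1 a (bip a (m ⊗ n) (H0 ⊗ (A ⊗ B)) ⊗ p)
                  (H0 ⊗ (bip a (m ⊗ B) (A ⊗ n) ⊗ C)) in
  let i2 := in2 a (bip a (m ⊗ n) (H0 ⊗ (A ⊗ B)) ⊗ p)
                  (H0 ⊗ (bip a (m ⊗ B) (A ⊗ n) ⊗ C)) in
     i1 ∘ (in1 a (m ⊗ n) (H0 ⊗ (A ⊗ B)) ⊠ I p)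
        ∘ ((I m ⊠ pr1 a (n ⊗ p) (H0 ⊗ (B ⊗ C))) ∘ q1)
  +' i2 ∘ (I H0 ⊠ (in1 a (m ⊗ B) (A ⊗ n) ⊠ I C)) ∘ alpha011 M B C
        ∘ ((I m ⊠ pr2 a (n ⊗ p) (H0 ⊗ (B ⊗ C))) ∘ q1)
  +' i2 ∘ (I H0 ⊠ (in2 a (m ⊗ B) (A ⊗ n) ⊠ I C)) ∘ alpha101 A N C
        ∘ ((I H0 ⊠ (I A ⊠ pr1 a (n ⊗ C) (B ⊗ p))) ∘ q2)
  +' i1 ∘ (in2 a (m ⊗ n) (H0 ⊗ (A ⊗ B)) ⊠ I p) ∘ alpha110 A B P
        ∘ ((I H0 ⊠ (I A ⊠ pr2 a (n ⊗ C) (B ⊗ p))) ∘ q2).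

Definition dsum_alpha1 (X Y Z : hmod H * ob S) : arr S :=
  let: (M, A) := X in let: (N, B) := Y in let: (P, C) := Z in
  let m := mob M in let n := mob N in let p := mob P in
  let q1 := pr1 a (m ⊗ bip a (n ⊗ C) (B ⊗ p)) (A ⊗ bip a (n ⊗ p) (H0 ⊗ (B ⊗ C))) in
  let q2 := pr2 a (m ⊗ bip a (n ⊗ C) (B ⊗ p)) (A ⊗ bip a (n ⊗ p) (H0 ⊗ (B ⊗ C))) in
  let i1 := in1 a (bip a (m ⊗ n) (H0 ⊗ (A ⊗ B)) ⊗ C) (bip a (m ⊗ B) (A ⊗ n) ⊗ p) in
  let i2 := in2 a (bip a (m ⊗ n) (H0 ⊗ (A ⊗ B)) ⊗ C) (bip a (m ⊗ B) (A ⊗ n) ⊗ p) in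
     i1 ∘ (in1 a (m ⊗ n) (H0 ⊗ (A ⊗ B)) ⊠ I C)
        ∘ ((I m ⊠ pr1 a (n ⊗ C) (B ⊗ p)) ∘ q1)
  +' i2 ∘ (in1 a (m ⊗ B) (A ⊗ n) ⊠ I p) ∘ alpha010 M B P
        ∘ ((I m ⊠ pr2 a (n ⊗ C) (B ⊗ p)) ∘ q1)
  +' i2 ∘ (in2 a (m ⊗ B) (A ⊗ n) ⊠ I p)
        ∘ ((I A ⊠ pr1 a (n ⊗ p) (H0 ⊗ (B ⊗ C))) ∘ q2)
  +' i1 ∘ (in2 a (m ⊗ n) (H0 ⊗ (A ⊗ B)) ⊠ I C) ∘ alpha111 A B C
        ∘ ((I A ⊠ pr2 a (n ⊗ p) (H0 ⊗ (B ⊗ C))) ∘ q2).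

End DirectSum.
End Alpha.

Definition disj_ob (X : hmod H + ob S) : ob S :=
  match X with inl M => mob M | inr A => A end.

Definition disj_arr (X Y : hmod H + ob S) : disj_hom X Y -> arr S :=
  match X, Y return disj_hom X Y -> arr S with
  | inl M, inl N => fun f => sval f
  | inr A, inr B => fun f => sval f
  | _, _ => fun f => False_rect _ f
  end.

(** [M] is the monoidal structure with associator built from [gam], [del], [phi]
    and identity unit isomorphisms. *)
Definition disj_built (gam del phi : arr S) (M : monoidalStr Cdisj) : Prop :=
  [/\ forall X Y Z : hmod H + ob S,
        disj_arr (assoc M X Y Z) = disj_alpha gam del phi X Y Z,
      forall X : hmod H + ob S, disj_arr (lunit M X) = idm (disj_ob X)
    & forall X : hmod H + ob S, disj_arr (runit M X) = idm (disj_ob X)].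

(** In the direct sum the unit isomorphisms are the identities on the
    homogeneous components; the other summands of [tone ⊗c X] and [X ⊗c tone]
    are zero objects. *)
Definition dsum_built (a : additiveStr S) (gam del phi : arr S)
    (M : monoidalStr (Cdsum a)) : Prop :=
  [/\ forall X Y Z : hmod H * ob S,
        sval (assoc M X Y Z).1 = dsum_alpha0 del a X Y Z
        /\ sval (assoc M X Y Z).2 = dsum_alpha1 gam phi a X Y Z,
      forall X : hmod H * ob S,
        sval (lunit M X).1 = pr1 a (𝟏 ⊗ mob X.1) (H0 ⊗ (zob a ⊗ X.2))
        /\ sval (lunit M X).2 = pr1 a (𝟏 ⊗ X.2) (zob a ⊗ mob X.1)
    & forall X : hmod H * ob S,
        sval (runit M X).1 = pr1 a (mob X.1 ⊗ 𝟏) (H0 ⊗ (X.2 ⊗ zob a))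
        /\ sval (runit M X).2 = pr2 a (mob X.1 ⊗ zob a) (X.2 ⊗ 𝟏)].

(** * The data [Gamma], [lam], [g] *)

Definition lmul (x : arr S) : arr S := mu H ∘ (x ⊠ idm H0).
Definition rmul (x : arr S) : arr S := mu H ∘ (idm H0 ⊠ x).

Definition mult_inverse (x y : arr S) : Prop :=
  [/\ y ∈ 𝟏 ⇒ H0, mu H ∘ (x ⊠ y) = eta H & mu H ∘ (y ⊠ x) = eta H].

Definition right_cointegral (lam : arr S) : Prop :=
  lam ∈ H0 ⇒ 𝟏 /\ (lam ⊠ idm H0) ∘ Delta H = eta H ∘ lam.

Definition distinguished (lam g : arr S) : Prop :=
  g ∈ 𝟏 ⇒ H0 /\ (idm H0 ⊠ lam) ∘ Delta H = g ∘ lam.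

Definition copair (Gamma : arr S) : arr S := (idm H0 ⊠ Gamma) ∘ coev H0.

Definition gammaOf (Gamma : arr S) : arr S := (antipV H ⊠ Gamma) ∘ coev H0.
Definition deltaOf (Gamma g : arr S) : arr S := (antip H ⊠ (rmul g ∘ Gamma)) ∘ coev H0.
Definition phiOf (Gamma lam : arr S) : arr S :=
  (idm H0 ⊠ (lam ∘ mu H)) ∘ (copair Gamma ⊠ idm H0).

(** [M] is the monoidal category [C(H, Gamma, lam)]; [g] is determined by [lam]. *)
Definition is_Cdisj (Gamma lam g : arr S) (M : monoidalStr Cdisj) : Prop :=
  disj_built (gammaOf Gamma) (deltaOf Gamma g) (phiOf Gamma lam) M.

Definition is_Cdsum (a : additiveStr S) (Gamma lam g : arr S)
    (M : monoidalStr (Cdsum a)) : Prop :=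
  dsum_built (gammaOf Gamma) (deltaOf Gamma g) (phiOf Gamma lam) M.

End Zesting.

Definition hopf_morphism (S : strictMonCat) (K L : hopfData S) (f : arr S) : Prop :=
  f ∈ carrier K ⇒ carrier L /\
  [/\ f ∘ mu K = mu L ∘ (f ⊠ f), f ∘ eta K = eta L,
      Delta L ∘ f = (f ⊠ f) ∘ Delta K, eps L ∘ f = eps K
    & antip L ∘ f = f ∘ antip K].

Definition hopf_isomorphism (S : strictMonCat) (K L : hopfData S) (f : arr S) : Prop :=
  hopf_morphism K L f /\ exists h, inverse_arrows (carrier K) (carrier L) f h.

Definition condition_a (S : ribbonCat) (H : hopfAlg S) (Gamma : arr S) : Prop :=
  hopf_isomorphism (dualHopf H) H Gamma.

Definition condition_b (S : ribbonCat) (H : hopfAlg S) (Gamma lam g : arr S) : Prop :=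
  [/\ right_cointegral H lam, distinguished H lam g
    & (lam ⊠ lam) ∘ copair H Gamma = idm 𝟏].

(** [lmul H gV ∘ rmul H g] is [Ad_{g^-1}] when [gV] is the inverse of [g]. *)
Definition condition_c (S : ribbonCat) (H : hopfAlg S) (Gamma g gV : arr S) : Prop :=
  dualarr Gamma
  = piv (carrier H) ∘ twV (carrier H) ∘ (antip H ∘ antip H) ∘ (lmul H gV ∘ rmul H g) ∘ Gamma.

(* Main.v *)
From HB Require Import structures.
From mathcomp Require Import ssreflect ssrfun ssrbool eqtype ssrnat seq.
Require Import Defs.

Set Implicit Arguments.
Unset Strict Implicit.
Unset Printing Implicit Defensive.

(** The associators are built from braidings, the Hopf algebra structure, module
    actions and duals, so the pentagon is a family of equations between string
    diagrams. Such equations hold up to isotopy and a few local replacements.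
    The isotopy is left to the tactic [diagram], which compares normal forms of
    diagrams and is proved sound ([diagram_sound]); what the proofs below spell
    out is which replacements are made.

    In the disjoint union the pentagon splits into sixteen cases according to
    the degrees of the four objects. Removing the modules leaves equations
    between [γ], [δ], [φ] and the structure of [H], collected in
    [associator_data]; they imply the pentagon, naturality, invertibility and
    the triangle ([alpha_pentagon], [disj_monoidal]).

    For the elements built from [Γ] and [λ] these equations only involve the
    copairing [C = (id ⊗ Γ) ∘ coev]. That [Γ] is a Hopf algebra map means that
    [C] exchanges products in one leg with coproducts in the other, which makes
    [γ] a bicharacter inverse to [C] and gives the laws of [δ]. Condition c)
    describes [C] after a braiding ([copair_flip], [copair_braid]) and makes
    [γ] and [δ] compatible. The map [φ] is the Fourier transform attached to
    [λ]: the cointegral property moves coproducts through it ([Delta_phi],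
    [lam_shift]). The pentagon for four objects of degree 1 is Fourier
    inversion [φ(g φ(x)) = S^-1(x)] ([phi_g_phi]): after a flip of the
    copairing the left-hand side is an expression in the integral
    [C_1 λ(C_2 g)], the integral property shows that it is a constant times
    [S^-1(x)], and [(λ ⊗ λ) ∘ C = id] fixes the constant. Inversion also makes
    [φ] invertible and provides the remaining laws ([phi_mul_del]). The same
    normalisation cancels [λ] on the right, so [g] is unique and group-like
    and [S ∘ g] is its inverse ([distinguished_unique], [g_inverse]).

    In the direct sum an arrow out of a tensor product is determined by its
    restrictions to tensor products of homogeneous parts ([incl_ext3]), where
    the associator restricts to that of the disjoint union ([aarr_incl3]).
    Coherence is inherited along these inclusions ([pentagon_glue],
    [dsum_monoidal]).

    For part (ii), the transported data have the copairing that [f] maps to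
    [C], so [f] maps their [γ'], [δ'], [φ'] to [γ], [δ], [φ]
    ([gamma_transport], [delta_transport], [phi_transport]). Pulling modules
    back along [f] is then a monoidal functor, with comparison [f ⊗ id] on
    products of two objects of degree 1 and the identity otherwise
    ([comparison_assoc]), and pulling back along the inverse of [f] shows that
    it is an equivalence. *)

(** * String diagrams up to isotopy *)

(** An arrow of a strict braided category is presented as a diagram: a source
    word of strands and a list of slices read from the source on, each with a
    single generator and the number of strands on its left. Composition is
    concatenation, and what remains is to compare diagrams up to sliding
    distant slices past each other, up to naturality of the braiding, and up
    to given local replacements. *)
Definition word := seq nat.
(** [Cross true a b] is the braiding of [a] past [b] and [Cross false a b] the
    inverse of the braiding of [b] past [a]. *)
Inductive gen := Box of nat | Cross of bool & nat & nat.
Notation slice := (nat * gen)%type.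
Notation signature := (seq (word * word)).

Definition eq_gen (g h : gen) :=
  match g, h with
  | Box m, Box n => m == n
  | Cross o a b, Cross o' a' b' => [&& o == o', a == a' & b == b']
  | _, _ => false
  end.

Lemma eq_genP : Equality.axiom eq_gen.
Proof.
case=> [m|o a b] [n|o' a' b'] /=; try by constructor.
- by apply: (iffP eqP) => [->|[]].
- by apply: (iffP and3P) => [[/eqP-> /eqP-> /eqP->]|[-> -> ->]].
Qed.

HB.instance Definition _ := hasDecEq.Build gen eq_genP.

Section Combinatorics.
Variable sg : signature.
Implicit Types (g : gen) (s t : slice) (D L R : seq slice) (w : word).

Definition gin g : word :=
  match g with Box n => (nth ([::], [::]) sg n).1 | Cross _ a b => [:: a; b] end.
Definition gout g : word :=
  match g with Box n => (nth ([::], [::]) sg n).2 | Cross _ a b => [:: b; a] end.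

Definition next w s : word :=
  take s.1 w ++ gout s.2 ++ drop (s.1 + size (gin s.2)) w.
Definition fits w s :=
  (s.1 <= size w) && (take (size (gin s.2)) (drop s.1 w) == gin s.2).
Fixpoint wf w D := if D is s :: D' then fits w s && wf (next w s) D' else true.
Definition tgt w D := foldl next w D.
Definition shift k D : seq slice := [seq (k + s.1, s.2) | s <- D].

(** [s] followed by [t] is exchanged with [t] followed by [s] when [t] touches
    only strands to the left of [s] ([swapl]) or to the right ([swapr]); the
    position of the generator further right moves by the difference between
    the outputs and the inputs of the other one. *)
Definition swapl s t : option (slice * slice) :=
  if t.1 + size (gin t.2) <= s.1
  then Some (t, (s.1 - size (gin t.2) + size (gout t.2), s.2)) else None.
Definition swapr s t : option (slice * slice) :=
  if s.1 + size (gout s.2) <= t.1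
  then Some ((t.1 - size (gout s.2) + size (gin s.2), t.2), s) else None.
Definition swap s t :=
  if swapl s t is Some p then Some p else swapr s t.

(** One pass of insertion sort for moving slices to the left of the diagram as
    early as possible. Iterating it brings the diagrams that occur below to a
    canonical order; the number of passes only matters for completeness, as
    each single exchange is sound. *)
Fixpoint bubble s R :=
  if R is t :: R' then
    if swapl t s is Some (s', t') then t' :: bubble s' R' else s :: R
  else [:: s].
Definition pass D := rev (foldl (fun R s => bubble s R) [::] D).
Definition planar_nf D := iter 3 pass D.

(** [forward s L] carries the slice [s] past all of [L]. *)
Fixpoint forward s L : option (seq slice * slice) :=
  if L is t :: L' then
    if swap s t is Some (t', s') then
      if forward s' L' is Some (L'', s'') then Some (t' :: L'', s'') else None
    else None
  else Some ([::], s).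

(** A left-hand side need not occur contiguously. With [e] the last slice of the
    pattern, [P] its other slices in reverse, and [R] the diagram before the
    match in reverse, each slice is carried forward until it meets the block
    [blk] matched so far, which it joins if it is the next slice of the
    pattern; otherwise it is carried past the block if possible ([aft]) and
    left before it if not ([pend]). *)
Fixpoint gather (P : seq slice) (e : slice) R pend blk aft
    : option (seq slice * seq slice * seq slice * seq slice) :=
  match P with
  | [::] => Some (R, pend, blk, aft)
  | p :: P' =>
    (fix scan R pend blk aft :=
       match R with
       | [::] => None
       | s :: R' =>
         match forward s pend with
         | None => scan R' (s :: pend) blk aft
         | Some (pend', s') =>
           let found :=
             if (s'.2 == p.2) && (s'.1 + e.1 == (last s' blk).1 + p.1)
             then gather P' e (catrev pend' R') [::] (s' :: blk) aft else None in
           if found is Some _ then found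
           else match forward s' blk with
                | None => scan R' (s :: pend) blk aft
                | Some (blk', s'') => scan R' pend' blk' (s'' :: aft)
                end
         end
       end) R pend blk aft
  end.

Record rule := Rule { rsrc : word; rlhs : seq slice; rrhs : seq slice }.

Definition rule_wf (r : rule) :=
  [&& wf (rsrc r) (rlhs r), wf (rsrc r) (rrhs r)
    & tgt (rsrc r) (rlhs r) == tgt (rsrc r) (rrhs r)].

(** The search may propose anything: the block is compared with the shifted
    left-hand side before it is replaced, so soundness does not depend on how
    it was found. *)
Definition rewrite_at (r : rule) w R s aft : option (seq slice) :=
  if rev (rlhs r) is e :: P then
    if s.2 == e.2 then
      if gather P e R [::] [:: s] aft is Some (R', pend, blk, aft') then
        let pre := rev R' ++ pend in
        let k := (last s blk).1 - e.1 in
        let u := tgt w pre in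
        if [&& blk == shift k (rlhs r), k <= size u
             & take (size (rsrc r)) (drop k u) == rsrc r]
        then Some (pre ++ shift k (rrhs r) ++ aft') else None
      else None
    else None
  else None.

Fixpoint rewrite_from (r : rule) w R D : option (seq slice) :=
  if D is s :: aft then
    let found := rewrite_at r w R s aft in
    if found is Some _ then found else rewrite_from r w (s :: R) aft
  else None.

Definition rewrite_rule w D r :=
  if rule_wf r then rewrite_from r w [::] D else None.

Fixpoint first_rewrite w D (rs : seq rule) :=
  if rs is r :: rs' then
    if rewrite_rule w D r is Some D' then Some D' else first_rewrite w D rs'
  else None.

Definition cross_right o x (v : word) : seq slice :=
  [seq (p.1, Cross o x p.2) | p <- zip (iota 0 (size v)) v].
Fixpoint cross_left o x (v : word) : seq slice :=
  if v is a :: v' then rcons (shift 1 (cross_left o x v')) (0, Cross o a x) else [::].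

Definition cancel_rule o a b :=
  Rule [:: a; b] [:: (0, Cross o a b); (0, Cross (~~ o) b a)] [::].
Definition nat_right o x g :=
  Rule (x :: gin g) (rcons (cross_right o x (gin g)) (0, g))
       ((1, g) :: cross_right o x (gout g)).
Definition nat_left o x g :=
  Rule (rcons (gin g) x) (rcons (cross_left o x (gin g)) (1, g))
       ((0, g) :: cross_left o x (gout g)).
Definition flip (r : rule) := Rule (rsrc r) (rrhs r) (rlhs r).
(** A box without inputs whose first output crosses a strand on its left can be
    created on the other side of that strand, its remaining outputs then cross
    back. *)
Definition pull_left o x g :=
  if (gin g, gout g) is ([::], a :: v) then
    Rule [:: x] [:: (1, g); (0, Cross o x a)] ((0, g) :: shift 1 (cross_left (~~ o) x v))
  else Rule [::] [::] [::].
(** The mirror image, for a box without outputs. *)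
Definition pull_sink o x g :=
  if (gin g, gout g) is (a :: v, [::]) then
    Rule [:: a, x & v] [:: (0, Cross o a x); (1, g)]
      (rcons (shift 1 (cross_right (~~ o) x v)) (0, g))
  else Rule [::] [::] [::].

(** Each kind of generator has one orientation of naturality. A box without
    inputs is moved away from the strands that cross its outputs; a box with
    one output is moved behind the crossings of that output; any other box is
    moved before the crossings of its inputs; triple crossings are brought to
    one of their two forms. *)
Definition crossing_rules g (c : gen) : seq rule :=
  if c is Cross o a b then
    match gin g, gout g, g with
    | [::], _, Box _ =>
        [:: flip (nat_right o a g); flip (nat_left o b g); pull_left o a g]
    | _ :: _, [:: i], Box _ =>
        (if i == b then [:: flip (nat_right o a g)] else [::])
        ++ (if i == a then [:: flip (nat_left o b g)] else [::])
    | i :: v, _, Box _ =>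
        (if last i v == b then [:: nat_right o a g] else [::])
        ++ (if i == a then [:: nat_left o b g; pull_sink o b g] else [::])
    | i :: v, j :: _, Cross _ _ _ =>
        (if last i v == b then [:: nat_right o a g] else [::])
        ++ (if j == a then [:: flip (nat_left o b g)] else [::])
    | _, _, _ => [::]
    end
  else [::].

Definition structural_rules D : seq rule :=
  let gs := undup [seq s.2 | s <- D] in
  let cs := [seq g <- gs | if g is Cross _ _ _ then true else false] in
  flatten [seq if c is Cross o a b then [:: cancel_rule o a b] else [::] | c <- cs]
  ++ flatten [seq flatten [seq crossing_rules g c | c <- cs] | g <- gs].

(** The given rules are only tried when no structural rule applies, so their
    left-hand sides have to be met in naturality normal form. *)
Fixpoint normalise fuel (rs : seq rule) w D :=
  if fuel is n.+1 then
    if first_rewrite w D (structural_rules D) is Some D' then normalise n rs w D'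
    else if first_rewrite w D rs is Some D' then normalise n rs w D'
    else D
  else D.

End Combinatorics.

Inductive oexp := OUnit | OAtom of nat | OTen of oexp & oexp.
Inductive term :=
  | TId of oexp | TBox of nat | TCross of bool & oexp & oexp
  | TComp of term & term | TTen of term & term.

Fixpoint flat (A : oexp) : word :=
  match A with OUnit => [::] | OAtom n => [:: n] | OTen A B => flat A ++ flat B end.

(** The hexagon identities reduce the crossing of two words to crossings of
    strands. *)
Fixpoint cross_words o (v w : word) : seq slice :=
  if v is x :: v' then shift 1 (cross_words o v' w) ++ cross_right o x w else [::].

Section Compile.
Variable sg : signature.

Fixpoint tdom t : word :=
  match t with
  | TId A => flat A
  | TBox n => gin sg (Box n)
  | TCross _ A B => flat A ++ flat B
  | TComp g f => tdom f
  | TTen f g => tdom f ++ tdom g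
  end.
Fixpoint tcod t : word :=
  match t with
  | TId A => flat A
  | TBox n => gout sg (Box n)
  | TCross _ A B => flat B ++ flat A
  | TComp g f => tcod g
  | TTen f g => tcod f ++ tcod g
  end.
Fixpoint twf t : bool :=
  match t with
  | TComp g f => [&& twf g, twf f & tcod f == tdom g]
  | TTen f g => twf f && twf g
  | _ => true
  end.
Fixpoint compile t : seq slice :=
  match t with
  | TId _ => [::]
  | TBox n => [:: (0, Box n)]
  | TCross o A B => cross_words o (flat A) (flat B)
  | TComp g f => compile f ++ compile g
  | TTen f g => compile f ++ shift (size (tcod f)) (compile g)
  end.
Definition compile_rule (p : term * term) := Rule (tdom p.1) (compile p.1) (compile p.2).

Definition solve_nf fuel (rs : seq (term * term)) t :=
  planar_nf sg (normalise sg fuel (map compile_rule rs) (tdom t) (compile t)).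

Definition check fuel rs l r :=
  [&& twf l, twf r, tdom l == tdom r, all (fun p => twf p.1 && twf p.2) rs,
    all (fun p => tdom p.1 == tdom p.2) rs & solve_nf fuel rs l == solve_nf fuel rs r].
End Compile.

Section Semantics.
Variables (S : ribbonCat) (sg : signature) (oenv : seq (ob S)) (benv : seq (arr S)).
Implicit Types (g : gen) (s t : slice) (D L R : seq slice) (u v w : word).

Definition obw w : ob S := foldr (fun a A => nth unit oenv a ⊗ A) unit w.
Local Notation I w := (idm (obw w)).

Definition xing (o : bool) (A B : ob S) : arr S := if o then br A B else brV B A.
Definition garr g : arr S :=
  match g with
  | Box n => nth (idm unit) benv n
  | Cross o a b => xing o (nth unit oenv a) (nth unit oenv b)
  end.
Definition sarr w s : arr S :=
  I (take s.1 w) ⊠ garr s.2 ⊠ I (drop (s.1 + size (gin sg s.2)) w).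
Fixpoint den w D : arr S :=
  if D is s :: D' then den (next sg w s) D' ∘ sarr w s else I w.

Hypothesis box_hom : forall n,
  garr (Box n) ∈ obw (gin sg (Box n)) ⇒ obw (gout sg (Box n)).

Lemma obw_cat u v : obw (u ++ v) = obw u ⊗ obw v.
Proof. by elim: u => [|a u IH] /=; rewrite ?tob_unitl // IH tob_assoc. Qed.

Lemma xing_hom o A B : xing o A B ∈ A ⊗ B ⇒ B ⊗ A.
Proof. by case: o; rewrite /xing; eauto with hom. Qed.
Hint Resolve xing_hom : hom.

Lemma garr_hom g : garr g ∈ obw (gin sg g) ⇒ obw (gout sg g).
Proof. by case: g => [n|o a b]; [apply: box_hom | rewrite /= !tob_unitr; apply: xing_hom]. Qed.
Hint Resolve garr_hom : hom.

Lemma fits_split w s : fits sg w s ->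
  exists u v, w = u ++ gin sg s.2 ++ v /\ s.1 = size u.
Proof.
case: s => k g /andP[/= le /eqP e].
exists (take k w), (drop (size (gin sg g)) (drop k w)); rewrite size_take_min (minn_idPl le).
by split=> //; rewrite -{1}e !cat_take_drop.
Qed.

Lemma fits_cat u v g : fits sg (u ++ gin sg g ++ v) (size u, g).
Proof. by rewrite /fits /= size_cat leq_addr drop_size_cat // take_size_cat //=. Qed.

Lemma next_cat u v g : next sg (u ++ gin sg g ++ v) (size u, g) = u ++ gout sg g ++ v.
Proof.
by rewrite /next /= take_size_cat // addnC -drop_drop drop_size_cat // drop_size_cat.
Qed.

Lemma sarr_cat u v g :
  sarr (u ++ gin sg g ++ v) (size u, g) = I u ⊠ garr g ⊠ I v.
Proof.
by rewrite /sarr /= take_size_cat // addnC -drop_drop drop_size_cat // drop_size_cat.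
Qed.

Lemma sarr_hom w s : fits sg w s -> sarr w s ∈ obw w ⇒ obw (next sg w s).
Proof.
case: s => k g /fits_split[u [v [-> /= ->]]]; rewrite sarr_cat next_cat !obw_cat.
by hom.
Qed.

Lemma den_hom w D : wf sg w D -> den w D ∈ obw w ⇒ obw (tgt sg w D).
Proof.
elim: D w => [|s D IH] w /=; first by move=> _; apply: idm_hom.
by case/andP=> /sarr_hom h /IH h'; apply: comp_hom_eq h' h erefl.
Qed.

Lemma wf_cat w D E : wf sg w (D ++ E) = wf sg w D && wf sg (tgt sg w D) E.
Proof. by elim: D w => //= s D IH w; rewrite IH andbA. Qed.

Lemma tgt_cat w D E : tgt sg w (D ++ E) = tgt sg (tgt sg w D) E.
Proof. exact: foldl_cat. Qed.

Lemma den_cat w D E : wf sg w (D ++ E) -> den w (D ++ E) = den (tgt sg w D) E ∘ den w D.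
Proof.
elim: D w => [|s D IH] w /=.
  by move=> h; rewrite (idr_hom (den_hom h)).
case/andP=> hs; rewrite wf_cat => /andP[hD hE]; rewrite IH ?wf_cat ?hD //.
rewrite comp_assoc //.
  exact: hom_composable (sarr_hom hs) (den_hom hD) erefl.
exact: hom_composable (den_hom hD) (den_hom hE) erefl.
Qed.

(** The relation is asymmetric in the well-formedness condition, because the
    search only ever leaves well-formed diagrams. *)
Variant deforms D E : Prop :=
  Deforms of forall w, wf sg w D ->
    [/\ wf sg w E, tgt sg w E = tgt sg w D & den w E = den w D].

Lemma deforms_refl D : deforms D D.
Proof. by split=> w. Qed.

Lemma deforms_trans E D F : deforms D E -> deforms E F -> deforms D F.
Proof. by case=> h [h']; split=> w /h[/h'[? -> ->] -> ->]. Qed.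

Lemma deforms_cat D D' E E' : deforms D D' -> deforms E E' -> deforms (D ++ E) (D' ++ E').
Proof.
case=> h [h']; split=> w hDE; have := hDE; rewrite wf_cat => /andP[/h[hD t d] /h'[hE t' d']].
have hDE' : wf sg w (D' ++ E') by rewrite wf_cat hD t hE.
by split; rewrite // ?tgt_cat ?t ?t' // !den_cat // t d d'.
Qed.

Lemma deforms_catl D E E' : deforms E E' -> deforms (D ++ E) (D ++ E').
Proof. by move=> h; apply: deforms_cat => //; apply: deforms_refl. Qed.

Lemma deforms_catr D D' E : deforms D D' -> deforms (D ++ E) (D' ++ E).
Proof. by move=> h; apply: deforms_cat => //; apply: deforms_refl. Qed.

(** The only geometric input of sorting: generators on disjoint strands commute,
    by functoriality of the tensor product. *)
Lemma interchange u m v g h :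
  let w := u ++ gin sg g ++ m ++ gin sg h ++ v in
  let w' := u ++ gout sg g ++ m ++ gout sg h ++ v in
  let D := [:: (size u, g); (size u + size (gout sg g) + size m, h)] in
  let E := [:: (size u + size (gin sg g) + size m, h); (size u, g)] in
  [/\ wf sg w D, wf sg w E, tgt sg w D = w', tgt sg w E = w' & den w D = den w E].
Proof.
have a1 (x y z z' : word) : x ++ y ++ z ++ z' = (x ++ y ++ z) ++ z' by rewrite !catA.
have sz (x : word) : size u + size x + size m = size (u ++ x ++ m).
  by rewrite !size_cat addnA.
rewrite /= !sz.
have n1 := next_cat u (m ++ gin sg h ++ v) g.
have n2 := next_cat u (m ++ gout sg h ++ v) g.
have n3 := next_cat (u ++ gin sg g ++ m) v h.
have n4 := next_cat (u ++ gout sg g ++ m) v h.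
have f1 := fits_cat u (m ++ gin sg h ++ v) g.
have f2 := fits_cat u (m ++ gout sg h ++ v) g.
have f3 := fits_cat (u ++ gin sg g ++ m) v h.
have f4 := fits_cat (u ++ gout sg g ++ m) v h.
have s1 := sarr_cat u (m ++ gin sg h ++ v) g.
have s2 := sarr_cat u (m ++ gout sg h ++ v) g.
have s3 := sarr_cat (u ++ gin sg g ++ m) v h.
have s4 := sarr_cat (u ++ gout sg g ++ m) v h.
rewrite -!a1 in n3 n4 f3 f4 s3 s4.
rewrite f1 n1 f4 n4 f3 n3 f2 n2 s1 s4 s3 s2; split=> //.
have hg := garr_hom g; have hh := garr_hom h.
rewrite !obw_cat -!comp_assoc; try typ.
congr (_ ∘ _).
rewrite -!tarr_idm !tarr_assoc -!whiskerr; try typ.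
congr (_ ⊠ _).
rewrite -!(tarr_assoc (I u)) -!whiskerl; try typ.
congr (_ ⊠ _).
have hmh : I m ⊠ garr h ∈ obw m ⊗ obw (gin sg h) ⇒ obw m ⊗ obw (gout sg h) by hom.
by have := tarr_slide hg hmh; rewrite -!tarr_idm !tarr_assoc => ->.
Qed.

Lemma cat_prefix (a b c d : word) : a ++ b = c ++ d -> size c <= size a ->
  exists2 m, a = c ++ m & d = m ++ b.
Proof.
elim: c a => [|x c IH] [|y a] //=; first by exists [::].
  by exists (y :: a).
by case=> -> e le; have [m -> ->] := IH _ e le; exists m.
Qed.

Lemma wf_split w k g l h : wf sg w [:: (k, g); (l, h)] ->
  exists u v u' v', [/\ w = u ++ gin sg g ++ v, k = size u,
    u ++ gout sg g ++ v = u' ++ gin sg h ++ v' & l = size u'].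
Proof.
case/andP=> /fits_split[u [v [-> /= ->]]]; rewrite next_cat => /andP[+ _].
by case/fits_split=> u' [v' [e el]]; exists u, v, u', v'.
Qed.

Lemma deforms_swapl s t t' s' :
  swapl sg s t = Some (t', s') -> deforms [:: s; t] [:: t'; s'].
Proof.
case: s t => [k g] [l h]; rewrite /swapl; case: ifP => //= le [<- <-]; split=> w.
case/wf_split=> u [v [u' [v' [ew ek e el]]]]; rewrite ek el in le.
have [|m eu ev] := cat_prefix (etrans e (catA _ _ _)); first by rewrite size_cat.
have -> : w = u' ++ gin sg h ++ m ++ gin sg g ++ v by rewrite ew eu -!catA.
have [w1 w2 t1 t2 d] := interchange u' m v h g.
have -> : k = size u' + size (gin sg h) + size m by rewrite ek eu !size_cat.
have -> : size u' + size (gin sg h) + size m - size (gin sg h) + size (gout sg h)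
    = size u' + size (gout sg h) + size m by rewrite -addnA addnCA addKn addnAC.
by rewrite el; split; rewrite // t1 t2.
Qed.

Lemma deforms_swapr s t t' s' :
  swapr sg s t = Some (t', s') -> deforms [:: s; t] [:: t'; s'].
Proof.
case: s t => [k g] [l h]; rewrite /swapr; case: ifP => //= le [<- <-]; split=> w.
case/wf_split=> u [v [u' [v' [ew ek e el]]]]; rewrite ek el in le.
rewrite catA in e; have [|m eu ev] := cat_prefix (esym e); first by rewrite size_cat.
have -> : w = u ++ gin sg g ++ m ++ gin sg h ++ v' by rewrite ew ev.
have [w1 w2 t1 t2 d] := interchange u m v' g h.
have -> : l = size u + size (gout sg g) + size m by rewrite el eu !size_cat.
have -> : size u + size (gout sg g) + size m - size (gout sg g) + size (gin sg g)
    = size u + size (gin sg g) + size m by rewrite -addnA addnCA addKn addnAC.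
by rewrite ek; split; rewrite // t1 t2.
Qed.

Lemma deforms_swap s t t' s' : swap sg s t = Some (t', s') -> deforms [:: s; t] [:: t'; s'].
Proof.
rewrite /swap; case E: (swapl sg s t) => [p|]; last exact: deforms_swapr.
by move=> [e]; apply: deforms_swapl; rewrite E e.
Qed.

Lemma deforms_bubble s R : deforms (rcons (rev R) s) (rev (bubble sg s R)).
Proof.
elim: R s => [|t R IH] s /=; first exact: deforms_refl.
case E: (swapl sg t s) => [[s' t']|]; last by rewrite !rev_cons; apply: deforms_refl.
rewrite !rev_cons -!cats1 -catA.
apply: deforms_trans (deforms_catl _ (deforms_swapl E)) _.
by rewrite -cat1s catA; apply: deforms_catr; rewrite cats1.
Qed.

Lemma deforms_pass D : deforms D (pass sg D).
Proof.
have H : forall R, deforms (rev R ++ D) (rev (foldl (fun R s => bubble sg s R) R D)).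
  elim: D => [|s D IH] R /=; first by rewrite cats0; apply: deforms_refl.
  apply: deforms_trans (IH _); rewrite -cat1s catA; apply: deforms_catr.
  by rewrite cats1; apply: deforms_bubble.
exact: (H [::]).
Qed.

Lemma deforms_planar D : deforms D (planar_nf sg D).
Proof.
exact: (deforms_trans (deforms_pass D) (deforms_trans (deforms_pass _) (deforms_pass _))).
Qed.

Lemma deforms_forward s L L' s' :
  forward sg s L = Some (L', s') -> deforms (s :: L) (rcons L' s').
Proof.
elim: L s L' s' => [|t L IH] s L' s' /=; first by case=> <- <-; apply: deforms_refl.
case E: (swap sg s t) => [[t1 s1]|//]; case F: (forward sg s1 L) => [[L1 s2]|//] [<- <-].
rewrite -[s :: _]/([:: s; t] ++ L).
apply: deforms_trans (deforms_catr _ (deforms_swap E)) _.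
by apply: (deforms_catl [:: t1] (IH _ _ _ F)).
Qed.

Lemma deforms_gather P e R pend blk aft R' pend' blk' aft' :
  gather sg P e R pend blk aft = Some (R', pend', blk', aft') ->
  deforms (rev R ++ pend ++ blk ++ aft) (rev R' ++ pend' ++ blk' ++ aft').
Proof.
elim: P R pend blk aft => [|p P IHP] R pend blk aft.
  by case=> <- <- <- <-; apply: deforms_refl.
rewrite /=; elim: R pend blk aft => [//|s R IHR] pend blk aft.
case E: (forward sg s pend) => [[q s1]|]; last first.
  by move=> /IHR h; rewrite rev_cons cat_rcons -cat_cons.
have step : deforms (rev (s :: R) ++ pend ++ blk ++ aft) (rev R ++ q ++ (s1 :: blk) ++ aft).
  rewrite rev_cons cat_rcons -cat_cons -[s1 :: blk]cat1s -!catA [q ++ _]catA cats1.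
  by apply: deforms_catl; apply: deforms_catr; apply: deforms_forward.
case F: (if _ then _ else _) => [m|].
  move=> [em]; move: F; case: ifP => // _; rewrite em => /IHP.
  rewrite catrevE rev_cat revK -catA /= => h; exact: deforms_trans step h.
case G: (forward sg s1 blk) => [[b s2]|] /IHR h.
  apply: deforms_trans step (deforms_trans _ h); do 2 apply: deforms_catl.
  by rewrite -cat_rcons; apply: deforms_catr; apply: deforms_forward.
by rewrite rev_cons cat_rcons.
Qed.

Lemma whisker u v w D : wf sg w D ->
  [/\ wf sg (u ++ w ++ v) (shift (size u) D),
      tgt sg (u ++ w ++ v) (shift (size u) D) = u ++ tgt sg w D ++ v
    & den (u ++ w ++ v) (shift (size u) D) = I u ⊠ den w D ⊠ I v].
Proof.
elim: D w => [|[k g] D IH] w /=.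
  by move=> _; split=> //; rewrite !tarr_idm !obw_cat tob_assoc.
case/andP=> hf hD; have hs := sarr_hom hf; have hd := den_hom hD.
have {IH} := IH _ hD; move: hf hs hd {hD}.
case/fits_split=> x [y [-> /= ->]]; rewrite sarr_cat next_cat => hs hd [w1 t1 d1].
have -> : u ++ (x ++ gin sg g ++ y) ++ v = (u ++ x) ++ gin sg g ++ y ++ v by rewrite !catA.
rewrite -size_cat fits_cat next_cat sarr_cat.
have -> : (u ++ x) ++ gout sg g ++ y ++ v = u ++ (x ++ gout sg g ++ y) ++ v by rewrite !catA.
split=> //; rewrite d1 whiskerl; last exact: hom_composable hs hd erefl.
rewrite whiskerr; last first.
  exact: hom_composable (tarr_hom (idm_hom _) hs) (tarr_hom (idm_hom _) hd) erefl.
by congr (_ ∘ _); rewrite !obw_cat -!tarr_idm !tarr_assoc.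
Qed.

Definition rule_holds (r : rule) :=
  rule_wf sg r -> den (rsrc r) (rlhs r) = den (rsrc r) (rrhs r).

Lemma rewrite_at_sound r w R s aft D :
  rule_wf sg r -> rule_holds r -> rewrite_at sg r w R s aft = Some D ->
  wf sg w (rev R ++ s :: aft) ->
  [/\ wf sg w D, tgt sg w D = tgt sg w (rev R ++ s :: aft) & den w D = den w (rev R ++ s :: aft)].
Proof.
move=> rw rh; rewrite /rewrite_at; case: (rev (rlhs r)) => // e P; case: ifP => // _.
case G: (gather _ _ _ _ _ _ _) => [[[[R' pend] blk] aft']|//].
set pre := rev R' ++ pend; set k := _ - _; case: ifP => // /and3P[/eqP eb lek /eqP esrc] [<-] hw.
have [dg] := deforms_gather G; have {dg}[hw' <- <-] := dg _ hw.
rewrite catA -/pre eb in hw' *; clearbody pre.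
have /and3P[wl wr /eqP te] := rw; have de := rh rw.
set u := tgt sg w pre in lek esrc *.
have ed : drop k u = rsrc r ++ drop (size (rsrc r)) (drop k u).
  by rewrite -{1}esrc cat_take_drop.
have eu : u = take k u ++ rsrc r ++ drop (size (rsrc r)) (drop k u).
  by rewrite -ed cat_take_drop.
have ek : k = size (take k u) by rewrite size_take_min (minn_idPl lek).
have := whisker (take k u) (drop (size (rsrc r)) (drop k u)) wl.
have := whisker (take k u) (drop (size (rsrc r)) (drop k u)) wr.
rewrite -eu -ek -te -de => -[w1 t1 d1] [w2 t2 d2].
have /and3P[wp _] : [&& wf sg w pre, wf sg u (shift k (rlhs r))
    & wf sg (tgt sg u (shift k (rlhs r))) aft'] by rewrite -!wf_cat.
rewrite t2 => wa.
have wD : wf sg w (pre ++ shift k (rrhs r) ++ aft') by rewrite !wf_cat wp -/u w1 t1.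
split; first by [].
  by rewrite !tgt_cat -/u t1 t2.
rewrite !den_cat -/u ?t1 ?t2 ?d1 ?d2 //; rewrite wf_cat ?w1 ?w2 ?t1 ?t2 //.
Qed.

Lemma rewrite_from_sound r w R D E :
  rule_wf sg r -> rule_holds r -> rewrite_from sg r w R D = Some E -> wf sg w (rev R ++ D) ->
  [/\ wf sg w E, tgt sg w E = tgt sg w (rev R ++ D) & den w E = den w (rev R ++ D)].
Proof.
move=> rw rh; elim: D R => [//|s D IH] R /=.
case F: (rewrite_at _ _ _ _ _ _) => [E'|]; first by case=> <-; apply: rewrite_at_sound F.
by rewrite -cat_rcons -rev_cons; apply: IH.
Qed.

Lemma rewrite_rule_sound r w D E : rule_holds r -> rewrite_rule sg w D r = Some E ->
  wf sg w D -> [/\ wf sg w E, tgt sg w E = tgt sg w D & den w E = den w D].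
Proof.
by rewrite /rewrite_rule; case: ifP => // rw rh h; apply: (rewrite_from_sound rw rh h).
Qed.

Fixpoint all_hold (rs : seq rule) : Prop :=
  if rs is r :: rs' then rule_holds r /\ all_hold rs' else True.

Lemma all_hold_cat rs rs' : all_hold rs -> all_hold rs' -> all_hold (rs ++ rs').
Proof. by elim: rs => [|r rs IH] //= [h hs] h'; split=> //; apply: IH. Qed.

Lemma all_hold_flatten (T : Type) (f : T -> seq rule) (xs : seq T) :
  (forall x, all_hold (f x)) -> all_hold (flatten (map f xs)).
Proof. by move=> h; elim: xs => //= x xs; apply: all_hold_cat. Qed.

Lemma first_rewrite_sound rs w D E : all_hold rs -> first_rewrite sg w D rs = Some E ->
  wf sg w D -> [/\ wf sg w E, tgt sg w E = tgt sg w D & den w E = den w D].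
Proof.
elim: rs => //= r rs IH [h hs]; case F: (rewrite_rule _ _ _ _) => [E'|]; last exact: IH.
by case=> <-; apply: rewrite_rule_sound F.
Qed.

Lemma xing_natE o (A B A' B' : ob S) (p q : arr S) : p ∈ A ⇒ A' -> q ∈ B ⇒ B' ->
  xing o A' B' ∘ (p ⊠ q) = (q ⊠ p) ∘ xing o A B.
Proof.
move=> hf hg; case: o; rewrite /xing; first exact: br_natE.
have [b1 v1 e1 e1'] := br_inverse B A; have [b2 v2 e2 e2'] := br_inverse B' A'.
transitivity (brV B' A' ∘ ((p ⊠ q) ∘ br B A) ∘ brV B A).
  by rewrite -!comp_assoc; try typ; rewrite e1'; congr (_ ∘ _); symmetry; compid.
rewrite -(br_natE hg hf) comp_assoc; [|typ|typ].
by rewrite e2; congr (_ ∘ _); compid.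
Qed.

Lemma xing_inv o A B : xing (~~ o) B A ∘ xing o A B = idm (A ⊗ B).
Proof. by case: o; rewrite /xing; [case: (br_inverse A B) | case: (br_inverse B A)]. Qed.

Lemma xing_unitr o A : xing o A unit = idm A.
Proof.
have e : br A unit = idm A.
  have := br_hexr A unit unit; rewrite tarr_unitl tarr_unitr tob_unitl => e.
  have [b v ei _] := br_inverse A unit; rewrite tob_unitl tob_unitr in b v ei.
  rewrite -ei -[in LHS](idl_hom b (erefl A)) -ei -comp_assoc; try typ.
  by rewrite -e.
case: o; rewrite /xing //.
by have [b v ei _] := br_inverse unit A; move: b v ei;
    rewrite br_unitl !tob_unitl !tob_unitr => b v <-; symmetry; compid.
Qed.

Lemma xing_unitl o A : xing o unit A = idm A.
Proof.
have h : xing o unit A ∈ A ⇒ A.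
  by have := xing_hom o unit A; rewrite tob_unitl tob_unitr.
have := xing_inv o unit A; rewrite xing_unitr tob_unitl => <-.
by symmetry; compid.
Qed.

Lemma xing_hexl o (A B D : ob S) : xing o (A ⊗ B) D = (xing o A D ⊠ idm B) ∘ (idm A ⊠ xing o B D).
Proof.
case: o; rewrite /xing; first exact: br_hexl.
have [b1 v1 _ e1] := br_inverse D A; have [b2 v2 _ e2] := br_inverse D B.
have [b v e _] := br_inverse D (A ⊗ B).
transitivity (brV D (A ⊗ B) ∘ (br D (A ⊗ B) ∘ ((brV D A ⊠ idm B) ∘ (idm A ⊠ brV D B)))).
  rewrite br_hexr; have -> : (idm A ⊠ br D B) ∘ (br D A ⊠ idm B)
      ∘ ((brV D A ⊠ idm B) ∘ (idm A ⊠ brV D B)) = idm (A ⊗ B ⊗ D).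
    rewrite -comp_assoc; try typ.
    rewrite [(br D A ⊠ _) ∘ _]comp_assoc; try typ.
    rewrite -whiskerr ?e1; last by typ.
    rewrite tarr_idm (idl_hom (tarr_hom (idm_hom A) v2)) ?tob_assoc //.
    by rewrite -whiskerl ?e2 ?tarr_idm ?tob_assoc //; typ.
  by symmetry; compid.
rewrite comp_assoc; try typ.
by rewrite e; compid.
Qed.

Lemma xing_hexr o (A B D : ob S) : xing o A (B ⊗ D) = (idm B ⊠ xing o A D) ∘ (xing o A B ⊠ idm D).
Proof.
case: o; rewrite /xing; first exact: br_hexr.
have [b1 v1 _ e1] := br_inverse B A; have [b2 v2 _ e2] := br_inverse D A.
have [b v e _] := br_inverse (B ⊗ D) A.
transitivity (brV (B ⊗ D) A ∘ (br (B ⊗ D) A ∘ ((idm B ⊠ brV D A) ∘ (brV B A ⊠ idm D)))).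
  rewrite br_hexl; have -> : (br B A ⊠ idm D) ∘ (idm B ⊠ br D A)
      ∘ ((idm B ⊠ brV D A) ∘ (brV B A ⊠ idm D)) = idm (A ⊗ B ⊗ D).
    rewrite -comp_assoc; try typ.
    rewrite [(idm B ⊠ br D A) ∘ _]comp_assoc; try typ.
    rewrite -whiskerl ?e2; last by typ.
    rewrite tarr_idm (idl_hom (tarr_hom v1 (idm_hom D))) ?tob_assoc //.
    by rewrite -whiskerr ?e1 ?tarr_idm //; typ.
  by symmetry; compid.
rewrite comp_assoc; try typ.
by rewrite e; compid.
Qed.

Lemma cross_right_cons o x a v :
  cross_right o x (a :: v) = (0, Cross o x a) :: shift 1 (cross_right o x v).
Proof.
rewrite /cross_right /shift /= -map_comp (iotaDl 1 0).
by congr (_ :: _); move: (iota _ _) => s; elim: s v => [|i s IH] [|b v] //=; rewrite IH.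
Qed.

Lemma shift0 D : shift 0 D = D.
Proof. by elim: D => [|[k g] D IH] //=; rewrite IH. Qed.

Lemma cross_right_den o x v :
  [/\ wf sg (x :: v) (cross_right o x v), tgt sg (x :: v) (cross_right o x v) = rcons v x
    & den (x :: v) (cross_right o x v) = xing o (nth unit oenv x) (obw v)].
Proof.
elim: v => [|a v [w1 t1 d1]].
  by split; rewrite //= xing_unitr tob_unitr.
rewrite cross_right_cons /=.
have := whisker [:: a] [::] w1; rewrite !cats0 /= => -[w2 t2 d2].
have := fits_cat [::] v (Cross o x a); have := next_cat [::] v (Cross o x a).
have := sarr_cat [::] v (Cross o x a); rewrite /= => -> -> ->.
rewrite w2 t2 d2 t1; split=> //.
rewrite d1 tarr_unitl tarr_unitr tob_unitr.
by rewrite xing_hexr.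
Qed.

Lemma cross_left_den o x v :
  [/\ wf sg (rcons v x) (cross_left o x v), tgt sg (rcons v x) (cross_left o x v) = x :: v
    & den (rcons v x) (cross_left o x v) = xing o (obw v) (nth unit oenv x)].
Proof.
elim: v => [|a v [w1 t1 d1]].
  by split; rewrite //= xing_unitl tob_unitr.
rewrite /= -[rcons (shift _ _) _]cats1.
have := whisker [:: a] [::] w1; rewrite !cats0 /= => -[w2 t2 d2].
have f := fits_cat [::] v (Cross o a x); have n := next_cat [::] v (Cross o a x).
have s := sarr_cat [::] v (Cross o a x); rewrite /= in f n s.
have w3 : wf sg (a :: rcons v x) (shift 1 (cross_left o x v) ++ [:: (0, Cross o a x)]).
  by rewrite wf_cat w2 t2 t1 /= f.
rewrite den_cat // tgt_cat t2 t1 /= n s; split=> //.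
rewrite d2 d1 !tarr_unitr tarr_unitl xing_hexl tob_unitr.
rewrite (idl_hom (tarr_hom (xing_hom o _ _) (idm_hom (obw v)))) //.
by rewrite drop0 tob_assoc.
Qed.

Lemma rcons_split (D : seq slice) s w : wf sg w (rcons D s) ->
  [/\ wf sg w D, fits sg (tgt sg w D) s
    & den w (rcons D s) = sarr (tgt sg w D) s ∘ den w D].
Proof.
rewrite -cats1 => h; have := h; rewrite wf_cat => /= /andP[h1 /andP[h2 _]].
by split; rewrite // den_cat //= (idl_hom (sarr_hom h2)).
Qed.

Lemma nat_right_holds o x g : rule_holds (nat_right sg o x g).
Proof.
case/and3P=> /= wl wr _; have [w1 f1 ->] := rcons_split wl.
have [_ t1 d1] := cross_right_den o x (gin sg g); rewrite t1 d1 in f1 *.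
have := whisker [:: x] [::] (D := [:: (0, g)]) (w := gin sg g).
have := sarr_cat [::] [:: x] g; have := next_cat [:: x] [::] g; have := sarr_cat [:: x] [::] g.
rewrite !cats0 !cats1 /= !tarr_unitl !tarr_unitr !tob_unitr => -> -> -> _.
have [_ _ ->] := cross_right_den o x (gout sg g).
by rewrite (xing_natE _ (idm_hom _) (garr_hom g)).
Qed.

Lemma nat_left_holds o x g : rule_holds (nat_left sg o x g).
Proof.
case/and3P=> /= wl wr _; have [w1 f1 ->] := rcons_split wl.
have [_ t1 d1] := cross_left_den o x (gin sg g); rewrite t1 d1 in f1 *.
have := sarr_cat [::] [:: x] g; have := next_cat [::] [:: x] g; have := sarr_cat [:: x] [::] g.
rewrite !cats0 !cats1 /= !tarr_unitl !tarr_unitr !tob_unitr => -> -> ->.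
have [_ _ ->] := cross_left_den o x (gout sg g).
by rewrite (xing_natE _ (garr_hom g) (idm_hom _)).
Qed.

Lemma cancel_holds o a b : rule_holds (cancel_rule o a b).
Proof.
move=> _; rewrite /den /sarr /= !tarr_unitl !tarr_unitr tob_unitr.
rewrite (idl_hom (xing_hom _ _ _)) //.
exact: xing_inv.
Qed.

Lemma flip_holds r : rule_holds r -> rule_holds (flip r).
Proof.
by move=> h /and3P[/= w1 w2 /eqP t]; symmetry; apply: h; rewrite /rule_wf w1 w2 t /=.
Qed.

Lemma den_cons u v w x k g D : k = size u -> w = u ++ gin sg g ++ v -> x = u ++ gout sg g ++ v ->
  den w ((k, g) :: D) = den x D ∘ (I u ⊠ garr g ⊠ I v).
Proof. by move=> -> -> -> /=; rewrite next_cat sarr_cat. Qed.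

Lemma pull_left_holds o x g : rule_holds (pull_left sg o x g).
Proof.
have hg := garr_hom g.
rewrite /pull_left; case ei: (gin sg g) hg => [|//]; case eo: (gout sg g) => [//|a v] hg _.
set X := nth unit oenv x.
change (den [:: x] [:: (1, g); (0, Cross o x a)]
  = den [:: x] ((0, g) :: shift 1 (cross_left (~~ o) x v))).
have [w1 t1 d1] := cross_left_den (~~ o) x v.
have [_ _ d2] := whisker [:: a] [::] w1.
rewrite (@den_cons [:: x] [::] _ [:: x, a & v]) ?ei ?eo ?cats0 //.
rewrite (@den_cons [::] v _ [:: a, x & v]) //.
rewrite (@den_cons [::] [:: x] _ (a :: rcons v x)) ?ei ?eo /= ?cats1 //.
rewrite /= cats0 in d2; rewrite d2 d1 /= -/X !tarr_unitl !tarr_unitr !tob_unitr.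
have hx := idm_hom X; have := xing_natE o hx hg.
rewrite xing_unitr (idr_hom (tarr_hom hg hx)) ?tob_unitl // => <- /=.
have k := xing_hom o X (nth unit oenv a); have k' := xing_hom o X (obw v).
have k2 := xing_hom (~~ o) (obw v) X.
rewrite /= in hg; rewrite xing_hexr -comp_assoc; try typ.
rewrite [RHS]comp_assoc; try typ.
rewrite [_ ∘ (_ ∘ (xing o X _ ⊠ _))]comp_assoc; try typ.
rewrite -whiskerl ?xing_inv; last by typ.
by rewrite !tarr_idm -[RHS]comp_assoc; try typ.
Qed.

Lemma pull_sink_holds o x g : rule_holds (pull_sink sg o x g).
Proof.
have hg := garr_hom g.
rewrite /pull_sink; case ei: (gin sg g) hg => [//|a v]; case eo: (gout sg g) => [|//] hg.
case/and3P=> _ wr _; set X := nth unit oenv x.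
change (den [:: a, x & v] [:: (0, Cross o a x); (1, g)]
  = den [:: a, x & v] (rcons (shift 1 (cross_right (~~ o) x v)) (0, g))).
have [w1 t1 d1] := cross_right_den (~~ o) x v.
have [w2 t2 d2] := whisker [:: a] [::] w1.
rewrite /= cats0 in w2 t2 d2; rewrite t1 cats0 in t2.
have [_ _ ->] := rcons_split wr.
rewrite (@den_cons [::] v _ [:: x, a & v]) //.
rewrite (@den_cons [:: x] [::] _ [:: x]) ?ei ?eo ?cats0 //.
have := sarr_cat [::] [:: x] g; rewrite ei /= cats1 => es.
rewrite t2 es d2 d1 /= -/X !tarr_unitl !tarr_unitr !tob_unitr.
have hx := idm_hom X; have := xing_natE (~~ o) hx hg.
rewrite /= xing_unitr (idl_hom (tarr_hom hx hg)) ?tob_unitr // => ->.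
have k := xing_hom o (nth unit oenv a) X; have k' := xing_hom (~~ o) X (obw v).
have k2 := xing_hom (~~ o) X (nth unit oenv a).
rewrite /= in hg; rewrite xing_hexr -!comp_assoc; try typ.
rewrite -whiskerr ?xing_inv; last by typ.
by congr (_ ∘ _); rewrite tarr_idm; compid.
Qed.

Lemma crossing_rules_hold g c : all_hold (crossing_rules sg g c).
Proof.
have R := nat_right_holds; have F := fun o x g => flip_holds (@nat_right_holds o x g).
have L := nat_left_holds; have G := fun o x g => flip_holds (@nat_left_holds o x g).
have P := pull_left_holds; have Q := pull_sink_holds.
case: c => [//|o a b] /=; case: (gin sg g) => [|i v]; case: (gout sg g) => [|j [|j' v']];
  by case: g => [n|o' a' b'] /=; repeat (case: ifP => _ /=); repeat (split=> //).
Qed.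

Lemma structural_hold D : all_hold (structural_rules sg D).
Proof.
apply: all_hold_cat; apply: all_hold_flatten.
  by case=> [n|o a b] //=; split=> //; apply: cancel_holds.
by move=> g; apply: all_hold_flatten => c; apply: crossing_rules_hold.
Qed.

Lemma normalise_sound fuel rs w D : all_hold rs -> wf sg w D ->
  [/\ wf sg w (normalise sg fuel rs w D), tgt sg w (normalise sg fuel rs w D) = tgt sg w D
    & den w (normalise sg fuel rs w D) = den w D].
Proof.
move=> hrs; elim: fuel D => [|n IH] D hD //=.
case E: (first_rewrite _ _ _ _) => [D'|].
  have [w1 <- <-] := first_rewrite_sound (structural_hold D) E hD; exact: IH.
case F: (first_rewrite _ _ _ _) => [D'|//].
have [w1 <- <-] := first_rewrite_sound hrs F hD; exact: IH.
Qed.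

Fixpoint oden (A : oexp) : ob S :=
  match A with OUnit => unit | OAtom n => nth unit oenv n | OTen A B => oden A ⊗ oden B end.

Fixpoint tden (t : term) : arr S :=
  match t with
  | TId A => idm (oden A)
  | TBox n => nth (idm unit) benv n
  | TCross true A B => br (oden A) (oden B)
  | TCross false A B => brV (oden B) (oden A)
  | TComp g f => tden g ∘ tden f
  | TTen f g => tden f ⊠ tden g
  end.

Lemma obw_flat A : obw (flat A) = oden A.
Proof. by elim: A => [|n|A IHA B IHB] //=; rewrite ?tob_unitr // obw_cat IHA IHB. Qed.

Lemma cross_words_den o v w :
  [/\ wf sg (v ++ w) (cross_words o v w), tgt sg (v ++ w) (cross_words o v w) = w ++ v
    & den (v ++ w) (cross_words o v w) = xing o (obw v) (obw w)].
Proof.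
elim: v => [|x v [w1 t1 d1]]; first by rewrite cats0 /= xing_unitl.
have := whisker [:: x] [::] w1; rewrite t1 d1 !cats0 => -[w2 t2 d2].
have [w3 t3 d3] := cross_right_den o x w.
have := whisker [::] v w3; rewrite t3 d3 shift0 cat_rcons => -[w4 t4 d4].
have h : wf sg ((x :: v) ++ w) (cross_words o (x :: v) w).
  by rewrite [cross_words _ _ _]/= wf_cat -cat1s -catA w2 t2.
rewrite h [cross_words _ _ _]/= tgt_cat den_cat // -cat1s -catA t2; split=> //.
by rewrite d2 d4 /= tarr_unitl tarr_unitr tob_unitr -xing_hexl.
Qed.

Lemma compile_sound (t : term) : twf sg t ->
  [/\ wf sg (tdom sg t) (compile sg t), tgt sg (tdom sg t) (compile sg t) = tcod sg t
    & den (tdom sg t) (compile sg t) = tden t].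
Proof.
elim: t => [A|n|o A B|g IHg f IHf|f IHf g IHg] /=.
- by rewrite obw_flat.
- have := fits_cat [::] [::] (Box n); have := next_cat [::] [::] (Box n).
  have := sarr_cat [::] [::] (Box n); rewrite /= !cats0 => -> -> -> _.
  split=> //; rewrite tarr_unitl tarr_unitr; exact: idl_hom (box_hom n) erefl.
- have [w1 t1 d1] := cross_words_den o (flat A) (flat B).
  by rewrite w1 t1 d1 !obw_flat; case: o {w1 t1 d1}.
- case/and3P=> /IHg[wg tg dg] /IHf[wf_ tf df] /eqP e.
  have h : wf sg (tdom sg f) (compile sg f ++ compile sg g) by rewrite wf_cat wf_ tf e.
  by rewrite h den_cat // tgt_cat tf e tg dg df.
- case/andP=> /IHf[wf_ tf df] /IHg[wg tg dg].
  have [w1 t1 d1] := whisker [::] (tdom sg g) wf_.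
  have := whisker (tcod sg f) [::] wg; rewrite !cats0 => -[w2 t2 d2].
  rewrite shift0 /= tf in w1 t1 d1.
  have h : wf sg (tdom sg f ++ tdom sg g)
     (compile sg f ++ shift (size (tcod sg f)) (compile sg g)) by rewrite wf_cat w1 t1.
  rewrite h tgt_cat den_cat // t1 t2 d1 d2 tg df dg tarr_unitl tarr_unitr; split=> //.
  have := den_hom wf_; have := den_hom wg; rewrite tf df tg dg => hg hf.
  by rewrite (tarr_rl hf hg).
Qed.

Fixpoint hold (rs : seq (term * term)) : Prop :=
  if rs is p :: rs' then tden p.1 = tden p.2 /\ hold rs' else True.

Lemma compile_rules_hold rs : hold rs -> all (fun p => twf sg p.1 && twf sg p.2) rs ->
  all (fun p => tdom sg p.1 == tdom sg p.2) rs -> all_hold (map (compile_rule sg) rs).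
Proof.
elim: rs => //= -[l r] rs IH [/= e h] /andP[/andP[wl wr] ws] /andP[/eqP ed eds]; split; last exact: IH.
move=> _; have [_ _ /= ->] := compile_sound wl; rewrite ed.
by have [_ _ ->] := compile_sound wr.
Qed.

(** Both sides are brought to a diagram with the same denotation, so equal
    normal forms give equal arrows; nothing is claimed when they differ. *)
Lemma check_sound fuel rs (l r : term) : hold rs -> check sg fuel rs l r -> tden l = tden r.
Proof.
move=> hrs /and5P[wl wr /eqP e ws /andP[ds /eqP n]].
have hr := compile_rules_hold hrs ws ds.
have red (t : term) : twf sg t -> den (tdom sg t) (solve_nf sg fuel rs t) = tden t.
  move=> wt; have [w1 t1 <-] := compile_sound wt.
  have [w2 t2 <-] := normalise_sound fuel hr w1.
  by have [d] := deforms_planar (normalise sg fuel (map (compile_rule sg) rs) (tdom sg t) (compile sg t));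
    have [_ _ ->] := d _ w2.
by rewrite -(red l wl) -(red r wr) n e.
Qed.
End Semantics.

Fixpoint valid (S : ribbonCat) (oenv : seq (ob S)) (bs : seq (arr S)) (ts : seq (oexp * oexp)) : Prop :=
  match bs, ts with
  | f :: bs', t :: ts' => f ∈ oden oenv t.1 ⇒ oden oenv t.2 /\ valid oenv bs' ts'
  | [::], [::] => True
  | _, _ => False
  end.

Definition sig_of (ts : seq (oexp * oexp)) : signature := [seq (flat t.1, flat t.2) | t <- ts].

Lemma diagram_sound (S : ribbonCat) (oenv : seq (ob S)) (benv : seq (arr S)) ts rs fuel l r :
  valid oenv benv ts -> hold oenv benv rs -> check (sig_of ts) fuel rs l r = true ->
  tden oenv benv l = tden oenv benv r.
Proof.
move=> hv hrs; apply: check_sound => //= n; rewrite /gin /gout /=.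
elim: benv ts n hv {hrs} => [|f bs IH] [|t ts] [|n] //=; try by move=> _; apply: idm_hom.
- by case=> h _; rewrite !obw_flat.
- by case=> _; apply: IH.
Qed.

Ltac index x l :=
  lazymatch l with
  | x :: _ => constr:(0)
  | _ :: ?l' => let n := index x l' in constr:(n.+1)
  end.
Ltac adjoin x l :=
  lazymatch l with
  | context [x :: _] => l
  | _ => constr:(x :: l)
  end.

Ltac boxes t acc :=
  lazymatch t with
  | comp ?g ?f => let acc := boxes g acc in boxes f acc
  | tarr ?f ?g => let acc := boxes f acc in boxes g acc
  | idm _ => acc
  | br _ _ => acc
  | brV _ _ => acc
  | ?f => adjoin f acc
  end.
Ltac boxes_rules rs acc :=
  lazymatch rs with
  | (?rs', ?e) => let acc := boxes_rules rs' acc in boxes_rules e acc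
  | tt => acc
  | ?e => lazymatch type of e with ?l = ?r => let acc := boxes l acc in boxes r acc end
  end.

(** A box is any arrow that is not built from composition, tensor product,
    identities and braidings; its source and target are found among the
    hypotheses and the hints for [is_hom]. *)
Ltac typing f :=
  lazymatch constr:(ltac:(eexists; eexists;
      first [solve [eauto 2 with hom nocore] | fail 2 "diagram: no type known for" f])
    : exists A B, is_hom A B f) with
  | @ex_intro _ _ _ (@ex_intro _ _ _ ?p) => p
  end.
Ltac typings bs :=
  lazymatch bs with
  | ?f :: ?bs' => let p := typing f in let q := typings bs' in constr:((p, q))
  | _ => constr:(tt)
  end.

Ltac atoms_ob A acc :=
  lazymatch A with
  | tob ?A ?B => let acc := atoms_ob A acc in atoms_ob B acc
  | unit => acc
  | _ => adjoin A acc
  end.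
Ltac atoms t acc :=
  lazymatch t with
  | comp ?g ?f => let acc := atoms g acc in atoms f acc
  | tarr ?f ?g => let acc := atoms f acc in atoms g acc
  | idm ?A => atoms_ob A acc
  | br ?A ?B => let acc := atoms_ob A acc in atoms_ob B acc
  | brV ?A ?B => let acc := atoms_ob A acc in atoms_ob B acc
  | _ => acc
  end.
Ltac atoms_rules rs acc :=
  lazymatch rs with
  | (?rs', ?e) => let acc := atoms_rules rs' acc in atoms_rules e acc
  | tt => acc
  | ?e => lazymatch type of e with ?l = ?r => let acc := atoms l acc in atoms r acc end
  end.
Ltac atoms_typings ps acc :=
  lazymatch ps with
  | (?p, ?q) =>
      lazymatch type of p with is_hom ?A ?B _ =>
        let acc := atoms_ob A acc in let acc := atoms_ob B acc in atoms_typings q acc end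
  | tt => acc
  end.

Ltac reify_ob os A :=
  lazymatch A with
  | tob ?A ?B => let a := reify_ob os A in let b := reify_ob os B in constr:(OTen a b)
  | unit => constr:(OUnit)
  | _ => let n := index A os in constr:(OAtom n)
  end.
Ltac reify os bs t :=
  lazymatch t with
  | comp ?g ?f => let g' := reify os bs g in let f' := reify os bs f in constr:(TComp g' f')
  | tarr ?f ?g => let f' := reify os bs f in let g' := reify os bs g in constr:(TTen f' g')
  | idm ?A => let a := reify_ob os A in constr:(TId a)
  | br ?A ?B => let a := reify_ob os A in let b := reify_ob os B in constr:(TCross true a b)
  | brV ?B ?A => let a := reify_ob os A in let b := reify_ob os B in constr:(TCross false a b)
  | ?f => let n := index f bs in constr:(TBox n)
  end.
Ltac reify_rules os bs rs acc :=
  lazymatch rs with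
  | (?rs', ?e) => let acc := reify_rules os bs e acc in reify_rules os bs rs' acc
  | tt => acc
  | ?e => lazymatch type of e with
      ?l = ?r => let l' := reify os bs l in let r' := reify os bs r in constr:((l', r') :: acc) end
  end.
Ltac rules_proof rs acc :=
  lazymatch rs with
  | (?rs', ?e) => let acc := rules_proof e acc in rules_proof rs' acc
  | tt => acc
  | ?e => constr:(conj e acc)
  end.
Ltac reify_typings os ps :=
  lazymatch ps with
  | (?p, ?q) =>
      lazymatch type of p with is_hom ?A ?B _ =>
        let a := reify_ob os A in let b := reify_ob os B in
        let ts := reify_typings os q in constr:((a, b) :: ts) end
  | tt => constr:(@nil (oexp * oexp))
  end.
Ltac valid_proof ps :=
  lazymatch ps with
  | (?p, ?q) => let r := valid_proof q in constr:(conj p r)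
  | tt => constr:(I)
  end.

Ltac with_reified rs k :=
  lazymatch goal with |- @eq (arr ?R) ?l ?r =>
    let Sm := lazymatch type of l with arr ?Sm => Sm end in
    let bs := boxes l (@nil (arr Sm)) in
    let bs := boxes r bs in
    let bs := boxes_rules rs bs in
    let ps := typings bs in
    let os := atoms l (@nil (ob Sm)) in
    let os := atoms r os in
    let os := atoms_rules rs os in
    let os := atoms_typings ps os in
    let l' := reify os bs l in
    let r' := reify os bs r in
    let rs' := reify_rules os bs rs (@nil (term * term)) in
    let ts := reify_typings os ps in
    k Sm os bs ps ts rs' l' r'
  end.

Ltac diagram_with fuel rs :=
  with_reified rs ltac:(fun Sm os bs ps ts rs' l' r' =>
    let pv := valid_proof ps in
    let pr := rules_proof rs constr:(I) in
    refine (@diagram_sound _ os bs ts rs' fuel l' r' pv pr _); vm_compute; exact (erefl true)).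

(** [diagram (e1, ..., en)] proves an equation between arrows that are equal up
    to isotopy and the equations [e1], ..., [en], used from left to right. *)
Tactic Notation "diagram" := diagram_with 200 tt.
Tactic Notation "diagram" constr(rs) := diagram_with 200 rs.

Local Notation I := idm.

(** * Identities in a Hopf algebra *)

Section Hopf.
Variables (S : ribbonCat) (H : hopfAlg S).
Local Notation H0 := (carrier H).
Local Notation mu := (mu H).
Local Notation Delta := (Delta H).
Local Notation eta := (eta H).
Local Notation eps := (eps H).
Local Notation Sa := (antip H).
Local Notation Sv := (antipV H).

Local Notation Delta2 := ((I H0 ⊠ br H0 H0 ⊠ I H0) ∘ (Delta ⊠ Delta)).

(** The comultiplication is an algebra map, with the braiding spelled out so that
    the rule can be used on diagrams. *)
Lemma mul_comul : Delta ∘ mu = (mu ⊠ mu) ∘ Delta2.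
Proof. rewrite Delta_mu /mu2. diagram. Qed.

(** The antipode axiom next to a further factor, in right-nested form. *)
Lemma antip_right_mul : mu ∘ (I H0 ⊠ (mu ∘ (Sa ⊠ I H0))) ∘ (Delta ⊠ I H0) = eps ⊠ I H0.
Proof.
transitivity (mu ∘ ((mu ∘ (I H0 ⊠ Sa) ∘ Delta) ⊠ I H0)); first by diagram (mu_assoc H).
by rewrite antip_right; diagram (mu_etal H).
Qed.

(** Both sides are convolution inverses of the multiplication, the left one from
    the left and the right one from the right, in the algebra of arrows
    [H ⊗ H → H] with the coalgebra structure [Delta2] on the source. *)
Lemma antip_mu : Sa ∘ mu = mu ∘ br H0 H0 ∘ (Sa ⊠ Sa).
Proof.
set h := (X in _ = X).
have hh : h ∈ H0 ⊗ H0 ⇒ H0 by rewrite /h; hom.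
have A : mu ∘ (mu ⊠ h) ∘ Delta2 = eta ∘ (eps ⊠ eps).
  transitivity (mu ∘ (I H0 ⊠ ((mu ∘ (I H0 ⊠ (mu ∘ (Sa ⊠ I H0))) ∘ (Delta ⊠ I H0))
     ∘ br H0 H0)) ∘ (I H0 ⊠ Sa ⊠ I H0) ∘ (Delta ⊠ I H0)).
    by rewrite /h; diagram (mu_assoc H).
  by rewrite antip_right_mul; diagram (antip_right H).
have B : mu ∘ ((Sa ∘ mu) ⊠ mu) ∘ Delta2 = eta ∘ (eps ⊠ eps).
  transitivity (mu ∘ (Sa ⊠ I H0) ∘ Delta ∘ mu); last by rewrite antip_left; diagram (eps_mu H).
  diagram mul_comul.
transitivity (mu ∘ (((mu ∘ ((Sa ∘ mu) ⊠ mu) ∘ Delta2)) ⊠ h) ∘ Delta2).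
  transitivity (mu ∘ ((Sa ∘ mu) ⊠ (mu ∘ (mu ⊠ h) ∘ Delta2)) ∘ Delta2).
    rewrite A. diagram (mu_etar H, Delta_epsr H).
  diagram (mu_assoc H, Delta_coassoc H).
rewrite B. diagram (mu_etal H, Delta_epsl H).
Qed.

Lemma antip_eta : Sa ∘ eta = eta.
Proof.
transitivity (mu ∘ (Sa ⊠ I H0) ∘ Delta ∘ eta); first by diagram (Delta_eta H, mu_etar H).
by rewrite antip_left; diagram (eps_eta H).
Qed.

Lemma eps_antip : eps ∘ Sa = eps.
Proof.
transitivity (eps ∘ (mu ∘ (Sa ⊠ I H0) ∘ Delta)); last by rewrite antip_left; diagram (eps_eta H).
diagram (eps_mu H, Delta_epsr H).
Qed.

(** The dual argument: both sides are convolution inverses of the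
    comultiplication. *)
Lemma Delta_antip : Delta ∘ Sa = br H0 H0 ∘ (Sa ⊠ Sa) ∘ Delta.
Proof.
set h := (X in _ = X).
have hh : h ∈ H0 ⇒ H0 ⊗ H0 by rewrite /h; hom.
pose mu2 := (mu ⊠ mu) ∘ (I H0 ⊠ br H0 H0 ⊠ I H0).
have A : mu2 ∘ (Delta ⊠ h) ∘ Delta = (eta ⊠ eta) ∘ eps.
  transitivity ((mu ⊠ I H0) ∘ (I H0 ⊠ br H0 H0) ∘ (I H0 ⊠ ((mu ∘ (I H0 ⊠ Sa) ∘ Delta) ⊠ Sa))
       ∘ (I H0 ⊠ Delta) ∘ Delta).
    by rewrite /h /mu2; diagram (mu_assoc H, Delta_coassoc H).
  rewrite antip_right. diagram (antip_right H, mu_etal H, mu_etar H, Delta_epsl H).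
have B : mu2 ∘ ((Delta ∘ Sa) ⊠ Delta) ∘ Delta = (eta ⊠ eta) ∘ eps.
  transitivity (Delta ∘ (mu ∘ (Sa ⊠ I H0) ∘ Delta)); last by rewrite antip_left; diagram (Delta_eta H).
  rewrite /mu2. diagram mul_comul.
transitivity (mu2 ∘ ((mu2 ∘ ((Delta ∘ Sa) ⊠ Delta) ∘ Delta) ⊠ h) ∘ Delta).
  transitivity (mu2 ∘ ((Delta ∘ Sa) ⊠ (mu2 ∘ (Delta ⊠ h) ∘ Delta)) ∘ Delta).
    rewrite A /mu2. diagram (mu_etar H, Delta_epsr H).
  rewrite /mu2. diagram (mu_assoc H, Delta_coassoc H).
rewrite B /mu2. diagram (mu_etal H, Delta_epsl H).
Qed.

Lemma antipVK : Sv ∘ Sa = I H0.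
Proof. by case: (antip_inverse H). Qed.

Lemma antipKV : Sa ∘ Sv = I H0.
Proof. by case: (antip_inverse H). Qed.

(** Conjugating the laws of the antipode by its inverse gives laws of the
    inverse, with the inverse braiding. *)
Lemma antipV_mu : Sv ∘ mu = mu ∘ brV H0 H0 ∘ (Sv ⊠ Sv).
Proof.
transitivity (Sv ∘ (mu ∘ br H0 H0 ∘ (Sa ⊠ Sa)) ∘ brV H0 H0 ∘ (Sv ⊠ Sv)); first by diagram antipKV.
rewrite -antip_mu. diagram antipVK.
Qed.

Lemma Delta_antipV : Delta ∘ Sv = (Sv ⊠ Sv) ∘ brV H0 H0 ∘ Delta.
Proof.
transitivity ((Sv ⊠ Sv) ∘ brV H0 H0 ∘ (br H0 H0 ∘ (Sa ⊠ Sa) ∘ Delta) ∘ Sv); first by diagram antipVK.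
rewrite -Delta_antip. diagram antipKV.
Qed.

Lemma antipV_eta : Sv ∘ eta = eta.
Proof. rewrite -[X in _ ∘ X]antip_eta. diagram antipVK. Qed.

Lemma antipV_left : mu ∘ (Sv ⊠ I H0) ∘ brV H0 H0 ∘ Delta = eta ∘ eps.
Proof.
transitivity (Sv ∘ (mu ∘ (Sa ⊠ I H0) ∘ Delta)).
  diagram (antipV_mu, antipVK).
rewrite antip_left. diagram antipV_eta.
Qed.

Lemma antipV_right : mu ∘ (I H0 ⊠ Sv) ∘ brV H0 H0 ∘ Delta = eta ∘ eps.
Proof.
transitivity (Sv ∘ (mu ∘ (I H0 ⊠ Sa) ∘ Delta)).
  diagram (antipV_mu, antipVK).
rewrite antip_right. diagram antipV_eta.
Qed.

(** Up to braidings this says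
    [(x_2 y)_2 ⊗ S^-1((x_2 y)_1) x_1 = x y_2 ⊗ S^-1(y_1)], which is why the
    associator in degrees 011 and 111 respects the action of [H]. *)
Lemma antipV_absorb :
  (I H0 ⊠ mu) ∘ (((I H0 ⊠ Sv) ∘ brV H0 H0 ∘ Delta) ⊠ I H0) ∘ brV H0 H0
    ∘ (I H0 ⊠ mu) ∘ (Delta ⊠ I H0)
  = (mu ⊠ Sv) ∘ (I H0 ⊠ (brV H0 H0 ∘ Delta)).
Proof.
transitivity ((mu ⊠ (mu ∘ (Sv ⊠ (mu ∘ (Sv ⊠ I H0) ∘ brV H0 H0 ∘ Delta))))
  ∘ brV (H0 ⊗ H0 ⊗ H0) H0 ∘ (Delta ⊠ (brV H0 H0 ∘ Delta))).
  diagram (mul_comul, antipV_mu, mu_assoc H, Delta_coassoc H).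
rewrite antipV_left. diagram (mu_etar H, Delta_epsl H).
Qed.
End Hopf.

(** * Associators on the disjoint union *)

Section Alpha.
Variables (S : ribbonCat) (H : hopfAlg S).
Local Notation H0 := (carrier H).
Local Notation mu := (mu H).
Local Notation Delta := (Delta H).
Local Notation eta := (eta H).
Local Notation eps := (eps H).
Local Notation Sa := (antip H).
Local Notation Sv := (antipV H).
Implicit Types (X Y Z W : hmod H + ob S).

(** What [gam], [del] and [phi] have to satisfy. The equation [eqijkl] is the
    pentagon for objects of degrees [i], [j], [k], [l] with the actions of [H]
    removed; the remaining pentagons follow from the axioms of a Hopf algebra.
    [del_eps] is the triangle, and the elements [gamV], [delV], [phiV] provide
    the inverses of the associators in degrees 010, 101 and 111. [delV] is
    inverse to [del] for the product [x_1 y_1 ⊗ y_2 x_2]. *)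
Record associator_data (gam del phi gamV delV phiV : arr S) : Prop := AssociatorData {
  gam_hom : gam ∈ 𝟏 ⇒ H0 ⊗ H0;
  del_hom : del ∈ 𝟏 ⇒ H0 ⊗ H0;
  phi_hom : phi ∈ H0 ⇒ H0;
  gamV_hom : gamV ∈ 𝟏 ⇒ H0 ⊗ H0;
  delV_hom : delV ∈ 𝟏 ⇒ H0 ⊗ H0;
  phiV_hom : phiV ∈ H0 ⇒ H0;
  gam_gamV : (mu ⊠ mu) ∘ (I H0 ⊠ br H0 H0 ⊠ I H0) ∘ (gam ⊠ gamV) = eta ⊠ eta;
  gamV_gam : (mu ⊠ mu) ∘ (I H0 ⊠ br H0 H0 ⊠ I H0) ∘ (gamV ⊠ gam) = eta ⊠ eta;
  del_delV : (mu ⊠ mu) ∘ (I H0 ⊠ delV ⊠ I H0) ∘ del = eta ⊠ eta;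
  delV_del : (mu ⊠ mu) ∘ (I H0 ⊠ del ⊠ I H0) ∘ delV = eta ⊠ eta;
  phi_phiV : phi ∘ phiV = I H0;
  phiV_phi : phiV ∘ phi = I H0;
  del_eps : (I H0 ⊠ eps) ∘ del = eta;
  eq0010 : (Delta ⊠ I H0) ∘ gam
    = (I (H0 ⊗ H0) ⊠ mu) ∘ (I H0 ⊠ br H0 H0 ⊠ I H0) ∘ (gam ⊠ gam);
  eq0100 : (I H0 ⊠ Delta) ∘ gam
    = (mu ⊠ I (H0 ⊗ H0)) ∘ (I H0 ⊠ br H0 H0 ⊠ I H0) ∘ (gam ⊠ gam);
  eq1001 : (I H0 ⊠ Delta) ∘ del = (mu ⊠ br H0 H0) ∘ (I H0 ⊠ del ⊠ I H0) ∘ del;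
  eq0101 :
    (I H0 ⊠ br H0 H0) ∘ (mu ⊠ I H0 ⊠ Sv) ∘ (I H0 ⊠ del ⊠ I H0) ∘ brV H0 H0 ∘ Delta
    = (I H0 ⊠ mu ⊠ mu) ∘ (I (H0 ⊗ H0) ⊠ br H0 H0 ⊠ I H0) ∘ (I H0 ⊠ gam ⊠ I (H0 ⊗ H0))
      ∘ (((I H0 ⊠ Sv) ∘ brV H0 H0 ∘ Delta ∘ mu) ⊠ I H0) ∘ (I H0 ⊠ del);
  eq1010 :
    (I H0 ⊠ br H0 H0) ∘ ((Delta ∘ mu) ⊠ I H0) ∘ (I H0 ⊠ del)
    = (mu ⊠ mu ⊠ mu) ∘ (I H0 ⊠ del ⊠ I (H0 ⊗ H0 ⊗ H0)) ∘ (I H0 ⊠ br H0 H0 ⊠ I H0)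
      ∘ (Delta ⊠ gam);
  eq0111 : (phi ⊠ I H0) ∘ brV H0 H0 ∘ (I H0 ⊠ mu) ∘ (gam ⊠ I H0)
    = (I H0 ⊠ Sv) ∘ brV H0 H0 ∘ Delta ∘ phi;
  eq1011 : phi ⊠ eta = (mu ⊠ mu) ∘ (phi ⊠ del ⊠ Sv) ∘ brV H0 H0 ∘ Delta;
  eq1101 : phi ⊠ eta = (I H0 ⊠ mu) ∘ ((Delta ∘ phi ∘ mu) ⊠ I H0) ∘ (I H0 ⊠ del);
  eq1110 : (mu ⊠ I H0) ∘ (I H0 ⊠ br H0 H0) ∘ (gam ⊠ phi) = (phi ⊠ I H0) ∘ Delta;
  eq1111 : (I H0 ⊠ mu) ∘ (((I H0 ⊠ Sv) ∘ brV H0 H0 ∘ Delta) ⊠ I H0) ∘ brV H0 H0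
      ∘ (I H0 ⊠ mu) ∘ (Delta ⊠ I H0)
    = (mu ⊠ (phi ∘ mu)) ∘ (I H0 ⊠ del ⊠ phi)
}.

(** Working with the underlying arrows in [S] avoids the dependent types of the
    morphisms of the disjoint union. *)
Definition disj_map_arr X Y (f g : arr S) : arr S :=
  match X, Y with inr _, inr _ => I H0 ⊠ (f ⊠ g) | _, _ => f ⊠ g end.

Definition is_disj_hom X Y (f : arr S) : Prop :=
  match X, Y with
  | inl M, inl N => is_modhom M N f
  | inr A, inr B => f ∈ A ⇒ B
  | _, _ => False
  end.

Variables gam del phi gamV delV phiV : arr S.
Hypothesis P : associator_data gam del phi gamV delV phiV.
Let hgam := gam_hom P.
Let hdel := del_hom P.
Let hphi := phi_hom P.
Let hgamV := gamV_hom P.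
Let hdelV := delV_hom P.
Let hphiV := phiV_hom P.
Hint Resolve hgam hdel hphi hgamV hdelV hphiV : hom.

Local Notation alpha := (disj_alpha gam del phi).
Local Notation ten := (@disj_ten S H).

Definition alpha010V (M : hmod H) (B : ob S) (Q : hmod H) : arr S :=
  (I (mob M) ⊠ br (mob Q) B)
  ∘ ((act2 M Q ∘ (gamV ⊠ I (mob M ⊗ mob Q))) ⊠ I B) ∘ (I (mob M) ⊠ brV (mob Q) B).
Definition alpha011V (M : hmod H) (B C : ob S) : arr S :=
  ((act M ⊠ I H0) ∘ (I H0 ⊠ br H0 (mob M)) ∘ (Delta ⊠ I (mob M))) ⊠ I (B ⊗ C).
Definition alpha110V (A B : ob S) (Q : hmod H) : arr S :=
  (I (H0 ⊗ A ⊗ B) ⊠ act Q) ∘ (I H0 ⊠ br H0 (A ⊗ B) ⊠ I (mob Q))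
  ∘ (((I H0 ⊠ Sa) ∘ Delta) ⊠ I (A ⊗ B ⊗ mob Q)).
Definition alpha111V (A B C : ob S) : arr S :=
  (br H0 A ∘ (phiV ⊠ I A)) ⊠ I (B ⊗ C).

Definition alphaV X Y Z : arr S :=
  match X, Y, Z with
  | inl M, inl N, inl Q => I (mob M ⊗ mob N ⊗ mob Q)
  | inl M, inl N, inr C => I (mob M ⊗ mob N ⊗ C)
  | inr A, inl N, inl Q => I (A ⊗ mob N ⊗ mob Q)
  | inl M, inr B, inl Q => alpha010V M B Q
  | inl M, inr B, inr C => alpha011V M B C
  | inr A, inl N, inr C => alpha101 delV A N C
  | inr A, inr B, inl Q => alpha110V A B Q
  | inr A, inr B, inr C => alpha111V A B C
  end.

Ltac unfold_alpha :=
  rewrite /disj_map_arr /disj_alpha /alphaV /= /alpha010 /alpha011 /alpha101 /alpha110 /alpha111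
    /alpha010V /alpha011V /alpha110V /alpha111V /= /act2 /= ?/act2 /=.

Lemma alpha_hom X Y Z :
  alpha X Y Z ∈ disj_ob (ten X (ten Y Z)) ⇒ disj_ob (ten (ten X Y) Z).
Proof. by case: X Y Z => [M|A] [N|B] [Q|C]; unfold_alpha; hom. Qed.

Lemma alphaV_hom X Y Z :
  alphaV X Y Z ∈ disj_ob (ten (ten X Y) Z) ⇒ disj_ob (ten X (ten Y Z)).
Proof. by case: X Y Z => [M|A] [N|B] [Q|C]; unfold_alpha; hom. Qed.

Lemma act_inverse (E F : arr S) (M N : hmod H) : E ∈ 𝟏 ⇒ H0 ⊗ H0 -> F ∈ 𝟏 ⇒ H0 ⊗ H0 ->
  (mu ⊠ mu) ∘ (I H0 ⊠ br H0 H0 ⊠ I H0) ∘ (E ⊠ F) = eta ⊠ eta ->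
  act2 M N ∘ (E ⊠ I (mob M ⊗ mob N)) ∘ (act2 M N ∘ (F ⊠ I (mob M ⊗ mob N))) = I (mob M ⊗ mob N).
Proof.
move=> hE hF e; rewrite /act2.
transitivity ((act M ⊠ act N) ∘ (I H0 ⊠ br H0 (mob M) ⊠ I (mob N))
  ∘ (((mu ⊠ mu) ∘ (I H0 ⊠ br H0 H0 ⊠ I H0) ∘ (E ⊠ F)) ⊠ I (mob M ⊗ mob N))).
  diagram (act_mu M, act_mu N).
rewrite e; diagram (act_eta M, act_eta N).
Qed.

Lemma act_mid_inverse (E F : arr S) (A : ob S) (N : hmod H) : E ∈ 𝟏 ⇒ H0 ⊗ H0 -> F ∈ 𝟏 ⇒ H0 ⊗ H0 ->
  (mu ⊠ mu) ∘ (I H0 ⊠ F ⊠ I H0) ∘ E = eta ⊠ eta -> forall C : ob S,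
  alpha101 F A N C ∘ alpha101 E A N C = I (H0 ⊗ A ⊗ mob N ⊗ C).
Proof.
move=> hE hF e C; rewrite /alpha101.
transitivity ((mu ⊠ I A ⊠ act N ⊠ I C) ∘ (I (H0 ⊗ H0) ⊠ br H0 A ⊠ I (mob N ⊗ C))
   ∘ (I H0 ⊠ ((mu ⊠ mu) ∘ (I H0 ⊠ F ⊠ I H0) ∘ E) ⊠ I (A ⊗ mob N ⊗ C))).
  diagram (act_mu N, mu_assoc H).
rewrite e; diagram (act_eta N, mu_etar H).
Qed.

Lemma alphaVK X Y Z : alphaV X Y Z ∘ alpha X Y Z = I (disj_ob (ten X (ten Y Z))).
Proof.
case: X Y Z => [M|A] [N|B] [Q|C].
- by unfold_alpha; diagram.
- by unfold_alpha; diagram.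
- transitivity ((I (mob M) ⊠ br (mob Q) B)
    ∘ ((act2 M Q ∘ (gamV ⊠ I (mob M ⊗ mob Q)) ∘ (act2 M Q ∘ (gam ⊠ I (mob M ⊗ mob Q)))) ⊠ I B)
    ∘ (I (mob M) ⊠ brV (mob Q) B)).
    by unfold_alpha; diagram.
  by rewrite (act_inverse M Q hgamV hgam (gamV_gam P)) /=; diagram.
- transitivity (((act M ⊠ I H0) ∘ (I H0 ⊠ br H0 (mob M)) ∘ (((mu ∘ (I H0 ⊠ Sv) ∘ brV H0 H0
    ∘ Delta) ⊠ I H0 ⊠ I (mob M)))
   ∘ (Delta ⊠ I (mob M)) ∘ brV H0 (mob M)) ⊠ I (B ⊗ C)).
    by unfold_alpha; diagram (act_mu M, Delta_coassoc H).
  by rewrite antipV_right /=; diagram (act_eta M, Delta_epsl H).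
- by unfold_alpha; diagram.
- have := act_mid_inverse A N hdel hdelV (del_delV P) C; unfold_alpha => ->; by rewrite !tob_assoc.
- transitivity ((I (H0 ⊗ A ⊗ B) ⊠ act Q) ∘ (I H0 ⊠ br H0 (A ⊗ B) ⊠ I (mob Q))
    ∘ (((I H0 ⊠ (mu ∘ (Sa ⊠ I H0) ∘ Delta)) ∘ Delta) ⊠ I (A ⊗ B ⊗ mob Q))).
    by unfold_alpha; diagram (act_mu Q, Delta_coassoc H).
  by rewrite antip_left /=; diagram (act_eta Q, Delta_epsr H).
- by unfold_alpha; diagram (phiV_phi P).
Qed.

Lemma alphaKV X Y Z : alpha X Y Z ∘ alphaV X Y Z = I (disj_ob (ten (ten X Y) Z)).
Proof.
case: X Y Z => [M|A] [N|B] [Q|C].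
- by unfold_alpha; diagram.
- by unfold_alpha; diagram.
- transitivity ((I (mob M) ⊠ br (mob Q) B)
    ∘ ((act2 M Q ∘ (gam ⊠ I (mob M ⊗ mob Q)) ∘ (act2 M Q ∘ (gamV ⊠ I (mob M ⊗ mob Q)))) ⊠ I B)
    ∘ (I (mob M) ⊠ brV (mob Q) B)).
    by unfold_alpha; diagram.
  by rewrite (act_inverse M Q hgam hgamV (gam_gamV P)) /=; diagram.
- transitivity (((I H0 ⊠ act M) ∘ ((brV H0 H0 ∘ ((mu ∘ (Sv ⊠ I H0) ∘ brV H0 H0 ∘ Delta) ⊠ I H0)
    ∘ Delta) ⊠ I (mob M))) ⊠ I (B ⊗ C)).
    by unfold_alpha; diagram (act_mu M, Delta_coassoc H).
  by rewrite antipV_left /=; diagram (act_eta M, Delta_epsl H).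
- by unfold_alpha; diagram.
- have := act_mid_inverse A N hdelV hdel (delV_del P) C; unfold_alpha => ->; by rewrite !tob_assoc.
- transitivity ((I (H0 ⊗ A ⊗ B) ⊠ act Q) ∘ (I H0 ⊠ br H0 (A ⊗ B) ⊠ I (mob Q))
    ∘ (((I H0 ⊠ (mu ∘ (I H0 ⊠ Sa) ∘ Delta)) ∘ Delta) ⊠ I (A ⊗ B ⊗ mob Q))).
    by unfold_alpha; diagram (act_mu Q, Delta_coassoc H).
  by rewrite antip_right /=; diagram (act_eta Q, Delta_epsr H).
- by unfold_alpha; diagram (phi_phiV P).
Qed.

(** [through F e rs] uses [e : l = r] inside the context [F]: both sides of the
    goal are isotopic, up to [rs], to [F l] and [F r]. *)
Ltac through F e rs :=
  lazymatch type of e with ?l = ?r =>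
    let L := eval cbv beta in (F l) in let R := eval cbv beta in (F r) in
    transitivity L; [diagram rs | transitivity R; [by rewrite e | symmetry; diagram rs]]
  end.

(** Only the four associators with values in degree 0 have to be module maps. *)
Lemma alpha_disj_hom X Y Z : is_disj_hom (ten X (ten Y Z)) (ten (ten X Y) Z) (alpha X Y Z).
Proof.
have h := alpha_hom X Y Z.
case: X Y Z h => [M|A] [N|B] [Q|C] //= h; split=> //; move=> {h}; unfold_alpha.
- by diagram (Delta_coassoc H).
- through (fun D : arr S => (I H0 ⊠ act M ⊠ I (B ⊗ C)) ∘ (D ⊠ I (mob M ⊗ B ⊗ C))
    ∘ (I H0 ⊠ brV H0 (mob M) ⊠ I (B ⊗ C))) (antipV_absorb H) (act_mu M, mul_comul H).
- diagram (mu_assoc H).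
- diagram (mul_comul H, act_mu Q).
Qed.

Lemma alpha_natural X X' Y Y' Z Z' (f g h : arr S) :
  is_disj_hom X X' f -> is_disj_hom Y Y' g -> is_disj_hom Z Z' h ->
  alpha X' Y' Z' ∘ disj_map_arr X (ten Y Z) f (disj_map_arr Y Z g h)
  = disj_map_arr (ten X Y) Z (disj_map_arr X Y f g) h ∘ alpha X Y Z.
Proof.
case: X X' Y Y' Z Z' => [M|A] [M'|A'] [N|B] [N'|B'] [Q|C] [Q'|C'] //= hf hg hh.
- by move: hf hg hh => [hf ef] [hg eg] [hh eh]; unfold_alpha; diagram.
- by move: hf hg => [hf ef] [hg eg]; unfold_alpha; diagram.
- by move: hf hh => [hf ef] [hh eh]; unfold_alpha; diagram (ef, eh).
- by move: hf => [hf ef]; unfold_alpha; diagram ef.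
- by move: hg hh => [hg eg] [hh eh]; unfold_alpha; diagram.
- by move: hg => [hg eg]; unfold_alpha; diagram eg.
- by move: hh => [hh eh]; unfold_alpha; diagram eh.
- by unfold_alpha; diagram.
Qed.

Lemma alpha_triangle X Y : alpha X (inl (unit_mod H)) Y = I (disj_ob (ten X Y)).
Proof.
case: X Y => [M|A] [Q|C]; unfold_alpha; try by diagram.
transitivity ((mu ⊠ I (A ⊗ C)) ∘ (I H0 ⊠ ((I H0 ⊠ eps) ∘ del) ⊠ I (A ⊗ C))).
  by diagram.
by rewrite (del_eps P); diagram (mu_etar H).
Qed.

(** Each case applies at most one equation of [associator_data], in the diagram
    where the legs of the elements of [H] act on the modules. *)
Lemma alpha_pentagon X Y Z W :
  alpha (ten X Y) Z W ∘ alpha X Y (ten Z W)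
  = disj_map_arr (ten X (ten Y Z)) W (alpha X Y Z) (I (disj_ob W)) ∘ alpha X (ten Y Z) W
    ∘ disj_map_arr X (ten Y (ten Z W)) (I (disj_ob X)) (alpha Y Z W).
Proof.
case: X Y Z W => [X|X] [Y|Y] [Z|Z] [W|W]; unfold_alpha.
- by diagram.
- by diagram.
- by diagram (eq0010 P, act_mu W).
- by diagram (Delta_antipV H, act_mu Y, Delta_coassoc H).
- by diagram (eq0100 P, act_mu X).
- through (fun D : arr S => (I H0 ⊠ act X ⊠ I Y ⊠ act Z ⊠ I W)
    ∘ (I (H0 ⊗ H0) ⊠ br H0 (mob X ⊗ Y) ⊠ I (mob Z ⊗ W)) ∘ (D ⊠ I (mob X ⊗ Y ⊗ mob Z ⊗ W))
    ∘ (brV H0 (mob X) ⊠ I (Y ⊗ mob Z ⊗ W))) (eq0101 P) (act_mu X, act_mu Z).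
- by diagram (act_mu W, Delta_coassoc H).
- through (fun D : arr S => (I H0 ⊠ act X ⊠ I (Y ⊗ Z ⊗ W)) ∘ (D ⊠ I (mob X ⊗ Y ⊗ Z ⊗ W))
    ∘ (brV H0 (mob X ⊗ Y) ⊠ I (Z ⊗ W))) (eq0111 P) tt.
- by diagram.
- by diagram (eq1001 P, mu_assoc H).
- through (fun D : arr S => (I (H0 ⊗ X) ⊠ act Y ⊠ I Z ⊠ act W)
    ∘ (I H0 ⊠ br H0 X ⊠ I (mob Y ⊗ Z ⊗ H0 ⊗ mob W))
    ∘ (I (H0 ⊗ H0) ⊠ br H0 (X ⊗ mob Y ⊗ Z) ⊠ I (mob W)) ∘ (D ⊠ I (X ⊗ mob Y ⊗ Z ⊗ mob W)))
    (eq1010 P) (act_mu Y, act_mu W).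
- through (fun D : arr S => (I (H0 ⊗ X) ⊠ act Y ⊠ I (Z ⊗ W)) ∘ (I H0 ⊠ br H0 X ⊠ I (mob Y ⊗ Z ⊗ W))
    ∘ (D ⊠ I (X ⊗ mob Y ⊗ Z ⊗ W)) ∘ (brV H0 (X ⊗ mob Y) ⊠ I (Z ⊗ W)))
    (eq1011 P) (act_mu Y, act_eta Y).
- by diagram (act_mu W, Delta_coassoc H).
- through (fun D : arr S => (I (H0 ⊗ X ⊗ Y) ⊠ act Z ⊠ I W) ∘ (I H0 ⊠ br H0 (X ⊗ Y) ⊠ I (mob Z ⊗ W))
    ∘ (D ⊠ I (X ⊗ Y ⊗ mob Z ⊗ W)) ∘ (brV H0 X ⊠ I (Y ⊗ mob Z ⊗ W)))
    (eq1101 P) (act_mu Z, act_eta Z).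
- through (fun D : arr S => (I (H0 ⊗ X ⊗ Y ⊗ Z) ⊠ act W) ∘ (I H0 ⊠ br H0 (X ⊗ Y ⊗ Z) ⊠ I (mob W))
    ∘ (D ⊠ I (X ⊗ Y ⊗ Z ⊗ mob W)) ∘ (brV H0 X ⊠ I (Y ⊗ Z ⊗ mob W))) (eq1110 P) (act_mu W).
- through (fun D : arr S => (D ⊠ I (X ⊗ Y ⊗ Z ⊗ W)) ∘ (I H0 ⊠ brV H0 (X ⊗ Y) ⊠ I (Z ⊗ W)))
    (eq1111 P) (mul_comul H).
Qed.

End Alpha.

(** * Copairings and the Fourier transform of a cointegral *)

(** From here on [Gamma] enters only through its copairing [C]: [C1] to [C4] say
    that [Gamma] is a Hopf algebra map, [Cc] is condition c). In the comments
    [C_1 ⊗ C_2] denotes [C], and braidings are left out. *)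
Section Copairing.
Variables (S : ribbonCat) (H : hopfAlg S).
Local Notation H0 := (carrier H).
Local Notation mu := (mu H).
Local Notation Delta := (Delta H).
Local Notation eta := (eta H).
Local Notation eps := (eps H).
Local Notation Sa := (antip H).
Local Notation Sv := (antipV H).
Variables (C lam g gV : arr S).
Hypothesis hC : C ∈ 𝟏 ⇒ H0 ⊗ H0.
Hypothesis hl : lam ∈ H0 ⇒ 𝟏.
Hypothesis hg : g ∈ 𝟏 ⇒ H0.
Hypothesis hgV : gV ∈ 𝟏 ⇒ H0.
Hypothesis C1 : (Delta ⊠ I H0) ∘ C = (I (H0 ⊗ H0) ⊠ mu) ∘ (I H0 ⊠ C ⊠ I H0) ∘ C.
Hypothesis C2 : (I H0 ⊠ Delta) ∘ C = (mu ⊠ I (H0 ⊗ H0)) ∘ (I H0 ⊠ C ⊠ I H0) ∘ C.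
Hypothesis C3 : (eps ⊠ I H0) ∘ C = eta.
Hypothesis C3' : (I H0 ⊠ eps) ∘ C = eta.
Hypothesis C4 : (Sa ⊠ I H0) ∘ C = (I H0 ⊠ Sa) ∘ C.
Hypothesis Cc : C = br H0 H0 ∘ (I H0 ⊠ (Sa ∘ Sa ∘ (mu ∘ (gV ⊠ I H0) ∘ (mu ∘ (I H0 ⊠ g))))) ∘ C.
Hypothesis gg : Delta ∘ g = g ⊠ g.
Hypothesis eg : eps ∘ g = I 𝟏.
Hypothesis gVl : mu ∘ (gV ⊠ g) = eta.
Hypothesis gVr : mu ∘ (g ⊠ gV) = eta.
Hypothesis lr : (lam ⊠ I H0) ∘ Delta = eta ∘ lam.
Hypothesis lg : (I H0 ⊠ lam) ∘ Delta = g ∘ lam.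
Hypothesis ll : (lam ⊠ lam) ∘ C = I 𝟏.

Definition gamma_of_copairing := (Sv ⊠ I H0) ∘ C.
Definition delta_of_copairing := (Sa ⊠ (mu ∘ (I H0 ⊠ g))) ∘ C.
(** The Fourier transform attached to the cointegral. *)
Definition phi_of_copairing := (I H0 ⊠ (lam ∘ mu)) ∘ (C ⊠ I H0).
Local Notation gam := gamma_of_copairing.
Local Notation del := delta_of_copairing.
Local Notation phi := phi_of_copairing.

Lemma cgam_hom : gam ∈ 𝟏 ⇒ H0 ⊗ H0.
Proof. by rewrite /gamma_of_copairing; hom. Qed.

Lemma cdel_hom : del ∈ 𝟏 ⇒ H0 ⊗ H0.
Proof. by rewrite /delta_of_copairing; hom. Qed.

Lemma cphi_hom : phi ∈ H0 ⇒ H0.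
Proof. by rewrite /phi_of_copairing; hom. Qed.
Hint Resolve cgam_hom cdel_hom cphi_hom : hom.
Lemma Delta_gam_l : (Delta ⊠ I H0) ∘ gam = (I (H0 ⊗ H0) ⊠ mu) ∘ (I H0 ⊠ br H0 H0 ⊠ I H0) ∘ (gam ⊠ gam).
Proof. rewrite /gamma_of_copairing. diagram (Delta_antipV H, C1). Qed.

Lemma Delta_gam_r : (I H0 ⊠ Delta) ∘ gam = (mu ⊠ I (H0 ⊗ H0)) ∘ (I H0 ⊠ br H0 H0 ⊠ I H0) ∘ (gam ⊠ gam).
Proof. rewrite /gamma_of_copairing. diagram (antipV_mu H, C2). Qed.

Lemma Delta_del_r : (I H0 ⊠ Delta) ∘ del = (mu ⊠ br H0 H0) ∘ (I H0 ⊠ del ⊠ I H0) ∘ del.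
Proof. rewrite /delta_of_copairing. diagram (antip_mu H, C2, mul_comul H, gg). Qed.

(** [S^-1(c_2) c_1 = ε(c)] in the first leg: [gam] and [C] are mutually inverse
    because [C1] turns a product of copairings into a coproduct. *)
Lemma gam_C : (mu ⊠ mu) ∘ (I H0 ⊠ br H0 H0 ⊠ I H0) ∘ (gam ⊠ C) = eta ⊠ eta.
Proof.
transitivity (((mu ∘ (Sv ⊠ I H0) ∘ brV H0 H0) ⊠ I H0) ∘ (I (H0 ⊗ H0) ⊠ mu) ∘ (I H0 ⊠ C ⊠ I H0) ∘ C).
  rewrite /gamma_of_copairing. diagram.
transitivity (((mu ∘ (Sv ⊠ I H0) ∘ brV H0 H0) ⊠ I H0) ∘ ((I (H0 ⊗ H0) ⊠ mu) ∘ (I H0 ⊠ C ⊠ I H0) ∘ C)).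
  diagram.
rewrite -C1. diagram (antipV_left H, C3).
Qed.

Lemma C_gam : (mu ⊠ mu) ∘ (I H0 ⊠ br H0 H0 ⊠ I H0) ∘ (C ⊠ gam) = eta ⊠ eta.
Proof.
transitivity (((mu ∘ (I H0 ⊠ Sv) ∘ brV H0 H0) ⊠ I H0) ∘ ((I (H0 ⊗ H0) ⊠ mu) ∘ (I H0 ⊠ C ⊠ I H0) ∘ C)).
  rewrite /gamma_of_copairing. diagram.
rewrite -C1. diagram (antipV_right H, C3).
Qed.

(** The part of the pentagon 0101 that is left once the factor common to both
    sides is removed. *)
Lemma gam_del_cancel : (I H0 ⊠ (mu ∘ (I H0 ⊠ Sv)) ⊠ mu) ∘ (I (H0 ⊗ H0) ⊠ br H0 H0 ⊠ I H0) ∘ (I H0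
    ⊠ gam ⊠ I (H0 ⊗ H0)) ∘ ((brV H0 H0 ∘ Delta) ⊠ I H0) ∘ del = (I H0 ⊠ eta ⊠ I H0) ∘ del.
Proof.
transitivity ((Sa ⊠ I H0 ⊠ (mu ∘ (I H0 ⊠ (mu ∘ (I H0 ⊠ g))))) ∘ (I H0 ⊠ ((mu ⊠ mu) ∘ (I H0
    ⊠ br H0 H0 ⊠ I H0) ∘ (gam ⊠ C)) ⊠ I H0) ∘ C).
  rewrite /delta_of_copairing. diagram (Delta_antip H, antipVK H, C1, mu_assoc H).
rewrite gam_C /delta_of_copairing. diagram (mu_etal H).
Qed.

Lemma antip_g : Sa ∘ g = gV.
Proof.
transitivity (mu ∘ (I H0 ⊠ mu) ∘ (Sa ⊠ I H0 ⊠ I H0) ∘ (g ⊠ g ⊠ gV)).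
  transitivity (mu ∘ (I H0 ⊠ (mu ∘ (g ⊠ gV))) ∘ Sa ∘ g); first by rewrite gVr; diagram (mu_etar H).
  diagram.
transitivity (mu ∘ ((mu ∘ (Sa ⊠ I H0) ∘ (g ⊠ g)) ⊠ gV)); first by diagram (mu_assoc H).
rewrite -gg. transitivity (mu ∘ (((mu ∘ (Sa ⊠ I H0) ∘ Delta) ∘ g) ⊠ gV)); first by diagram.
rewrite antip_left. diagram (eg, mu_etal H).
Qed.

Lemma antip_gV : Sa ∘ gV = g.
Proof.
transitivity (mu ∘ (I H0 ⊠ mu) ∘ (I H0 ⊠ Sa ⊠ Sa) ∘ (g ⊠ g ⊠ gV)).
  transitivity (mu ∘ (mu ⊠ I H0) ∘ (I H0 ⊠ Sa ⊠ Sa) ∘ (g ⊠ g ⊠ gV)); last by diagram (mu_assoc H).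
  rewrite -gg. transitivity (mu ∘ (((mu ∘ (I H0 ⊠ Sa) ∘ Delta) ∘ g) ⊠ (Sa ∘ gV))); last by diagram.
  rewrite antip_right. diagram (eg, mu_etal H).
transitivity (mu ∘ (I H0 ⊠ (Sa ∘ (mu ∘ (gV ⊠ g)))) ∘ g).
  diagram (antip_mu H).
rewrite gVl. diagram (antip_eta H, mu_etar H).
Qed.

Lemma antipV_g : Sv ∘ g = gV.
Proof. rewrite -antip_gV. diagram (antipVK H). Qed.

Lemma antipV_gV : Sv ∘ gV = g.
Proof. rewrite -antip_g. diagram (antipVK H). Qed.

Lemma gVl_mul : mu ∘ (I H0 ⊠ mu) ∘ (gV ⊠ g ⊠ I H0) = I H0.
Proof. transitivity (mu ∘ ((mu ∘ (gV ⊠ g)) ⊠ I H0)); first by diagram (mu_assoc H).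
rewrite gVl. diagram (mu_etal H). Qed.

Lemma gVr_mul : mu ∘ (I H0 ⊠ mu) ∘ (g ⊠ gV ⊠ I H0) = I H0.
Proof. transitivity (mu ∘ ((mu ∘ (g ⊠ gV)) ⊠ I H0)); first by diagram (mu_assoc H).
rewrite gVr. diagram (mu_etal H). Qed.

(** Condition c) with the antipodes distributed over both legs by [C4], so that
    conjugation by [g] becomes a product with [g] on either side. *)
Lemma copair_braid : ((mu ∘ (I H0 ⊠ g)) ⊠ Sa) ∘ br H0 H0 ∘ C = ((mu ∘ (g ⊠ Sv)) ⊠ I H0) ∘ C.
Proof.
transitivity (((mu ∘ (g ⊠ (Sv ∘ Sv))) ⊠ Sa) ∘ C); last first.
  transitivity (((mu ∘ (g ⊠ (Sv ∘ Sv))) ⊠ I H0) ∘ ((I H0 ⊠ Sa) ∘ C)); first by diagram.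
  rewrite -C4. diagram (antipVK H).
rewrite {2}Cc.
diagram (antipVK H, gVl_mul, gVr_mul, antip_mu H, antipV_mu H, antip_g, antip_gV, antipV_g,
    antipV_gV, mu_assoc H, gVl, gVr, mu_etar H).
Qed.

Lemma Delta_del : (I H0 ⊠ br H0 H0) ∘ (Delta ⊠ I H0) ∘ del = (I H0 ⊠ mu ⊠ I H0) ∘ (del ⊠ gam).
Proof. rewrite /gamma_of_copairing /delta_of_copairing. diagram (Delta_antip H, C1, mu_assoc H,
    copair_braid). Qed.

(** [λ∘μ] as a single box: associativity of the product would otherwise separate
    the cointegral from the product it is applied to. *)
Variable lm : arr S.
Hypothesis hlm : lm ∈ H0 ⊗ H0 ⇒ 𝟏.
Hypothesis lm_def : lam ∘ mu = lm.
Lemma lm_assoc : lm ∘ (mu ⊠ I H0) = lm ∘ (I H0 ⊠ mu).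
Proof. rewrite -lm_def. diagram (mu_assoc H). Qed.

Lemma phiE : phi = (I H0 ⊠ lm) ∘ (C ⊠ I H0).
Proof. by rewrite /phi_of_copairing lm_def. Qed.

Lemma Delta_phi : Delta ∘ phi = (I H0 ⊠ (phi ∘ mu)) ∘ (C ⊠ I H0).
Proof. rewrite phiE. diagram (C1, lm_assoc). Qed.

Lemma copair_phi_Delta : (mu ⊠ mu) ∘ (I H0 ⊠ br H0 H0 ⊠ I H0) ∘ (C ⊠ ((phi ⊠ I H0) ∘ Delta)) = phi ⊠ eta.
Proof.
transitivity ((I H0 ⊠ ((lm ⊠ mu) ∘ (I H0 ⊠ br H0 H0 ⊠ I H0) ∘ (Delta ⊠ Delta))) ∘ (C ⊠ I H0)).
  rewrite phiE. diagram (C2, mu_assoc H).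
transitivity ((I H0 ⊠ ((lam ⊠ I H0) ∘ Delta ∘ mu)) ∘ (C ⊠ I H0)).
  rewrite -lm_def. diagram (mul_comul H).
rewrite lr phiE -lm_def. diagram.
Qed.

(** By the defining equation of [g], [λ(x y_2) g S^-1(y_1)] is
    [x_1 y_2 S^-1(y_1) λ(x_2 y_3)], where [y_2 S^-1(y_1)] cancels. *)
Lemma lam_shift : (I H0 ⊠ lm) ∘ (Delta ⊠ I H0)
  = (lm ⊠ (mu ∘ (g ⊠ Sv))) ∘ (I H0 ⊠ (brV H0 H0 ∘ Delta)).
Proof.
transitivity (mu ∘ (((I H0 ⊠ lam) ∘ Delta ∘ mu) ⊠ Sv) ∘ (I H0 ⊠ (brV H0 H0 ∘ Delta))); last first.
  rewrite lg -lm_def. diagram.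
transitivity (mu ∘ (((mu ⊠ lm) ∘ (I H0 ⊠ br H0 H0 ⊠ I H0) ∘ (Delta ⊠ Delta)) ⊠ Sv) ∘ (I H0
    ⊠ (brV H0 H0 ∘ Delta))); last first.
  rewrite -lm_def. diagram (mul_comul H).
transitivity ((mu ∘ (I H0 ⊠ (mu ∘ (I H0 ⊠ Sv) ∘ brV H0 H0 ∘ Delta)) ⊠ lm) ∘ (I H0 ⊠ br H0 H0
    ⊠ I H0) ∘ (Delta ⊠ Delta)).
  rewrite antipV_right. diagram (mu_etar H, Delta_epsl H).
diagram (mu_assoc H, Delta_coassoc H).
Qed.

Lemma phi_del_antipV : (mu ⊠ mu) ∘ (phi ⊠ del ⊠ Sv) ∘ brV H0 H0 ∘ Delta = phi ⊠ eta.
Proof.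
transitivity ((mu ⊠ mu) ∘ (I H0 ⊠ ((Sa ⊠ I H0) ∘ C) ⊠ ((lm ⊠ (mu ∘ (g ⊠ Sv))) ∘ (I H0
    ⊠ (brV H0 H0 ∘ Delta)))) ∘ (C ⊠ I H0)).
  rewrite /delta_of_copairing phiE. diagram (mu_assoc H).
rewrite -lam_shift.
transitivity ((mu ⊠ I H0 ⊠ lm) ∘ (I H0 ⊠ (((mu ∘ (I H0 ⊠ Sa) ∘ Delta) ⊠ I H0) ∘ C) ⊠ I (H0 ⊗ H0))
    ∘ (C ⊠ I H0)).
  diagram (C1, C2, mu_assoc H).
rewrite antip_right phiE. diagram (mu_etar H, C3).
Qed.

(** The pairing inverse to the copairing, which exists since [Gamma] is
    invertible. *)
Variable W : arr S.
Hypothesis hW : W ∈ H0 ⊗ H0 ⇒ 𝟏.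
Hypothesis CW : (I H0 ⊠ W) ∘ (C ⊠ I H0) = I H0.

Lemma phi_mul_copair : (mu ⊠ I H0) ∘ (phi ⊠ C) = (phi ⊠ (mu ∘ (g ⊠ Sv))) ∘ brV H0 H0 ∘ Delta.
Proof.
transitivity ((I H0 ⊠ ((lm ⊠ (mu ∘ (g ⊠ Sv))) ∘ (I H0 ⊠ (brV H0 H0 ∘ Delta)))) ∘ (C ⊠ I H0)); last first.
  rewrite phiE. diagram.
rewrite -lam_shift phiE. diagram C2.
Qed.

(** [x ↦ λ(x g)] is a left cointegral, so its Fourier transform [L] is a
    right integral. *)
Definition right_integral := (I H0 ⊠ (lm ∘ (I H0 ⊠ g))) ∘ C.
Local Notation L := right_integral.
Lemma hL : L ∈ 𝟏 ⇒ H0. Proof. by rewrite /right_integral; hom. Qed.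
Hint Resolve hL : hom.
Lemma lam_g : (I H0 ⊠ (lm ∘ (I H0 ⊠ g))) ∘ Delta = eta ∘ lm ∘ (I H0 ⊠ g).
Proof.
transitivity (((mu ∘ (I H0 ⊠ gV)) ⊠ I 𝟏) ∘ (((I H0 ⊠ lam) ∘ Delta ∘ mu) ∘ (I H0 ⊠ g))).
  transitivity (((mu ∘ (I H0 ⊠ gV)) ⊠ I 𝟏) ∘ (((mu ⊠ lm) ∘ (I H0 ⊠ br H0 H0 ⊠ I H0) ∘ (Delta
      ⊠ Delta)) ∘ (I H0 ⊠ g))).
    diagram (gg, mu_assoc H, gVr, mu_etar H).
  rewrite -lm_def. diagram (mul_comul H).
rewrite lg -lm_def. diagram gVr.
Qed.

Lemma L_C : (mu ⊠ I H0) ∘ (L ⊠ C) = L ⊠ eta.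
Proof.
transitivity ((I H0 ⊠ ((I H0 ⊠ (lm ∘ (I H0 ⊠ g))) ∘ Delta)) ∘ C);
    last by rewrite lam_g /right_integral; diagram.
rewrite /right_integral. diagram C2.
Qed.

(** Endomorphisms are detected on the first leg of the copairing. *)
Lemma nondeg (u v : arr S) : u ∈ H0 ⇒ H0 -> v ∈ H0 ⇒ H0 -> (u ⊠ I H0) ∘ C = (v ⊠ I H0) ∘ C -> u = v.
Proof.
move=> hu hv e; transitivity ((I H0 ⊠ W) ∘ (((u ⊠ I H0) ∘ C) ⊠ I H0)).
  transitivity (u ∘ ((I H0 ⊠ W) ∘ (C ⊠ I H0))); first by rewrite CW; diagram.
  diagram.
rewrite e; transitivity (v ∘ ((I H0 ⊠ W) ∘ (C ⊠ I H0))); last by rewrite CW; diagram.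
diagram.
Qed.

Lemma L_right_integral : mu ∘ (L ⊠ I H0) = L ∘ eps.
Proof.
apply: nondeg; [hom|hom|].
transitivity ((mu ⊠ I H0) ∘ (L ⊠ C)); first by diagram.
rewrite L_C. diagram C3.
Qed.

(** [L_2 λ(S²(L_1) x) = λ(S²(L_1)) L_2 S^-1(x)]. Since [L] is a right integral,
    [L_1 S^-2(x) ⊗ L_2 = L_1 ⊗ L_2 S^-1(x)]; the factor [S^-2(x)] then becomes
    [x] under [λ∘S²]. *)
Lemma integral_twist : (I H0 ⊠ lm) ∘ ((br H0 H0 ∘ ((Sa ∘ Sa) ⊠ I H0) ∘ (Delta ∘ L)) ⊠ I H0)
  = mu ∘ ((((lam ∘ Sa ∘ Sa) ⊠ I H0) ∘ (Delta ∘ L)) ⊠ Sv).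
Proof.
(* a factor of the first leg of the integral moves to the second *)
have A : (mu ⊠ I H0) ∘ (I H0 ⊠ br H0 H0) ∘ ((Delta ∘ L) ⊠ (Sv ∘ Sv)) = (I H0 ⊠ mu) ∘ ((Delta ∘ L) ⊠ Sv).
  transitivity ((I H0 ⊠ mu) ∘ ((Delta ∘ (mu ∘ (L ⊠ I H0))) ⊠ Sa) ∘ Delta ∘ Sv ∘ Sv).
    transitivity ((I H0 ⊠ mu) ∘ (((mu ⊠ mu) ∘ (I H0 ⊠ br H0 H0 ⊠ I H0) ∘ ((Delta ∘ L) ⊠ Delta))
        ⊠ Sa) ∘ Delta ∘ Sv ∘ Sv).
     transitivity ((mu ⊠ mu) ∘ (I H0 ⊠ br H0 H0 ⊠ (mu ∘ (I H0 ⊠ Sa) ∘ Delta)) ∘ ((Delta ∘ L)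
         ⊠ (Delta ∘ Sv ∘ Sv))).
       rewrite antip_right. diagram (mu_etar H, Delta_epsr H).
     diagram (mu_assoc H, Delta_coassoc H).
    diagram (mul_comul H).
  rewrite L_right_integral. diagram (antipKV H, Delta_epsl H).
transitivity (((lam ∘ Sa ∘ Sa) ⊠ I H0) ∘ ((I H0 ⊠ mu) ∘ ((Delta ∘ L) ⊠ Sv))); last by diagram.
rewrite -A.
move: (Delta ∘ L) {A} (comp_hom_eq (Delta_hom H) hL erefl) => D hD.
transitivity ((I H0 ⊠ lm) ∘ ((br H0 H0 ∘ ((Sa ∘ Sa) ⊠ I H0)) ⊠ I H0)
  ∘ br H0 (H0 ⊗ H0) ∘ br (H0 ⊗ H0) H0 ∘ (D ⊠ I H0)); first by diagram.
transitivity ((((lam ∘ mu ∘ br H0 H0 ∘ br H0 H0) ∘ ((Sa ∘ Sa) ⊠ I H0)) ⊠ I H0) ∘ (I H0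
    ⊠ br H0 H0) ∘ (D ⊠ I H0)); last first.
  diagram (antip_mu H, antipKV H).
have -> : lam ∘ mu = lm := lm_def.
pose q := lm ∘ ((Sa ∘ Sa) ⊠ I H0); have hq : q ∈ H0 ⊗ H0 ⇒ 𝟏 by rewrite /q; hom.
transitivity (((I H0 ⊠ q) ∘ (br H0 H0 ⊠ I H0)
  ∘ br H0 (H0 ⊗ H0) ∘ br (H0 ⊗ H0) H0 ∘ (D ⊠ I H0))); first by rewrite /q; diagram.
transitivity (((q ∘ br H0 H0 ∘ br H0 H0) ⊠ I H0) ∘ (I H0 ⊠ br H0 H0) ∘ (D ⊠ I H0)); last first.
  by rewrite /q; diagram.
diagram.
Qed.

Lemma copair_braid_antip : ((mu ∘ (g ⊠ I H0)) ⊠ I H0) ∘ C = ((mu ∘ (I H0 ⊠ g)) ⊠ (Sa ∘ Sa))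
    ∘ br H0 H0 ∘ C.
Proof.
transitivity ((I H0 ⊠ Sa) ∘ (((mu ∘ (I H0 ⊠ g)) ⊠ Sa) ∘ br H0 H0 ∘ C)); last by diagram.
rewrite copair_braid. transitivity (((mu ∘ (g ⊠ Sv)) ⊠ I H0) ∘ ((I H0 ⊠ Sa) ∘ C)); last by diagram.
rewrite -C4. diagram (antipVK H).
Qed.

(** In [φ(g φ(x)) = C_1 λ(C_2 g D_1) λ(D_2 x)], with [D] a second copy of the
    copairing, [g D_1] is moved to the other leg by [copair_braid_antip], after
    which the two copairings combine to the coproduct of [L]. *)
Lemma phi_g_phi_L : phi ∘ mu ∘ (g ⊠ phi) = (I H0 ⊠ lm) ∘ ((br H0 H0 ∘ ((Sa ∘ Sa) ⊠ I H0) ∘ (Delta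
    ∘ L)) ⊠ I H0).
Proof.
transitivity ((I H0 ⊠ lm ⊠ lm) ∘ (C ⊠ ((((mu ∘ (g ⊠ I H0)) ⊠ I H0) ∘ C)) ⊠ I H0)).
  rewrite phiE. diagram.
rewrite copair_braid_antip.
pose q := lm ∘ ((Sa ∘ Sa) ⊠ I H0); have hq : q ∈ H0 ⊗ H0 ⇒ 𝟏 by rewrite /q; hom.
pose p := lm ∘ (I H0 ⊠ g); have hp : p ∈ H0 ⇒ 𝟏 by rewrite /p; hom.
transitivity ((I H0 ⊠ q) ∘ ((br H0 H0 ⊠ p) ⊠ I H0) ∘ (((Delta ⊠ I H0) ∘ C) ⊠ I H0)); last first.
  rewrite /q /p /right_integral. diagram.
rewrite C1.
transitivity ((I H0 ⊠ (p ∘ mu) ⊠ q) ∘ (((I (H0 ⊗ H0) ⊠ br H0 H0) ∘ (C ⊠ C)) ⊠ I H0)).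
  by rewrite /q /p; diagram lm_assoc.
pose pm := p ∘ mu; have hpm : pm ∈ H0 ⊗ H0 ⇒ 𝟏 by rewrite /pm; hom.
transitivity ((I H0 ⊠ pm ⊠ q) ∘ (((I (H0 ⊗ H0) ⊠ br H0 H0) ∘ (C ⊠ C)) ⊠ I H0)).
  by rewrite /pm; diagram.
transitivity ((I H0 ⊠ q) ∘ ((br H0 H0 ⊠ pm) ⊠ I H0) ∘ (((I H0 ⊠ C ⊠ I H0) ∘ C) ⊠ I H0)); last first.
  by rewrite /pm; diagram.
have e : (pm ⊠ I H0) ∘ (I H0 ⊠ br H0 H0) ∘ br (H0 ⊗ H0) H0 = (I H0 ⊠ pm) ∘ (I H0 ⊠ br H0 H0) by diagram.
transitivity ((I H0 ⊠ q) ∘ (I H0 ⊠ ((pm ⊠ I H0) ∘ (I H0 ⊠ br H0 H0) ∘ br (H0 ⊗ H0) H0) ⊠ I H0)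
  ∘ (I H0 ⊠ C ⊠ I (H0 ⊗ H0)) ∘ (C ⊠ I H0)); first by diagram.
rewrite e. diagram.
Qed.

(** The Fourier transform of the unit is a left integral. *)
Lemma dual_integral : mu ∘ (I H0 ⊠ ((I H0 ⊠ lam) ∘ C)) = ((I H0 ⊠ lam) ∘ C) ∘ eps.
Proof.
apply: nondeg; [hom|hom|].
transitivity ((I H0 ⊠ ((lam ⊠ I H0) ∘ Delta)) ∘ C).
  transitivity ((I H0 ⊠ lam ⊠ I H0) ∘ ((I H0 ⊠ Delta) ∘ C)); last by diagram.
  rewrite C2; diagram.
rewrite lr; diagram C3.
Qed.

Lemma phi_eta : phi ∘ eta = (I H0 ⊠ lam) ∘ C.
Proof. rewrite /phi_of_copairing. diagram (mu_etar H). Qed.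

(** Fourier inversion: the transform is its own inverse up to [g] and the
    antipode. By the preceding lemmas [φ(g φ(x)) = u S^-1(x)] with a constant
    [u], and the normalisation [ll] makes [u] the unit. *)
Lemma phi_g_phi : phi ∘ mu ∘ (g ⊠ phi) = Sv.
Proof.
have E : phi ∘ mu ∘ (g ⊠ phi) ∘ eta = eta.
  transitivity (phi ∘ mu ∘ (g ⊠ (phi ∘ eta))); first by diagram.
  rewrite phi_eta.
  transitivity (phi ∘ (mu ∘ (I H0 ⊠ ((I H0 ⊠ lam) ∘ C))) ∘ g); first by diagram.
  rewrite dual_integral.
  transitivity (phi ∘ ((I H0 ⊠ lam) ∘ C)); first by diagram eg.
  transitivity ((I H0 ⊠ lam) ∘ (I H0 ⊠ (mu ∘ (I H0 ⊠ ((I H0 ⊠ lam) ∘ C)))) ∘ C).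
    rewrite /phi_of_copairing. diagram.
  rewrite dual_integral.
  transitivity (((I H0 ⊠ eps) ∘ C) ⊠ ((lam ⊠ lam) ∘ C)); first by diagram.
  rewrite ll C3'. by diagram.
have E2 : phi ∘ mu ∘ (g ⊠ phi) = mu ∘ ((phi ∘ mu ∘ (g ⊠ phi) ∘ eta) ⊠ Sv).
  rewrite phi_g_phi_L integral_twist.
  transitivity (mu ∘ ((mu ∘ ((((lam ∘ Sa ∘ Sa) ⊠ I H0) ∘ (Delta ∘ L)) ⊠ (Sv ∘ eta))) ⊠ Sv));
      last by diagram.
  rewrite antipV_eta. diagram (mu_etar H, mu_etal H, mu_assoc H).
rewrite E2 E. diagram (mu_etal H).
Qed.

Lemma antipV_of_phi : (I H0 ⊠ Sv) ∘ brV H0 H0 ∘ Delta = (I H0 ⊠ (phi ∘ mu)) ∘ (del ⊠ phi).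
Proof.
transitivity ((Sa ⊠ I H0) ∘ (Delta ∘ phi) ∘ mu ∘ (g ⊠ phi)); last first.
  rewrite Delta_phi /delta_of_copairing. diagram (mu_assoc H).
transitivity ((Sa ⊠ I H0) ∘ Delta ∘ (phi ∘ mu ∘ (g ⊠ phi))); last by diagram.
rewrite phi_g_phi. diagram (Delta_antipV H, antipKV H).
Qed.

Lemma phi_rinv : phi ∘ (mu ∘ (g ⊠ (phi ∘ Sa))) = I H0.
Proof. rewrite -(antipVK H) -[in RHS]phi_g_phi. diagram. Qed.

Lemma phi_linv : (Sa ∘ phi ∘ mu ∘ (g ⊠ I H0)) ∘ phi = I H0.
Proof. transitivity (Sa ∘ (phi ∘ mu ∘ (g ⊠ phi))); first by diagram.
rewrite phi_g_phi. diagram (antipKV H). Qed.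

(** [phi_mul_copair] conjugated by Fourier inversion. *)
Lemma phi_mul_copair_r : ((phi ∘ mu) ⊠ I H0) ∘ (I H0 ⊠ C) = (I H0 ⊠ (mu ∘ (g ⊠ I H0))) ∘ Delta ∘ phi.
Proof.
have A : ((phi ∘ mu ∘ (g ⊠ mu)) ⊠ I H0) ∘ (phi ⊠ C) = (I H0 ⊠ (mu ∘ (g ⊠ I H0))) ∘ Delta ∘ (phi
    ∘ mu ∘ (g ⊠ phi)).
  transitivity (((phi ∘ mu ∘ (g ⊠ I H0)) ⊠ I H0) ∘ ((mu ⊠ I H0) ∘ (phi ⊠ C))); first by diagram.
  rewrite phi_mul_copair.
  transitivity (((phi ∘ mu ∘ (g ⊠ phi)) ⊠ (mu ∘ (g ⊠ Sv))) ∘ brV H0 H0 ∘ Delta); first by diagram.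
  rewrite phi_g_phi. diagram (Delta_antipV H).
transitivity (((phi ∘ mu ∘ (g ⊠ mu)) ⊠ I H0) ∘ (phi ⊠ C) ∘ (mu ∘ (g ⊠ (phi ∘ Sa))) ∘ mu ∘ (gV ⊠ I H0)).
  transitivity (((phi ∘ mu ∘ (g ⊠ mu)) ⊠ I H0) ∘ ((phi ∘ (mu ∘ (g ⊠ (phi ∘ Sa)))) ⊠ C) ∘ mu ∘ (gV
      ⊠ I H0)); last by diagram.
  rewrite phi_rinv. diagram (mu_assoc H, gVr_mul).
rewrite A.
transitivity ((I H0 ⊠ (mu ∘ (g ⊠ I H0))) ∘ Delta ∘ phi ∘ mu ∘ (g ⊠ (phi ∘ (mu ∘ (g ⊠ (phi
    ∘ Sa))))) ∘ mu ∘ (gV ⊠ I H0)); first by diagram.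
rewrite phi_rinv. diagram (mu_assoc H, gVr_mul).
Qed.

Lemma phi_mul_del : mu ∘ ((phi ∘ mu) ⊠ I H0) ∘ (I H0 ⊠ del) = eta ∘ lam.
Proof.
transitivity (mu ∘ ((phi ∘ mu) ⊠ (mu ∘ (I H0 ⊠ g))) ∘ (I H0 ⊠ ((Sa ⊠ I H0) ∘ C)));
    first by rewrite /delta_of_copairing; diagram.
rewrite C4.
transitivity (mu ∘ (I H0 ⊠ (mu ∘ (Sa ⊠ g))) ∘ (((phi ∘ mu) ⊠ I H0) ∘ (I H0 ⊠ C))); first by diagram.
rewrite phi_mul_copair_r.
transitivity (mu ∘ (I H0 ⊠ Sa) ∘ Delta ∘ phi); first by diagram (antip_mu H, antip_g, gVl,
    mu_assoc H, mu_etar H).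
rewrite antip_right /phi_of_copairing.
transitivity (eta ∘ lam ∘ mu ∘ (((eps ⊠ I H0) ∘ C) ⊠ I H0)); first by diagram.
rewrite C3. diagram (mu_etal H).
Qed.

Lemma Delta_phi_del : (I H0 ⊠ mu) ∘ ((Delta ∘ phi ∘ mu) ⊠ I H0) ∘ (I H0 ⊠ del) = phi ⊠ eta.
Proof.
rewrite Delta_phi.
transitivity ((I H0 ⊠ (mu ∘ ((phi ∘ mu) ⊠ I H0) ∘ (I H0 ⊠ del)) ) ∘ (I H0 ⊠ mu) ∘ (C ⊠ I H0)).
  diagram (mu_assoc H).
rewrite phi_mul_del /phi_of_copairing. diagram.
Qed.

Lemma pentagon0101 :
  (I H0 ⊠ br H0 H0) ∘ (mu ⊠ I H0 ⊠ Sv) ∘ (I H0 ⊠ del ⊠ I H0) ∘ brV H0 H0 ∘ Delta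
  = (I H0 ⊠ mu ⊠ mu) ∘ (I (H0 ⊗ H0) ⊠ br H0 H0 ⊠ I H0) ∘ (I H0 ⊠ gam ⊠ I (H0 ⊗ H0))
    ∘ (((I H0 ⊠ Sv) ∘ brV H0 H0 ∘ Delta ∘ mu) ⊠ I H0) ∘ (I H0 ⊠ del).
Proof.
pose q := ((brV H0 H0 ∘ Delta) ⊠ I H0) ∘ del.
have hq : q ∈ 𝟏 ⇒ H0 ⊗ H0 ⊗ H0 by rewrite /q; hom.
pose act_gam := (I H0 ⊠ mu ⊠ mu) ∘ (I (H0 ⊗ H0) ⊠ br H0 H0 ⊠ I H0) ∘ (I H0 ⊠ gam ⊠ I (H0 ⊗ H0)).
have e : act_gam ∘ (I H0 ⊠ Sv ⊠ I H0) ∘ q = (I H0 ⊠ eta ⊠ I H0) ∘ del.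
  by rewrite -gam_del_cancel /act_gam /q; diagram.
transitivity (act_gam ∘ (mu ⊠ (Sv ∘ mu) ⊠ I H0) ∘ (I H0 ⊠ brV H0 H0 ⊠ I (H0 ⊗ H0)) ∘ ((brV H0 H0
    ∘ Delta) ⊠ q)); last first.
  by rewrite /act_gam /q; diagram (mul_comul H).
transitivity ((mu ⊠ mu ⊠ I H0) ∘ (I (H0 ⊗ H0 ⊗ H0) ⊠ br H0 H0)
  ∘ (I H0 ⊠ (act_gam ∘ (I H0 ⊠ Sv ⊠ I H0) ∘ q) ⊠ Sv) ∘ brV H0 H0 ∘ Delta).
  rewrite e. diagram (mu_etal H).
rewrite /act_gam. diagram (antipV_mu H, mu_assoc H).
Qed.

Lemma pentagon1010 : (I H0 ⊠ br H0 H0) ∘ ((Delta ∘ mu) ⊠ I H0) ∘ (I H0 ⊠ del)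
  = (mu ⊠ mu ⊠ mu) ∘ (I H0 ⊠ del ⊠ I (H0 ⊗ H0 ⊗ H0)) ∘ (I H0 ⊠ br H0 H0 ⊠ I H0) ∘ (Delta ⊠ gam).
Proof.
transitivity ((mu ⊠ I H0 ⊠ mu) ∘ (I (H0 ⊗ H0) ⊠ br H0 H0 ⊠ I H0) ∘ (I H0 ⊠ br H0 H0
    ⊠ I (H0 ⊗ H0)) ∘ (Delta ⊠ ((I H0 ⊠ br H0 H0) ∘ (Delta ⊠ I H0) ∘ del))).
  diagram (mul_comul H).
rewrite Delta_del. diagram.
Qed.

Lemma pentagon1110 : (mu ⊠ I H0) ∘ (I H0 ⊠ br H0 H0) ∘ (gam ⊠ phi) = (phi ⊠ I H0) ∘ Delta.
Proof.
transitivity ((mu ⊠ mu) ∘ (I H0 ⊠ br H0 H0 ⊠ I H0) ∘ (gam ⊠ (phi ⊠ eta))).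
  diagram (mu_etar H).
rewrite -copair_phi_Delta.
transitivity ((mu ⊠ mu) ∘ (I H0 ⊠ br H0 H0 ⊠ I H0) ∘ (((mu ⊠ mu) ∘ (I H0 ⊠ br H0 H0 ⊠ I H0)
    ∘ (gam ⊠ C)) ⊠ ((phi ⊠ I H0) ∘ Delta))).
  diagram (mu_assoc H).
rewrite gam_C. diagram (mu_etal H).
Qed.

Lemma pentagon1111 : (I H0 ⊠ mu) ∘ (((I H0 ⊠ Sv) ∘ brV H0 H0 ∘ Delta) ⊠ I H0) ∘ brV H0 H0 ∘ (I H0
    ⊠ mu) ∘ (Delta ⊠ I H0)
  = (mu ⊠ (phi ∘ mu)) ∘ (I H0 ⊠ del ⊠ phi).
Proof.
transitivity ((mu ⊠ I H0) ∘ (I H0 ⊠ ((I H0 ⊠ (phi ∘ mu)) ∘ (del ⊠ phi)))); last by diagram.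
rewrite -antipV_of_phi.
rewrite antipV_absorb. diagram.
Qed.

(** The inverse of [gam] is the copairing itself, and that of [phi] is given by
    Fourier inversion. *)
Lemma copairing_associator_data :
  associator_data H gam del phi C ((I H0 ⊠ (mu ∘ (gV ⊠ I H0))) ∘ C) (Sa ∘ phi ∘ mu ∘ (g ⊠ I H0)).
Proof.
have hD : (I H0 ⊠ (mu ∘ (gV ⊠ I H0))) ∘ C ∈ 𝟏 ⇒ H0 ⊗ H0 by hom.
have hphiV : Sa ∘ phi ∘ mu ∘ (g ⊠ I H0) ∈ H0 ⇒ H0 by hom.
split=> //; try exact: cgam_hom; try exact: cdel_hom; try exact: cphi_hom.
- exact: gam_C.
- exact: C_gam.
- transitivity ((mu ⊠ (mu ∘ (gV ⊠ (mu ∘ (I H0 ⊠ g))))) ∘ (Sa ⊠ I (H0 ⊗ H0)) ∘ ((I (H0 ⊗ H0) ⊠ mu)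
    ∘ (I H0 ⊠ C ⊠ I H0) ∘ C)).
    rewrite /delta_of_copairing. diagram (mu_assoc H).
  rewrite -C1.
  transitivity (((mu ∘ (Sa ⊠ I H0) ∘ Delta) ⊠ (mu ∘ (gV ⊠ (mu ∘ (I H0 ⊠ g))))) ∘ C).
    diagram.
  rewrite antip_left. diagram (C3, mu_etal H, gVl).
- transitivity ((mu ⊠ mu) ∘ (I H0 ⊠ Sa ⊠ I H0 ⊠ (mu ∘ (g ⊠ (mu ∘ (gV ⊠ I H0))))) ∘ (I H0 ⊠ C
    ⊠ I H0) ∘ C).
    rewrite /delta_of_copairing. diagram (mu_assoc H).
  transitivity (((mu ∘ (I H0 ⊠ Sa)) ⊠ I H0) ∘ ((I (H0 ⊗ H0) ⊠ mu) ∘ (I H0 ⊠ C ⊠ I H0) ∘ C)).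
    diagram (gVr_mul).
  rewrite -C1.
  transitivity (((mu ∘ (I H0 ⊠ Sa) ∘ Delta) ⊠ I H0) ∘ C); first by diagram.
  rewrite antip_right. diagram C3.
- transitivity (phi ∘ (mu ∘ (g ⊠ (phi ∘ Sa)))); last exact: phi_rinv.
  transitivity (phi ∘ (Sa ∘ phi ∘ mu ∘ (g ⊠ I H0)) ∘ (phi ∘ (mu ∘ (g ⊠ (phi ∘ Sa))))).
    by rewrite phi_rinv; diagram.
  transitivity (phi ∘ ((Sa ∘ phi ∘ mu ∘ (g ⊠ I H0)) ∘ phi) ∘ (mu ∘ (g ⊠ (phi ∘ Sa)))).
    by diagram.
  by rewrite phi_linv; diagram.
- exact: phi_linv.
- rewrite /delta_of_copairing. diagram (eps_mu H, eg, C3', antip_eta H).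
- exact: Delta_gam_l.
- exact: Delta_gam_r.
- exact: Delta_del_r.
- exact: pentagon0101.
- exact: pentagon1010.
- transitivity ((I H0 ⊠ Sv) ∘ brV H0 H0 ∘ (Delta ∘ phi)); last by diagram.
  rewrite Delta_phi /gamma_of_copairing. diagram.
- by rewrite phi_del_antipV.
- by rewrite Delta_phi_del.
- exact: pentagon1110.
- exact: pentagon1111.
Qed.
End Copairing.

(** * The copairing of a Hopf isomorphism from the dual *)

Section Gamma.
Variables (S : ribbonCat) (H : hopfAlg S).
Local Notation H0 := (carrier H).
Local Notation mu := (mu H).
Local Notation Delta := (Delta H).
Local Notation eta := (eta H).
Local Notation eps := (eps H).
Local Notation Sa := (antip H).
Local Notation Sv := (antipV H).

Lemma dualarrE (A B : ob S) (f : arr S) : f ∈ A ⇒ B ->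
  dualarr f = (ev B ⊠ I A^∨) ∘ (I B^∨ ⊠ f ⊠ I A^∨) ∘ (I B^∨ ⊠ coev A).
Proof. by move=> [<- <-]. Qed.

Lemma dualarr_hom (A B : ob S) (f : arr S) : f ∈ A ⇒ B -> dualarr f ∈ B^∨ ⇒ A^∨.
Proof. by move=> hf; rewrite (dualarrE hf); hom. Qed.

Lemma twVK (U : ob S) : tw U ∘ twV U = I U.
Proof. by case: (tw_inverse U). Qed.

Lemma twV_hom (U : ob S) : twV U ∈ U ⇒ U.
Proof. by case: (tw_inverse U). Qed.
Hint Resolve twV_hom piv_hom : hom.

Variables (Gamma lam g gV GV : arr S).
Hypothesis hG : Gamma ∈ H0^∨ ⇒ H0.
Hypothesis hGV : GV ∈ H0 ⇒ H0^∨.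
Hypothesis GVK : GV ∘ Gamma = I H0^∨.
Hypothesis G_mu : Gamma ∘ Defs.mu (dualHopf H) = mu ∘ (Gamma ⊠ Gamma).
Hypothesis G_eta : Gamma ∘ Defs.eta (dualHopf H) = eta.
Hypothesis G_Delta : Delta ∘ Gamma = (Gamma ⊠ Gamma) ∘ Defs.Delta (dualHopf H).
Hypothesis G_eps : eps ∘ Gamma = Defs.eps (dualHopf H).
Hypothesis G_antip : Sa ∘ Gamma = Gamma ∘ Defs.antip (dualHopf H).
Local Notation C := (copair H Gamma).
Local Notation zz := (zigzag (r:=S) H0, zigzag_dual (r:=S) H0).

Lemma copair_hom : C ∈ 𝟏 ⇒ H0 ⊗ H0.
Proof. by rewrite /copair; hom. Qed.

(** Multiplicativity of [Gamma] is a statement about the comultiplication of [H]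
    in the first leg, since the product of the dual is dual to it. *)
Lemma copair_Delta_l : (Delta ⊠ I H0) ∘ C = (I (H0 ⊗ H0) ⊠ mu) ∘ (I H0 ⊠ C ⊠ I H0) ∘ C.
Proof.
transitivity ((I (H0 ⊗ H0) ⊠ (mu ∘ (Gamma ⊠ Gamma))) ∘ (I H0 ⊠ coev H0 ⊠ I H0^∨) ∘ coev H0).
  rewrite -G_mu /= /copair. diagram zz.
rewrite /copair; diagram.
Qed.

Lemma copair_Delta_r : (I H0 ⊠ Delta) ∘ C = (mu ⊠ I (H0 ⊗ H0)) ∘ (I H0 ⊠ C ⊠ I H0) ∘ C.
Proof.
transitivity ((I H0 ⊠ (Delta ∘ Gamma)) ∘ coev H0); first by rewrite /copair; diagram.
rewrite G_Delta /= /copair. diagram zz.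
Qed.

Lemma copair_eps_l : (eps ⊠ I H0) ∘ C = eta.
Proof.
rewrite -G_eta /= (dualarrE (eps_hom H)) /copair.
diagram (zigzag (r:=S) H0, zigzag_dual (r:=S) H0, zigzag (r:=S) 𝟏).
Qed.

Lemma copair_eps_r : (I H0 ⊠ eps) ∘ C = eta.
Proof.
transitivity ((I H0 ⊠ (eps ∘ Gamma)) ∘ coev H0); first by rewrite /copair; diagram.
rewrite G_eps /= (dualarrE (eta_hom H)).
diagram (zigzag (r:=S) H0, zigzag_dual (r:=S) H0, zigzag (r:=S) 𝟏).
Qed.

Lemma copair_antip : (Sa ⊠ I H0) ∘ C = (I H0 ⊠ Sa) ∘ C.
Proof.
transitivity ((I H0 ⊠ (Sa ∘ Gamma)) ∘ coev H0); last by rewrite /copair; diagram.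
rewrite G_antip /= (dualarrE (antip_hom H)) /copair.
diagram zz.
Qed.

Lemma copair_zigzag : (I H0 ⊠ (ev H0 ∘ (GV ⊠ I H0))) ∘ (C ⊠ I H0) = I H0.
Proof. rewrite /copair. diagram (GVK, zigzag (r:=S) H0). Qed.

Hypothesis hg : g ∈ 𝟏 ⇒ H0.
Hypothesis hgV : gV ∈ 𝟏 ⇒ H0.
(** Condition c) compares [Gamma] with its dual by means of the pivotal
    isomorphism, which is the braiding and the twist turned into an arrow to
    the double dual ([piv_ev]). The inverse twist of condition c) cancels that
    twist, so what remains is the behaviour of the copairing under the
    braiding. *)
Lemma copair_flip : condition_c H Gamma g gV ->
  C = br H0 H0 ∘ (I H0 ⊠ (Sa ∘ Sa ∘ (mu ∘ (gV ⊠ I H0) ∘ (mu ∘ (I H0 ⊠ g))))) ∘ C.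
Proof.
rewrite /condition_c /lmul /rmul; set K := mu ∘ _ ∘ _ => c.
have hK : K ∈ H0 ⇒ H0 by rewrite /K; hom.
have e : ev H0 ∘ (I H0^∨ ⊠ Gamma) = ev H0 ∘ br H0 H0^∨ ∘ ((Sa ∘ Sa ∘ K ∘ Gamma) ⊠ I H0^∨).
  transitivity (ev H0^∨ ∘ (dualarr Gamma ⊠ I H0^∨)).
    rewrite (dualarrE hG). diagram (zigzag_dual (r:=S) H0^∨, zigzag (r:=S) H0^∨).
  rewrite c.
  transitivity (ev H0^∨ ∘ (piv H0 ⊠ I H0^∨) ∘ ((twV H0 ∘ (Sa ∘ Sa) ∘ K ∘ Gamma) ⊠ I H0^∨)).
    by diagram.
  rewrite piv_ev. diagram (twVK H0).
transitivity ((I (H0 ⊗ H0) ⊠ (ev H0 ∘ (I H0^∨ ⊠ Gamma))) ∘ (I H0 ⊠ coev H0 ⊠ I H0^∨) ∘ coev H0).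
  rewrite /copair. diagram zz.
rewrite e /copair.
transitivity (br H0 H0 ∘ (I H0 ⊠ (Sa ∘ Sa ∘ K ∘ Gamma)) ∘ coev H0); last by diagram.
(* the strand that ends in the copairing is pulled over the dual pair *)
have slide : (I (H0 ⊗ H0) ⊠ (ev H0 ∘ br H0 H0^∨ ∘ ((Sa ∘ Sa ∘ K ∘ Gamma) ⊠ I H0^∨)))
    ∘ (br (H0 ⊗ H0^∨) H0 ⊠ I H0^∨) ∘ (I (H0 ⊗ H0^∨) ⊠ coev H0)
  = br H0 H0 ∘ (I H0 ⊠ (Sa ∘ Sa ∘ K ∘ Gamma)) by diagram zz.
rewrite -slide. diagram.
Qed.
End Gamma.

Section Conditions.
Variables (S : ribbonCat) (H : hopfAlg S).
Local Notation H0 := (carrier H).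
Local Notation mu := (mu H).
Local Notation Delta := (Delta H).
Local Notation eta := (eta H).
Local Notation eps := (eps H).
Local Notation Sa := (antip H).
Local Notation Sv := (antipV H).
Variables (Gamma lam g : arr S).
Hypothesis (a : condition_a H Gamma) (b : condition_b H Gamma lam g).

Lemma Gamma_hom : Gamma ∈ H0^∨ ⇒ H0.
Proof. by case: a => -[]. Qed.

Lemma lam_hom : lam ∈ H0 ⇒ 𝟏.
Proof. by case: b => -[]. Qed.

Lemma g_hom : g ∈ 𝟏 ⇒ H0.
Proof. by case: b => _ []. Qed.
Local Notation C := (copair H Gamma).
Lemma copair_homG : C ∈ 𝟏 ⇒ H0 ⊗ H0.
Proof. exact: copair_hom Gamma_hom. Qed.
Hint Resolve Gamma_hom lam_hom g_hom copair_homG : hom.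

(** The normalisation splits [lam], so that arrows precomposed with [lam] can be
    compared after cancelling it; this determines [g] and makes it group-like. *)
Lemma lam_split : lam ∘ ((lam ⊠ I H0) ∘ C) = I 𝟏.
Proof. by case: b => _ _ <-; diagram. Qed.

Lemma distinguished_unique g' : distinguished H lam g' -> g' = g.
Proof.
move=> [hg' e']; have [_ [_ e] _] := b.
transitivity ((g' ∘ lam) ∘ ((lam ⊠ I H0) ∘ C)).
  transitivity (g' ∘ (lam ∘ ((lam ⊠ I H0) ∘ C))); last by diagram.
  by rewrite lam_split; diagram.
rewrite -e' e.
transitivity (g ∘ (lam ∘ ((lam ⊠ I H0) ∘ C))); first by diagram.
by rewrite lam_split; diagram.
Qed.

Lemma g_group_like : Delta ∘ g = g ⊠ g.
Proof.
have [_ [_ e] _] := b.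
transitivity (Delta ∘ (g ∘ lam) ∘ ((lam ⊠ I H0) ∘ C)).
  transitivity (Delta ∘ g ∘ (lam ∘ ((lam ⊠ I H0) ∘ C))); last by diagram.
  by rewrite lam_split; diagram.
rewrite -e.
transitivity ((I H0 ⊠ ((I H0 ⊠ lam) ∘ Delta)) ∘ Delta ∘ ((lam ⊠ I H0) ∘ C)).
  by diagram (Delta_coassoc H).
rewrite e.
transitivity ((I H0 ⊠ g) ∘ ((I H0 ⊠ lam) ∘ Delta) ∘ ((lam ⊠ I H0) ∘ C)); first by diagram.
rewrite e.
transitivity ((g ⊠ g) ∘ (lam ∘ ((lam ⊠ I H0) ∘ C))); first by diagram.
by rewrite lam_split; diagram.
Qed.

Lemma eps_g : eps ∘ g = I 𝟏.
Proof.
have [_ [_ e] _] := b.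
transitivity (eps ∘ (g ∘ lam) ∘ ((lam ⊠ I H0) ∘ C)).
  transitivity (eps ∘ g ∘ (lam ∘ ((lam ⊠ I H0) ∘ C))); last by diagram.
  by rewrite lam_split; diagram.
rewrite -e.
transitivity (lam ∘ ((lam ⊠ I H0) ∘ C)); last exact: lam_split.
by diagram (Delta_epsl H).
Qed.

Lemma g_inverse : mult_inverse H g (Sa ∘ g).
Proof.
split; first by hom.
- transitivity (mu ∘ (I H0 ⊠ Sa) ∘ (g ⊠ g)); first by diagram.
  rewrite -g_group_like.
  transitivity ((mu ∘ (I H0 ⊠ Sa) ∘ Delta) ∘ g); first by diagram.
  by rewrite antip_right; diagram eps_g.
- transitivity (mu ∘ (Sa ⊠ I H0) ∘ (g ⊠ g)); first by diagram.
  rewrite -g_group_like.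
  transitivity ((mu ∘ (Sa ⊠ I H0) ∘ Delta) ∘ g); first by diagram.
  by rewrite antip_left; diagram eps_g.
Qed.

Lemma associator_of_Gamma gV : mult_inverse H g gV -> condition_c H Gamma g gV ->
  exists gamV delV phiV,
    associator_data H (gammaOf H Gamma) (deltaOf H Gamma g) (phiOf H Gamma lam) gamV delV phiV.
Proof.
move=> [hgV gr gl] c; have [[_ [Gm Ge GD Gs GS]] [GV [_ hGV' VK KV]]] := a.
have hG := Gamma_hom; have hGV : GV ∈ H0 ⇒ H0^∨ := hGV'; clear hGV'.
have [[_ lr] [_ lg] ll] := b.
have := copairing_associator_data copair_homG lam_hom g_hom hgV
  (copair_Delta_l hG Gm) (copair_Delta_r hG GD) (copair_eps_l hG Ge) (copair_eps_r hG Gs)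
  (copair_antip hG GS) (copair_flip hG g_hom hgV c) g_group_like eps_g gl gr lr lg ll.
have hlm : lam ∘ mu ∈ H0 ⊗ H0 ⇒ 𝟏 by hom.
have hW : ev H0 ∘ (GV ⊠ I H0) ∈ H0 ⊗ H0 ⇒ 𝟏 by hom.
move=> /(_ _ hlm erefl _ hW (copair_zigzag hG hGV VK)) D.
have -> : gammaOf H Gamma = gamma_of_copairing H C by rewrite /gammaOf /gamma_of_copairing /copair;
    diagram.
have -> : deltaOf H Gamma g
    = delta_of_copairing H C g by rewrite /deltaOf /rmul /delta_of_copairing /copair; diagram.
by do 3 eexists; exact: D.
Qed.
End Conditions.

(** * The monoidal category on the disjoint union *)

Section DisjHom.
Variables (S : ribbonCat) (H : hopfAlg S).
Local Notation H0 := (carrier H).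
Local Notation hom_ := (@sum_hom (rep_cat H) (base_cat S)).
Implicit Types (X Y Z W : hmod H + ob S).

Definition to_disj_hom X Y (f : arr S) : is_disj_hom X Y f -> hom_ X Y :=
  match X, Y return is_disj_hom X Y f -> hom_ X Y with
  | inl _, inl _ | inr _, inr _ => fun p => exist _ f p
  | _, _ => fun p => False_rect _ p
  end.

Lemma disj_arr_to X Y f (p : is_disj_hom X Y f) : disj_arr (to_disj_hom p) = f.
Proof. by case: X Y p => [M|A] [N|B]. Qed.

Lemma disj_arr_inj X Y (f g : hom_ X Y) : disj_arr f = disj_arr g -> f = g.
Proof. by case: X Y f g => [M|A] [N|B] //= f g; apply: sig_ext. Qed.

Lemma disj_arrP X Y (f : hom_ X Y) : is_disj_hom X Y (disj_arr f).
Proof. by case: X Y f => [M|A] [N|B] //= [f p]. Qed.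

Lemma disj_hom_arr X Y f : is_disj_hom X Y f -> f ∈ disj_ob X ⇒ disj_ob Y.
Proof. by case: X Y => [M|A] [N|B] //= []. Qed.

Lemma disj_arr_id X : disj_arr (@sum_id (rep_cat H) (base_cat S) X) = I (disj_ob X).
Proof. by case: X. Qed.

Lemma disj_arr_comp X Y Z (g : hom_ Y Z) (f : hom_ X Y) :
  disj_arr (sum_comp g f) = disj_arr g ∘ disj_arr f.
Proof. by case: X Y Z g f => [M|A] [N|B] [Q|C]. Qed.

Lemma disj_arr_map X X' Y Y' (f : hom_ X X') (g : hom_ Y Y') :
  disj_arr (disj_map f g) = disj_map_arr X Y (disj_arr f) (disj_arr g).
Proof. by case: X X' Y Y' f g => [M|A] [M'|A'] [N|B] [N'|B']. Qed.

Lemma is_disj_hom_id X : is_disj_hom X X (I (disj_ob X)).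
Proof. by case: X => [M|A]; [apply: idm_modhom | apply: idm_hom]. Qed.

Lemma is_disj_hom_map X X' Y Y' f g : is_disj_hom X X' f -> is_disj_hom Y Y' g ->
  is_disj_hom (disj_ten X Y) (disj_ten X' Y') (disj_map_arr X Y f g).
Proof.
move=> hf hg; rewrite -(disj_arr_to hf) -(disj_arr_to hg) -disj_arr_map; exact: disj_arrP.
Qed.

Lemma is_disj_hom_inv X Y f h : is_disj_hom X Y f -> h ∈ disj_ob Y ⇒ disj_ob X ->
  h ∘ f = I (disj_ob X) -> f ∘ h = I (disj_ob Y) -> is_disj_hom Y X h.
Proof.
case: X Y => [M|A] [N|B] //= [hf ef] hh hfI fhI; split=> //.
transitivity (h ∘ act N ∘ (I H0 ⊠ (f ∘ h))); first by rewrite fhI; diagram.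
transitivity (h ∘ (act N ∘ (I H0 ⊠ f)) ∘ (I H0 ⊠ h)); first by diagram.
rewrite -ef; transitivity ((h ∘ f) ∘ act M ∘ (I H0 ⊠ h)); first by diagram.
by rewrite hfI; diagram.
Qed.

Lemma disj_iso X Y (f : hom_ X Y) h : h ∈ disj_ob Y ⇒ disj_ob X ->
  h ∘ disj_arr f = I (disj_ob X) -> disj_arr f ∘ h = I (disj_ob Y) ->
  @is_iso (sum_cat (rep_cat H) (base_cat S)) X Y f.
Proof.
move=> hh e1 e2; have p := is_disj_hom_inv (disj_arrP f) hh e1 e2.
exists (to_disj_hom p); split; apply: disj_arr_inj; rewrite [LHS]disj_arr_comp disj_arr_to ?e1 ?e2;
by rewrite [RHS]disj_arr_id.
Qed.

Section Structure.
Variables gam del phi gamV delV phiV : arr S.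
Hypothesis P : associator_data H gam del phi gamV delV phiV.

Lemma disj_unitl X : disj_ob (disj_ten (inl (unit_mod H)) X) = disj_ob X.
Proof. by case: X => [M|A]; rewrite /= tob_unitl. Qed.

Lemma disj_unitr X : disj_ob (disj_ten X (inl (unit_mod H))) = disj_ob X.
Proof. by case: X => [M|A]; rewrite /= tob_unitr. Qed.

Lemma disj_lunit_hom X : is_disj_hom (disj_ten (inl (unit_mod H)) X) X (I (disj_ob X)).
Proof.
case: X => [M|A] /=; last by rewrite tob_unitl; apply: idm_hom.
split; rewrite /= ?tob_unitl; first exact: idm_hom.
by rewrite /act2 /=; diagram (Delta_epsl H).
Qed.

Lemma disj_runit_hom X : is_disj_hom (disj_ten X (inl (unit_mod H))) X (I (disj_ob X)).
Proof.
case: X => [M|A] /=; last by rewrite tob_unitr; apply: idm_hom.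
split; rewrite /= ?tob_unitr; first exact: idm_hom.
by rewrite /act2 /=; diagram (Delta_epsr H).
Qed.

(** The unit isomorphisms are identities of [S] whose source and target are only
    propositionally the same object, which is why they are built from
    [to_disj_hom]. *)
Lemma disj_monoidal : exists M : monoidalStr (Cdisj H), disj_built gam del phi M.
Proof.
unshelve eexists.
  refine (@MonoidalStr (Cdisj H)
    (fun X Y Z => to_disj_hom (alpha_disj_hom P X Y Z))
    (fun X => to_disj_hom (disj_lunit_hom X))
    (fun X => to_disj_hom (disj_runit_hom X)) _ _ _ _ _ _ _ _).
- move=> X Y Z.
  refine (@disj_iso (disj_ten X (disj_ten Y Z)) (disj_ten (disj_ten X Y) Z) _
    (alphaV gamV delV phiV X Y Z) _ _ _).
  + exact: alphaV_hom P X Y Z.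
  + by rewrite disj_arr_to (alphaVK P).
  + by rewrite disj_arr_to (alphaKV P).
- move=> X; refine (@disj_iso (disj_ten (inl (unit_mod H)) X) X _ (I (disj_ob X)) _ _ _).
  + by apply: hom_eq (idm_hom _) _ _; rewrite ?disj_unitl.
  + by rewrite disj_arr_to disj_unitl; compid.
  + by rewrite disj_arr_to; compid.
- move=> X; refine (@disj_iso (disj_ten X (inl (unit_mod H))) X _ (I (disj_ob X)) _ _ _).
  + by apply: hom_eq (idm_hom _) _ _; rewrite ?disj_unitr.
  + by rewrite disj_arr_to disj_unitr; compid.
  + by rewrite disj_arr_to; compid.
- move=> X X' Y Y' Z Z' f g h; apply: disj_arr_inj.
  rewrite [LHS]disj_arr_comp [RHS]disj_arr_comp !disj_arr_to !disj_arr_map.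
  by apply: (alpha_natural P); apply: disj_arrP.
- move=> X Y f; apply: disj_arr_inj; have hf := disj_hom_arr (disj_arrP f).
  rewrite [LHS]disj_arr_comp [RHS]disj_arr_comp !disj_arr_to disj_arr_map disj_arr_id.
  have -> : disj_map_arr (inl (unit_mod H)) X (I (disj_ob (inl (unit_mod H)))) (disj_arr f) = disj_arr f.
    by rewrite /disj_map_arr /= tarr_unitl.
  by rewrite (idl_hom hf) // (idr_hom hf).
- move=> X Y f; apply: disj_arr_inj; have hf := disj_hom_arr (disj_arrP f).
  rewrite [LHS]disj_arr_comp [RHS]disj_arr_comp !disj_arr_to disj_arr_map disj_arr_id.
  have -> : disj_map_arr X (inl (unit_mod H)) (disj_arr f) (I (disj_ob (inl (unit_mod H)))) = disj_arr f.
    by clear hf; case: X f => [M|A] f; rewrite /disj_map_arr /= tarr_unitr.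
  by rewrite (idl_hom hf) // (idr_hom hf).
- move=> X Y Z W; apply: disj_arr_inj.
  rewrite [LHS]disj_arr_comp ![in RHS]disj_arr_comp !disj_arr_map !disj_arr_to !disj_arr_id.
  exact: (alpha_pentagon P).
- move=> X Y; apply: disj_arr_inj.
  rewrite [LHS]disj_arr_comp !disj_arr_map !disj_arr_to !disj_arr_id.
  rewrite [disj_alpha _ _ _ _ _ _](alpha_triangle P X Y).
  by case: X Y => [M|A] [N|B]; rewrite /disj_map_arr /= !tarr_idm; compid.
split; move=> *; exact: disj_arr_to.
Qed.
End Structure.
End DisjHom.

(** * Biproducts *)

Section Biproducts.
Variables (S : ribbonCat) (a : additiveStr S).
Implicit Types (A B K L U V : ob S).
Local Notation "f +' g" := (add a f g) (at level 50, left associativity).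
Local Notation O := (zero a).

(** A relational form of [bip], stable under tensoring with identities: the
    summands of an iterated tensor product are biproducts of this kind. *)
Record biproduct U A B (i1 i2 p1 p2 : arr S) : Prop := Biproduct {
  bi1 : i1 ∈ A ⇒ U;
  bi2 : i2 ∈ B ⇒ U;
  bp1 : p1 ∈ U ⇒ A;
  bp2 : p2 ∈ U ⇒ B;
  bp1i1 : p1 ∘ i1 = I A;
  bp2i2 : p2 ∘ i2 = I B;
  bp1i2 : p1 ∘ i2 = O B A;
  bp2i1 : p2 ∘ i1 = O A B;
  bip_sum : i1 ∘ p1 +' i2 ∘ p2 = I U
}.

Lemma bip_biproduct A B :
  biproduct (bip a A B) A B (in1 a A B) (in2 a A B) (pr1 a A B) (pr2 a A B).
Proof.
by split; eauto with hom; rewrite ?pr1_in1 ?pr2_in2 ?pr1_in2 ?pr2_in1 ?bip_idm.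
Qed.

Lemma tarr_zerol K A B : O A B ⊠ I K = O (A ⊗ K) (B ⊗ K).
Proof.
have h0 := zero_hom a A B; have hz : O A B ⊠ I K ∈ A ⊗ K ⇒ B ⊗ K by hom.
have := tarr_addr a (I K) h0 h0; rewrite (add0 a h0) => e.
have := addN a hz; rewrite {2}e (addA a (opp_hom a hz) hz hz) (addN a hz) => <-.
by rewrite (add0 a hz).
Qed.

Lemma biproduct_whisker K L U A B i1 i2 p1 p2 : biproduct U A B i1 i2 p1 p2 ->
  biproduct (K ⊗ U ⊗ L) (K ⊗ A ⊗ L) (K ⊗ B ⊗ L)
    (I K ⊠ i1 ⊠ I L) (I K ⊠ i2 ⊠ I L) (I K ⊠ p1 ⊠ I L) (I K ⊠ p2 ⊠ I L).
Proof.
case=> h1 h2 k1 k2 e1 e2 e3 e4 s; split; try by hom.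
- by rewrite -!whiskerr -?whiskerl ?e1 ?tarr_idm //; typ.
- by rewrite -!whiskerr -?whiskerl ?e2 ?tarr_idm //; typ.
- by rewrite -!whiskerr -?whiskerl ?e3 ?tarr_zeror ?tarr_zerol //; typ.
- by rewrite -!whiskerr -?whiskerl ?e4 ?tarr_zeror ?tarr_zerol //; typ.
have j1 : i1 ∘ p1 ∈ U ⇒ U by hom. have j2 : i2 ∘ p2 ∈ U ⇒ U by hom.
rewrite -!whiskerr -?whiskerl; try typ.
rewrite -(tarr_addr a (I L) (tarr_hom (idm_hom K) j1) (tarr_hom (idm_hom K) j2)).
by rewrite -(tarr_addl a (I K) j1 j2) s !tarr_idm.
Qed.

Lemma biproduct_whiskerl K U A B i1 i2 p1 p2 : biproduct U A B i1 i2 p1 p2 ->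
  biproduct (K ⊗ U) (K ⊗ A) (K ⊗ B) (I K ⊠ i1) (I K ⊠ i2) (I K ⊠ p1) (I K ⊠ p2).
Proof. by move=> /(biproduct_whisker K 𝟏); rewrite !tob_unitr !tarr_unitr. Qed.

Lemma biproduct_whiskerr L U A B i1 i2 p1 p2 : biproduct U A B i1 i2 p1 p2 ->
  biproduct (U ⊗ L) (A ⊗ L) (B ⊗ L) (i1 ⊠ I L) (i2 ⊠ I L) (p1 ⊠ I L) (p2 ⊠ I L).
Proof. by move=> /(biproduct_whisker 𝟏 L); rewrite !tob_unitl !tarr_unitl. Qed.

Section One.
Variables (U A B : ob S) (i1 i2 p1 p2 : arr S).
Hypothesis h : biproduct U A B i1 i2 p1 p2.

Lemma biproduct_ext V f g : f ∈ U ⇒ V -> g ∈ U ⇒ V ->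
  f ∘ i1 = g ∘ i1 -> f ∘ i2 = g ∘ i2 -> f = g.
Proof.
case: h => h1 h2 k1 k2 _ _ _ _ s hf hg e1 e2.
have j1 : i1 ∘ p1 ∈ U ⇒ U by hom. have j2 : i2 ∘ p2 ∈ U ⇒ U by hom.
rewrite -(idr_hom hf erefl) -(idr_hom hg erefl) -s (comp_addl a j1 j2 hf) (comp_addl a j1 j2 hg).
by rewrite !comp_assoc; try typ; rewrite e1 e2.
Qed.
End One.

(** A triple tensor product in the direct sum has four summands in each degree,
    and [four_sum] is the shape in which the associator is written there. *)
Section Four.
Variables (U A B A1 A2 B1 B2 V : ob S) (i1 i2 p1 p2 j1 j2 q1 q2 k1 k2 r1 r2 : arr S).
Hypothesis hU : biproduct U A B i1 i2 p1 p2.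
Hypothesis hA : biproduct A A1 A2 j1 j2 q1 q2.
Hypothesis hB : biproduct B B1 B2 k1 k2 r1 r2.

Lemma four_ext f g : f ∈ U ⇒ V -> g ∈ U ⇒ V ->
  f ∘ (i1 ∘ j1) = g ∘ (i1 ∘ j1) -> f ∘ (i1 ∘ j2) = g ∘ (i1 ∘ j2) ->
  f ∘ (i2 ∘ k1) = g ∘ (i2 ∘ k1) -> f ∘ (i2 ∘ k2) = g ∘ (i2 ∘ k2) -> f = g.
Proof.
move=> hf hg e1 e2 e3 e4; have [b1 b2 _ _ _ _ _ _ _] := hU.
have [c1 c2 _ _ _ _ _ _ _] := hA; have [d1 d2 _ _ _ _ _ _ _] := hB.
apply: (biproduct_ext hU hf hg).
  by apply: (biproduct_ext (V := V) hA); rewrite -?comp_assoc //; try typ; hom.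
by apply: (biproduct_ext (V := V) hB); rewrite -?comp_assoc //; try typ; hom.
Qed.

Variables t1 t2 t3 t4 : arr S.
Hypothesis ht1 : t1 ∈ A1 ⇒ V.
Hypothesis ht2 : t2 ∈ A2 ⇒ V.
Hypothesis ht3 : t3 ∈ B1 ⇒ V.
Hypothesis ht4 : t4 ∈ B2 ⇒ V.

Definition four_sum := t1 ∘ (q1 ∘ p1) +' t2 ∘ (q2 ∘ p1) +' t3 ∘ (r1 ∘ p2) +' t4 ∘ (r2 ∘ p2).

Lemma four_sum_hom : four_sum ∈ U ⇒ V.
Proof.
have [_ _ ? ? _ _ _ _ _] := hU; have [_ _ ? ? _ _ _ _ _] := hA.
by have [_ _ ? ? _ _ _ _ _] := hB; do !apply: add_hom; hom.
Qed.

Lemma four_sumE : [/\ four_sum ∘ (i1 ∘ j1) = t1, four_sum ∘ (i1 ∘ j2) = t2,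
  four_sum ∘ (i2 ∘ k1) = t3 & four_sum ∘ (i2 ∘ k2) = t4].
Proof.
have [b1 b2 b3 b4 b5 b6 b7 b8 _] := hU; have [c1 c2 c3 c4 c5 c6 c7 c8 _] := hA.
have [d1 d2 d3 d4 d5 d6 d7 d8 _] := hB.
have s1 : t1 ∘ (q1 ∘ p1) ∈ U ⇒ V by hom. have s2 : t2 ∘ (q2 ∘ p1) ∈ U ⇒ V by hom.
have s3 : t3 ∘ (r1 ∘ p2) ∈ U ⇒ V by hom. have s4 : t4 ∘ (r2 ∘ p2) ∈ U ⇒ V by hom.
have s12 := add_hom a s1 s2; have s123 := add_hom a s12 s3.
have E x D : x ∈ D ⇒ U -> four_sum ∘ x = t1 ∘ (q1 ∘ (p1 ∘ x)) +' t2 ∘ (q2 ∘ (p1 ∘ x))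
    +' t3 ∘ (r1 ∘ (p2 ∘ x)) +' t4 ∘ (r2 ∘ (p2 ∘ x)).
  move=> hx; rewrite /four_sum (comp_addr a s123 s4 hx) (comp_addr a s12 s3 hx).
  by rewrite (comp_addr a s1 s2 hx) -!comp_assoc //; typ.
have P1 x D : x ∈ D ⇒ A -> (p1 ∘ (i1 ∘ x) = x) /\ (p2 ∘ (i1 ∘ x) = O D B).
  move=> hx; rewrite !comp_assoc; try typ.
  by rewrite b5 b8 (comp_zerol a _ hx); split=> //; compid.
have P2 x D : x ∈ D ⇒ B -> (p2 ∘ (i2 ∘ x) = x) /\ (p1 ∘ (i2 ∘ x) = O D A).
  move=> hx; rewrite !comp_assoc; try typ.
  by rewrite b6 b7 (comp_zerol a _ hx); split=> //; compid.
have Z D X Y x : x ∈ X ⇒ Y -> x ∘ O D X = O D Y by move=> hx; apply: comp_zeror hx.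
split.
- rewrite (E _ A1) ?(P1 _ _ c1).1 ?(P1 _ _ c1).2 ?c5 ?c8; last by hom.
  by rewrite (Z _ _ _ _ d3) (Z _ _ _ _ d4) (Z _ _ _ _ ht2) (Z _ _ _ _ ht3) (Z _ _ _ _ ht4)
    (idr_hom ht1) // !(addr0 a ht1).
- rewrite (E _ A2) ?(P1 _ _ c2).1 ?(P1 _ _ c2).2 ?c6 ?c7; last by hom.
  by rewrite (Z _ _ _ _ d3) (Z _ _ _ _ d4) (Z _ _ _ _ ht1) (Z _ _ _ _ ht3) (Z _ _ _ _ ht4)
    (idr_hom ht2) // (add0 a ht2) !(addr0 a ht2).
- rewrite (E _ B1) ?(P2 _ _ d1).1 ?(P2 _ _ d1).2 ?d5 ?d8; last by hom.
  by rewrite (Z _ _ _ _ c3) (Z _ _ _ _ c4) (Z _ _ _ _ ht1) (Z _ _ _ _ ht2) (Z _ _ _ _ ht4)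
    (idr_hom ht3) // (add0 a (zero_hom a _ _)) (add0 a ht3) (addr0 a ht3).
- rewrite (E _ B2) ?(P2 _ _ d2).1 ?(P2 _ _ d2).2 ?d6 ?d7; last by hom.
  by rewrite (Z _ _ _ _ c3) (Z _ _ _ _ c4) (Z _ _ _ _ ht1) (Z _ _ _ _ ht2) (Z _ _ _ _ ht3)
    (idr_hom ht4) // !(add0 a (zero_hom a _ _)) (add0 a ht4).
Qed.
End Four.
End Biproducts.

(** * Gluing structure along inclusions *)

(** In this part [i_xy : x ⊗c y -> xy] and the like are inclusions of tensor
    products of homogeneous parts, and an arrow [a] with
    [a ∘ inclusion = inclusion ∘ assoc] is the restriction of an associator of
    the direct sum. The lemmas say that such restrictions inherit coherence
    from the monoidal structure of the disjoint union. *)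
Section Glue.
Variables (K : tensorCat) (M : monoidalStr K).
Local Notation α := (assoc M).

Lemma tmap_idl_comp (x y y' y'' : cob K) (g : chom y' y'') (f : chom y y') :
  cid x ⊠c (g ∘c f) = (cid x ⊠c g) ∘c (cid x ⊠c f).
Proof. by rewrite -tmap_comp ccomp_idl. Qed.

Lemma tmap_idr_comp (x y y' y'' : cob K) (g : chom y' y'') (f : chom y y') :
  (g ∘c f) ⊠c cid x = (g ⊠c cid x) ∘c (f ⊠c cid x).
Proof. by rewrite -tmap_comp ccomp_idl. Qed.

Lemma tmap_slide (x x' y y' : cob K) (f : chom x x') (g : chom y y') :
  (f ⊠c cid y') ∘c (cid x ⊠c g) = (cid x' ⊠c g) ∘c (f ⊠c cid y).
Proof. by rewrite -!tmap_comp !ccomp_idl !ccomp_idr. Qed.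

Lemma assoc_nat1 (x x' y z : cob K) (f : chom x x') :
  α x' y z ∘c (f ⊠c cid (y ⊗c z)) = (f ⊠c cid y ⊠c cid z) ∘c α x y z.
Proof. by rewrite -assoc_nat tmap_id. Qed.

Lemma assoc_nat2 (x y y' z : cob K) (g : chom y y') :
  α x y' z ∘c (cid x ⊠c (g ⊠c cid z)) = (cid x ⊠c g ⊠c cid z) ∘c α x y z.
Proof. exact: assoc_nat. Qed.

Lemma assoc_nat3 (x y z z' : cob K) (h : chom z z') :
  α x y z' ∘c (cid x ⊠c (cid y ⊠c h)) = (cid (x ⊗c y) ⊠c h) ∘c α x y z.
Proof. by rewrite assoc_nat tmap_id. Qed.

Lemma pentagon_glue (x y z w xy yz zw x_yz xy_z y_zw yz_w p0 p1 p2 p3 p4 : cob K)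
    (i_xy : chom (x ⊗c y) xy) (i_yz : chom (y ⊗c z) yz) (i_zw : chom (z ⊗c w) zw)
    (i_x_yz : chom (x ⊗c yz) x_yz) (i_xy_z : chom (xy ⊗c z) xy_z)
    (i_y_zw : chom (y ⊗c zw) y_zw) (i_yz_w : chom (yz ⊗c w) yz_w)
    (k0 : chom (x ⊗c y_zw) p0) (k1 : chom (xy ⊗c zw) p1) (k2 : chom (xy_z ⊗c w) p2)
    (k3 : chom (x ⊗c yz_w) p3) (k4 : chom (x_yz ⊗c w) p4)
    (a_xyz : chom x_yz xy_z) (a_yzw : chom y_zw yz_w)
    (a1 : chom p0 p1) (a2 : chom p1 p2) (b1 : chom p0 p3) (b2 : chom p3 p4) (b3 : chom p4 p2) :
  a_xyz ∘c (i_x_yz ∘c (cid x ⊠c i_yz)) = i_xy_z ∘c (i_xy ⊠c cid z) ∘c α x y z ->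
  a_yzw ∘c (i_y_zw ∘c (cid y ⊠c i_zw)) = i_yz_w ∘c (i_yz ⊠c cid w) ∘c α y z w ->
  a1 ∘c (k0 ∘c (cid x ⊠c i_y_zw)) = k1 ∘c (i_xy ⊠c cid zw) ∘c α x y zw ->
  a2 ∘c (k1 ∘c (cid xy ⊠c i_zw)) = k2 ∘c (i_xy_z ⊠c cid w) ∘c α xy z w ->
  b1 ∘c k0 = k3 ∘c (cid x ⊠c a_yzw) ->
  b2 ∘c (k3 ∘c (cid x ⊠c i_yz_w)) = k4 ∘c (i_x_yz ⊠c cid w) ∘c α x yz w ->
  b3 ∘c k4 = k2 ∘c (a_xyz ⊠c cid w) ->
  a2 ∘c a1 ∘c (k0 ∘c (cid x ⊠c (i_y_zw ∘c (cid y ⊠c i_zw))))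
  = b3 ∘c b2 ∘c b1 ∘c (k0 ∘c (cid x ⊠c (i_y_zw ∘c (cid y ⊠c i_zw)))).
Proof.
move=> Exyz Eyzw E1 E2 F1 F2 F3.
have assoc3 (X Y Z W : cob K) (h : chom Z W) (g : chom Y Z) (f : chom X Y) :
  h ∘c g ∘c f = h ∘c (g ∘c f) by rewrite ccomp_assoc.
transitivity (k2 ∘c (i_xy_z ⊠c cid w) ∘c (i_xy ⊠c cid z ⊠c cid w)
    ∘c (α (x ⊗c y) z w ∘c α x y (z ⊗c w))).
  transitivity (a2 ∘c (a1 ∘c (k0 ∘c (cid x ⊠c i_y_zw))) ∘c (cid x ⊠c (cid y ⊠c i_zw))).
    by rewrite tmap_idl_comp !ccomp_assoc.
  rewrite E1.
  transitivity (a2 ∘c k1 ∘c (i_xy ⊠c cid zw) ∘c (α x y zw ∘c (cid x ⊠c (cid y ⊠c i_zw)))).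
    by rewrite !ccomp_assoc.
  rewrite assoc_nat3.
  transitivity (a2 ∘c k1 ∘c ((i_xy ⊠c cid zw) ∘c (cid (x ⊗c y) ⊠c i_zw)) ∘c α x y (z ⊗c w)).
    by rewrite !ccomp_assoc.
  rewrite tmap_slide.
  transitivity (a2 ∘c (k1 ∘c (cid xy ⊠c i_zw)) ∘c (i_xy ⊠c cid (z ⊗c w)) ∘c α x y (z ⊗c w)).
    by rewrite !ccomp_assoc.
  rewrite E2.
  transitivity (k2 ∘c (i_xy_z ⊠c cid w) ∘c (α xy z w ∘c (i_xy ⊠c cid (z ⊗c w))) ∘c α x y (z ⊗c w)).
    by rewrite !ccomp_assoc.
  by rewrite assoc_nat1 !ccomp_assoc.
rewrite (pentagon M).
transitivity (b3 ∘c b2 ∘c (b1 ∘c k0) ∘c (cid x ⊠c (i_y_zw ∘c (cid y ⊠c i_zw)))); last first.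
  by rewrite !ccomp_assoc.
rewrite F1.
transitivity (b3 ∘c b2 ∘c k3 ∘c (cid x ⊠c (a_yzw ∘c (i_y_zw ∘c (cid y ⊠c i_zw))))); last first.
  by rewrite [in LHS]tmap_idl_comp !ccomp_assoc.
rewrite Eyzw !tmap_idl_comp.
transitivity (b3 ∘c (b2 ∘c (k3 ∘c (cid x ⊠c i_yz_w))) ∘c (cid x ⊠c (i_yz ⊠c cid w))
  ∘c (cid x ⊠c α y z w)); last by rewrite !ccomp_assoc.
rewrite F2.
transitivity (b3 ∘c k4 ∘c (i_x_yz ⊠c cid w) ∘c (α x yz w ∘c (cid x ⊠c (i_yz ⊠c cid w)))
  ∘c (cid x ⊠c α y z w)); last by rewrite !ccomp_assoc.
rewrite assoc_nat2 F3.
transitivity (k2 ∘c ((a_xyz ∘c (i_x_yz ∘c (cid x ⊠c i_yz))) ⊠c cid w) ∘c α x (y ⊗c z) w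
  ∘c (cid x ⊠c α y z w)); last by rewrite !tmap_idr_comp !ccomp_assoc.
by rewrite Exyz !tmap_idr_comp !ccomp_assoc.
Qed.

Lemma natural_glue (x x' y y' z z' yz yz' xy xy' p p' q q' : cob K)
    (i_yz : chom (y ⊗c z) yz) (i_yz' : chom (y' ⊗c z') yz')
    (i_xy : chom (x ⊗c y) xy) (i_xy' : chom (x' ⊗c y') xy')
    (k : chom (x ⊗c yz) p) (k' : chom (x' ⊗c yz') p')
    (l : chom (xy ⊗c z) q) (l' : chom (xy' ⊗c z') q')
    (f : chom x x') (g : chom y y') (h : chom z z') (gh : chom yz yz') (fg : chom xy xy')
    (u : chom p p') (v : chom q q') (a : chom p q) (a' : chom p' q') :
  a ∘c (k ∘c (cid x ⊠c i_yz)) = l ∘c (i_xy ⊠c cid z) ∘c α x y z ->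
  a' ∘c (k' ∘c (cid x' ⊠c i_yz')) = l' ∘c (i_xy' ⊠c cid z') ∘c α x' y' z' ->
  gh ∘c i_yz = i_yz' ∘c (g ⊠c h) -> fg ∘c i_xy = i_xy' ∘c (f ⊠c g) ->
  u ∘c k = k' ∘c (f ⊠c gh) -> v ∘c l = l' ∘c (fg ⊠c h) ->
  a' ∘c u ∘c (k ∘c (cid x ⊠c i_yz)) = v ∘c a ∘c (k ∘c (cid x ⊠c i_yz)).
Proof.
move=> Ea Ea' Egh Efg Eu Ev.
transitivity (a' ∘c (u ∘c k) ∘c (cid x ⊠c i_yz)); first by rewrite !ccomp_assoc.
rewrite Eu; transitivity (a' ∘c k' ∘c ((f ⊠c gh) ∘c (cid x ⊠c i_yz))).
  by rewrite !ccomp_assoc.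
rewrite -tmap_comp ccomp_idr Egh.
transitivity (a' ∘c (k' ∘c (cid x' ⊠c i_yz')) ∘c (f ⊠c (g ⊠c h))).
  by rewrite -!ccomp_assoc -tmap_comp ccomp_idl.
rewrite Ea' -ccomp_assoc assoc_nat.
transitivity (v ∘c (a ∘c (k ∘c (cid x ⊠c i_yz)))); last by rewrite !ccomp_assoc.
rewrite Ea; transitivity (v ∘c l ∘c (i_xy ⊠c cid z) ∘c α x y z); last by rewrite !ccomp_assoc.
rewrite Ev -[l' ∘c (fg ⊠c h) ∘c _]ccomp_assoc -tmap_comp ccomp_idr Efg.
by rewrite !ccomp_assoc -[l' ∘c _ ∘c (_ ⊠c h)]ccomp_assoc -tmap_comp ccomp_idl.
Qed.

Lemma triangle_glue (x y y1 x1 p q r : cob K)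
    (i_1y : chom (tone ⊗c y) y1) (i_x1 : chom (x ⊗c tone) x1)
    (k : chom (x ⊗c y1) p) (l : chom (x1 ⊗c y) q) (m : chom (x ⊗c y) r)
    (a : chom p q) (rx : chom x1 x) (ly : chom y1 y) (u : chom q r) (v : chom p r) :
  a ∘c (k ∘c (cid x ⊠c i_1y)) = l ∘c (i_x1 ⊠c cid y) ∘c α x tone y ->
  rx ∘c i_x1 = runit M x -> ly ∘c i_1y = lunit M y ->
  u ∘c l = m ∘c (rx ⊠c cid y) -> v ∘c k = m ∘c (cid x ⊠c ly) ->
  u ∘c a ∘c (k ∘c (cid x ⊠c i_1y)) = v ∘c (k ∘c (cid x ⊠c i_1y)).
Proof.
move=> Ea Er El Eu Ev; rewrite -ccomp_assoc Ea [RHS]ccomp_assoc Ev !ccomp_assoc Eu.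
rewrite -[m ∘c _ ∘c (i_x1 ⊠c _)]ccomp_assoc -tmap_idr_comp Er.
by rewrite -[RHS]ccomp_assoc -tmap_idl_comp El -ccomp_assoc (triangle M).
Qed.
End Glue.

Section FunctorGlue.
Variables (C D : tensorCat) (M : monoidalStr C) (N : monoidalStr D) (F : monFunctor M N).

(** The same for the comparison of a monoidal functor: [t_yz], [t_xy], [s] and
    [s'] are its extensions along the inclusions. *)
Lemma functor_glue (x y z yz xy p q : cob C) (yz' xy' p' q' p'' q'' : cob D)
    (i_yz : chom (y ⊗c z) yz) (i_xy : chom (x ⊗c y) xy)
    (k : chom (x ⊗c yz) p) (l : chom (xy ⊗c z) q) (a : chom p q)
    (j_yz : chom (F y ⊗c F z) yz') (j_xy : chom (F x ⊗c F y) xy')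
    (k' : chom (F x ⊗c yz') p') (l' : chom (xy' ⊗c F z) q') (a' : chom p' q')
    (t_yz : chom yz' (F yz)) (t_xy : chom xy' (F xy))
    (k'' : chom (F x ⊗c F yz) p'') (l'' : chom (F xy ⊗c F z) q'')
    (e : chom p' p'') (e' : chom q' q'') (s : chom p'' (F p)) (s' : chom q'' (F q)) :
  a ∘c (k ∘c (cid x ⊠c i_yz)) = l ∘c (i_xy ⊠c cid z) ∘c assoc M x y z ->
  a' ∘c (k' ∘c (cid (F x) ⊠c j_yz)) = l' ∘c (j_xy ⊠c cid (F z)) ∘c assoc N (F x) (F y) (F z) ->
  t_yz ∘c j_yz = fmap F i_yz ∘c mf2 F y z -> t_xy ∘c j_xy = fmap F i_xy ∘c mf2 F x y ->
  e ∘c k' = k'' ∘c (cid (F x) ⊠c t_yz) -> e' ∘c l' = l'' ∘c (t_xy ⊠c cid (F z)) ->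
  s ∘c k'' = fmap F k ∘c mf2 F x yz -> s' ∘c l'' = fmap F l ∘c mf2 F xy z ->
  fmap F a ∘c s ∘c e ∘c (k' ∘c (cid (F x) ⊠c j_yz))
  = s' ∘c e' ∘c a' ∘c (k' ∘c (cid (F x) ⊠c j_yz)).
Proof.
move=> Ea Ea' Et Et' Ee Ee' Es Es'.
transitivity (fmap F a ∘c (s ∘c k'') ∘c (cid (F x) ⊠c (t_yz ∘c j_yz))).
  transitivity (fmap F a ∘c s ∘c (e ∘c k') ∘c (cid (F x) ⊠c j_yz)); first by rewrite !ccomp_assoc.
  by rewrite Ee tmap_idl_comp !ccomp_assoc.
rewrite Es Et tmap_idl_comp.
transitivity (fmap F a ∘c fmap F k ∘c (mf2 F x yz ∘c (cid (F x) ⊠c fmap F i_yz))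
  ∘c (cid (F x) ⊠c mf2 F y z)); first by rewrite !ccomp_assoc.
rewrite -fmap_id mf2_nat fmap_id.
transitivity (fmap F (a ∘c (k ∘c (cid x ⊠c i_yz))) ∘c mf2 F x (y ⊗c z) ∘c (cid (F x) ⊠c mf2 F y z)).
  by rewrite !fmap_comp !ccomp_assoc.
rewrite Ea.
transitivity (fmap F l ∘c fmap F (i_xy ⊠c cid z)
  ∘c (fmap F (assoc M x y z) ∘c mf2 F x (y ⊗c z) ∘c (cid (F x) ⊠c mf2 F y z))).
  by rewrite !fmap_comp !ccomp_assoc.
rewrite mf_assoc.
transitivity (fmap F l ∘c (fmap F (i_xy ⊠c cid z) ∘c mf2 F (x ⊗c y) z) ∘c (mf2 F x y ⊠c cid (F z))
  ∘c assoc N (F x) (F y) (F z)); first by rewrite !ccomp_assoc.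
rewrite -mf2_nat fmap_id.
transitivity (fmap F l ∘c mf2 F xy z ∘c ((fmap F i_xy ∘c mf2 F x y) ⊠c cid (F z))
  ∘c assoc N (F x) (F y) (F z)); first by rewrite tmap_idr_comp !ccomp_assoc.
rewrite -Es' -Et' tmap_idr_comp.
transitivity (s' ∘c (l'' ∘c (t_xy ⊠c cid (F z))) ∘c (j_xy ⊠c cid (F z))
  ∘c assoc N (F x) (F y) (F z)); first by rewrite !ccomp_assoc.
rewrite -Ee'.
transitivity (s' ∘c e' ∘c (l' ∘c (j_xy ⊠c cid (F z)) ∘c assoc N (F x) (F y) (F z))).
  by rewrite !ccomp_assoc.
by rewrite -Ea' !ccomp_assoc.
Qed.
End FunctorGlue.

(** * The monoidal category on the direct sum *)

(** An object [X] has the homogeneous parts [part X false] and [part X true] in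
    the disjoint union, and the part of degree [l] of [X ⊗c Y] is the biproduct
    of [part X i ⊗ part Y j] over [i (+) j = l]. All equations are checked on
    the inclusions of these summands. *)
Section Dsum.
Variables (S : ribbonCat) (H : hopfAlg S) (a : additiveStr S).
Local Notation H0 := (carrier H).
Implicit Types (X Y Z W : cob (Cdsum H a)) (i j k l m : bool).
Local Notation T := (@tten (Cdsum H a)).
Local Notation dchom := (@chom (Cdsum H a)).
Local Notation kchom := (@chom (Cdisj H)).

Definition part X i : hmod H + ob S := if i then inr X.2 else inl X.1.
Definition pob X i := disj_ob (part X i).

Definition component X Y (f : dchom X Y) i : kchom (part X i) (part Y i) :=
  if i return kchom (part X i) (part Y i) then f.2 else f.1.
Definition carr X Y (f : dchom X Y) i : arr S := if i then sval f.2 else sval f.1.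

Definition cast_component X Y (f : dchom X Y) i i' (e : i = i') : kchom (part X i) (part Y i') :=
  let: erefl := e in component f i.

Lemma cast_componentE X Y (f : dchom X Y) i i' (e : i = i') :
  disj_arr (cast_component f e) = carr f i.
Proof. by case: i' / e; case: i. Qed.

Lemma carr_comp X Y Z (g : dchom Y Z) (f : dchom X Y) i : carr (g ∘c f) i = carr g i ∘ carr f i.
Proof. by case: i. Qed.

Lemma carr_id X i : carr (cid X) i = I (pob X i).
Proof. by case: i. Qed.

Lemma carr_inj X Y (f g : dchom X Y) : (forall i, carr f i = carr g i) -> f = g.
Proof.
case: f g => [f0 f1] [g0 g1] e; congr (_, _); apply: sig_ext; [exact: (e false) | exact: (e true)].
Qed.

Lemma carrP X Y (f : dchom X Y) i : is_disj_hom (part X i) (part Y i) (carr f i).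
Proof. by case: f i => [[f0 p0] [f1 p1]] []. Qed.

Lemma carr_hom X Y (f : dchom X Y) i : carr f i ∈ pob X i ⇒ pob Y i.
Proof. exact: disj_hom_arr (carrP f i). Qed.

Definition to_dsum_hom X Y (f : bool -> arr S)
    (p : forall i, is_disj_hom (part X i) (part Y i) (f i)) : dchom X Y :=
  (exist _ (f false) (p false), exist _ (f true) (p true)).

Lemma carr_to X Y f (p : forall i, is_disj_hom (part X i) (part Y i) (f i)) i :
  carr (to_dsum_hom p) i = f i.
Proof. by case: i. Qed.

Lemma dsum_iso X Y (f : dchom X Y) (h : bool -> arr S) :
  (forall i, h i ∈ pob Y i ⇒ pob X i) ->
  (forall i, h i ∘ carr f i = I (pob X i)) -> (forall i, carr f i ∘ h i = I (pob Y i)) ->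
  @is_iso (Cdsum H a) X Y f.
Proof.
move=> hh e1 e2.
have p i : is_disj_hom (part Y i) (part X i) (h i) := is_disj_hom_inv (carrP f i) (hh i) (e1 i) (e2 i).
exists (to_dsum_hom p); split; apply: carr_inj => i; by rewrite carr_comp carr_to carr_id.
Qed.

(** The inclusion of the tensor product of two homogeneous parts. *)
Definition incl X Y i j : arr S :=
  match i, j with
  | false, false => in1 a (mob X.1 ⊗ mob Y.1) (H0 ⊗ (X.2 ⊗ Y.2))
  | true, true => in2 a (mob X.1 ⊗ mob Y.1) (H0 ⊗ (X.2 ⊗ Y.2))
  | false, true => in1 a (mob X.1 ⊗ Y.2) (X.2 ⊗ mob Y.1)
  | true, false => in2 a (mob X.1 ⊗ Y.2) (X.2 ⊗ mob Y.1)
  end.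

Lemma incl_disj_hom X Y i j :
  is_disj_hom (disj_ten (part X i) (part Y j)) (part (T X Y) (i (+) j)) (incl X Y i j).
Proof.
case: i j => [] [] /=.
- split; [exact: in2_hom | exact/esym/bip_act_in2].
- exact: in2_hom.
- exact: in1_hom.
- split; [exact: in1_hom | exact/esym/bip_act_in1].
Qed.

Lemma carr_map X X' Y Y' (f : dchom X X') (g : dchom Y Y') i j :
  carr (f ⊠c g) (i (+) j) ∘ incl X Y i j
  = incl X' Y' i j ∘ disj_map_arr (part X i) (part Y j) (carr f i) (carr g j).
Proof.
have f0 := carr_hom f false; have f1 := carr_hom f true.
have g0 := carr_hom g false; have g1 := carr_hom g true.
rewrite /pob /= in f0 f1 g0 g1.
case: i j => [] [] /=; rewrite /disj_map_arr /=.
- by rewrite (bsum_in2 a (tarr_hom f0 g0) (tarr_hom (idm_hom H0) (tarr_hom f1 g1))).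
- by rewrite (bsum_in2 a (tarr_hom f0 g1) (tarr_hom f1 g0)).
- by rewrite (bsum_in1 a (tarr_hom f0 g1) (tarr_hom f1 g0)).
- by rewrite (bsum_in1 a (tarr_hom f0 g0) (tarr_hom (idm_hom H0) (tarr_hom f1 g1))).
Qed.

(** The prefix [K] allows to iterate the lemma, and with [K = H] to compare
    actions. *)
Lemma incl_ext K X Y V l f g : f ∈ K ⊗ pob (T X Y) l ⇒ V -> g ∈ K ⊗ pob (T X Y) l ⇒ V ->
  (forall i j, l = i (+) j -> f ∘ (I K ⊠ incl X Y i j) = g ∘ (I K ⊠ incl X Y i j)) -> f = g.
Proof.
move=> hf hg e.
case: l hf hg e => hf hg e; apply: (bip_ext hf hg).
- exact: (e false true). - exact: (e true false).
- exact: (e false false). - exact: (e true true).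
Qed.

(** [disj_ten x (part Y j)] is [prefix x j ⊗ pob Y j] as an object of [S], also
    when both degrees are 1 and the tensor product has the additional factor
    [H]; this is the prefix for the next application of [incl_ext]. *)
Definition prefix (x : hmod H + ob S) j : ob S :=
  if x is inr A then (if j then H0 ⊗ A else A) else disj_ob x.

Lemma prefixE x y j : disj_ob (disj_ten x (part y j)) = prefix x j ⊗ pob y j.
Proof. by case: x j => [M|A] [] //=; rewrite tob_assoc. Qed.

Lemma prefix_map x Y Z j k f :
  disj_map_arr x (disj_ten (part Y j) (part Z k)) (I (disj_ob x)) f = I (prefix x (j (+) k)) ⊠ f.
Proof. by case: x j k => [M|A] [] [] //=; rewrite tarr_assoc tarr_idm. Qed.

(** Inclusions of triple tensor products for the two bracketings. *)
Definition incl3 X Y Z i j k : arr S :=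
  incl X (T Y Z) i (j (+) k)
  ∘ disj_map_arr (part X i) (disj_ten (part Y j) (part Z k)) (I (pob X i)) (incl Y Z j k).

Definition incl3' X Y Z i j k : arr S :=
  incl (T X Y) Z (i (+) j) k
  ∘ disj_map_arr (disj_ten (part X i) (part Y j)) (part Z k) (incl X Y i j) (I (pob Z k)).

Lemma incl_hom X Y i j : incl X Y i j ∈ disj_ob (disj_ten (part X i) (part Y j)) ⇒ pob (T X Y) (i (+) j).
Proof. exact: disj_hom_arr (incl_disj_hom X Y i j). Qed.

Lemma is_disj_hom_comp (x y z : hmod H + ob S) f g :
  is_disj_hom y z g -> is_disj_hom x y f -> is_disj_hom x z (g ∘ f).
Proof.
move=> hg hf; rewrite -(disj_arr_to hf) -(disj_arr_to hg) -disj_arr_comp; exact: disj_arrP.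
Qed.

Lemma incl3_disj_hom X Y Z i j k :
  is_disj_hom (disj_ten (part X i) (disj_ten (part Y j) (part Z k)))
    (part (T X (T Y Z)) (i (+) (j (+) k))) (incl3 X Y Z i j k).
Proof.
apply: is_disj_hom_comp (incl_disj_hom _ _ _ _) _.
exact: is_disj_hom_map (is_disj_hom_id _) (incl_disj_hom _ _ _ _).
Qed.

Lemma incl3'_disj_hom X Y Z i j k :
  is_disj_hom (disj_ten (disj_ten (part X i) (part Y j)) (part Z k))
    (part (T (T X Y) Z) (i (+) j (+) k)) (incl3' X Y Z i j k).
Proof.
apply: is_disj_hom_comp (incl_disj_hom _ _ _ _) _.
exact: is_disj_hom_map (incl_disj_hom _ _ _ _) (is_disj_hom_id _).
Qed.

Lemma incl_ext3 K X Y Z V l f g :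
  f ∈ K ⊗ pob (T X (T Y Z)) l ⇒ V -> g ∈ K ⊗ pob (T X (T Y Z)) l ⇒ V ->
  (forall i j k, l = i (+) (j (+) k) ->
     f ∘ (I K ⊠ incl3 X Y Z i j k) = g ∘ (I K ⊠ incl3 X Y Z i j k)) -> f = g.
Proof.
move=> hf hg e; apply: (incl_ext hf hg) => i n en.
have hi := incl_hom X (T Y Z) i n; rewrite -en prefixE in hi.
apply: (@incl_ext (K ⊗ prefix (part X i) n) Y Z V n).
- by hom.
- by hom.
move=> j k ejk.
have hyz := incl_hom Y Z j k; rewrite -ejk in hyz.
have := e i j k; rewrite -ejk => /(_ en); rewrite /incl3 prefix_map -ejk.
rewrite whiskerl; last by typ.
rewrite tarr_assoc tarr_idm !comp_assoc //; typ.
Qed.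

Lemma incl3_hom X Y Z i j k : incl3 X Y Z i j k
  ∈ disj_ob (disj_ten (part X i) (disj_ten (part Y j) (part Z k))) ⇒ pob (T X (T Y Z)) (i (+) (j (+) k)).
Proof. exact: disj_hom_arr (incl3_disj_hom X Y Z i j k). Qed.

Lemma incl3'_hom X Y Z i j k : incl3' X Y Z i j k
  ∈ disj_ob (disj_ten (disj_ten (part X i) (part Y j)) (part Z k)) ⇒ pob (T (T X Y) Z) (i (+) j (+) k).
Proof. exact: disj_hom_arr (incl3'_disj_hom X Y Z i j k). Qed.

Lemma incl3'_ext X Y Z V l f g : f ∈ pob (T (T X Y) Z) l ⇒ V -> g ∈ pob (T (T X Y) Z) l ⇒ V ->
  (forall i j k, l = i (+) j (+) k -> f ∘ incl3' X Y Z i j k = g ∘ incl3' X Y Z i j k) -> f = g.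
Proof.
move=> hf hg e.
have b A B L := biproduct_whiskerr L (bip_biproduct a A B).
case: l hf hg e => hf hg e.
- apply: (four_ext (bip_biproduct a _ _) (b _ _ _) (b _ _ _) hf hg).
  + exact: (e false false true). + exact: (e true true true).
  + exact: (e false true false). + exact: (e true false false).
- apply: (four_ext (bip_biproduct a _ _) (b _ _ _) (biproduct_whiskerl H0 (b _ _ _)) hf hg).
  + exact: (e false false false). + exact: (e true true false).
  + exact: (e false true true). + exact: (e true false true).
Qed.

(** The universal property that yields the inverse of the associator. *)
Lemma incl3'_case X Y Z V l (t : bool -> bool -> bool -> arr S) :
  (forall i j k, l = i (+) j (+) k ->
     t i j k ∈ disj_ob (disj_ten (disj_ten (part X i) (part Y j)) (part Z k)) ⇒ V) ->
  exists2 f, f ∈ pob (T (T X Y) Z) l ⇒ V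
    & forall i j k, l = i (+) j (+) k -> f ∘ incl3' X Y Z i j k = t i j k.
Proof.
move=> ht; have b A B L := biproduct_whiskerr L (bip_biproduct a A B).
case: l ht => ht.
- have h1 := ht false false true erefl; have h2 := ht true true true erefl.
  have h3 := ht false true false erefl; have h4 := ht true false false erefl.
  eexists; first exact: (four_sum_hom (bip_biproduct a _ _) (b _ _ _) (b _ _ _) h1 h2 h3 h4).
  have [e1 e2 e3 e4] := four_sumE (bip_biproduct a _ _) (b _ _ _) (b _ _ _) h1 h2 h3 h4.
  by case=> [] [] [].
- have h1 := ht false false false erefl; have h2 := ht true true false erefl.
  have h3 := ht false true true erefl; have h4 := ht true false true erefl.
  have hB A B L := biproduct_whiskerl H0 (b A B L).
  eexists; first exact: (four_sum_hom (bip_biproduct a _ _) (b _ _ _) (hB _ _ _) h1 h2 h3 h4).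
  have [e1 e2 e3 e4] := four_sumE (bip_biproduct a _ _) (b _ _ _) (hB _ _ _) h1 h2 h3 h4.
  by case=> [] [] [].
Qed.

Section Structure.
Variables gam del phi gamV delV phiV : arr S.
Hypothesis P : associator_data H gam del phi gamV delV phiV.
Local Notation alpha := (disj_alpha gam del phi).

Definition aarr X Y Z l := if l then dsum_alpha1 gam phi a X Y Z else dsum_alpha0 del a X Y Z.

(** The associator of the direct sum restricts to the associators of the disjoint
    union on the summands. *)
Lemma aarrP X Y Z l : aarr X Y Z l ∈ pob (T X (T Y Z)) l ⇒ pob (T (T X Y) Z) l
  /\ forall i j k, l = i (+) (j (+) k) -> aarr X Y Z l ∘ incl3 X Y Z i j k
       = incl3' X Y Z i j k ∘ alpha (part X i) (part Y j) (part Z k).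
Proof.
have ht i j k : l = i (+) (j (+) k) -> incl3' X Y Z i j k ∘ alpha (part X i) (part Y j) (part Z k)
  ∈ disj_ob (disj_ten (part X i) (disj_ten (part Y j) (part Z k))) ⇒ pob (T (T X Y) Z) l.
  move=> ->; rewrite addbA.
  by have h1 := incl3'_hom X Y Z i j k; have h2 := alpha_hom P (part X i) (part Y j) (part Z k); hom.
have hI i j k : l = i (+) (j (+) k) ->
  disj_ob (disj_ten (disj_ten (part X i) (part Y j)) (part Z k))
    = disj_ob (disj_ten (part X i) (disj_ten (part Y j) (part Z k))) ->
  incl3' X Y Z i j k
  ∈ disj_ob (disj_ten (part X i) (disj_ten (part Y j) (part Z k))) ⇒ pob (T (T X Y) Z) l.
  by move=> -> <-; rewrite addbA; exact: incl3'_hom.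
have b A B L := biproduct_whiskerl L (bip_biproduct a A B).
case: X Y Z l ht hI => [M A] [N B] [Q C] [] ht hI.
- have h1 := hI false false true erefl (esym (tob_assoc _ _ _)); have h2 := ht false true false erefl.
  have h3 := hI true false false erefl (esym (tob_assoc _ _ _)); have h4 := ht true true true erefl.
  have hs := four_sum_hom (bip_biproduct a _ _) (b _ _ _) (b _ _ _) h1 h2 h3 h4.
  have [e1 e2 e3 e4] := four_sumE (bip_biproduct a _ _) (b _ _ _) (b _ _ _) h1 h2 h3 h4.
  split; first exact: hs.
  case=> [] [] [] // _.
  + by apply: etrans e3 _; rewrite (idr_hom h3) //= tob_assoc.
  + by apply: etrans e1 _; rewrite (idr_hom h1) //= tob_assoc.
- have bb A' B' L K := biproduct_whiskerl K (b A' B' L).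
  have h1 := hI false false false erefl (esym (tob_assoc _ _ _)); have h2 := ht false true true erefl.
  have h3 := ht true false true erefl; have h4 := ht true true false erefl.
  have hs := four_sum_hom (bip_biproduct a _ _) (b _ _ _) (bb _ _ _ _) h1 h2 h3 h4.
  have [e1 e2 e3 e4] := four_sumE (bip_biproduct a _ _) (b _ _ _) (bb _ _ _ _) h1 h2 h3 h4.
  split; first exact: hs.
  case=> [] [] [] // _.
  + by apply: etrans e1 _; rewrite (idr_hom h1) //= tob_assoc.
Qed.

Lemma aarr_hom X Y Z l : aarr X Y Z l ∈ pob (T X (T Y Z)) l ⇒ pob (T (T X Y) Z) l.
Proof. by case: (aarrP X Y Z l). Qed.

Lemma aarr_incl3 X Y Z l i j k : l = i (+) (j (+) k) ->
  aarr X Y Z l ∘ incl3 X Y Z i j k = incl3' X Y Z i j k ∘ alpha (part X i) (part Y j) (part Z k).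
Proof. by case: (aarrP X Y Z l) => _; apply. Qed.

(** Being a module map can be tested on summands. *)
Lemma modhom_cancel (M N Q : hmod H) f h : is_modhom M N h -> is_modhom M Q (f ∘ h) ->
  f ∈ mob N ⇒ mob Q ->
  f ∘ act N ∘ (I H0 ⊠ h) = act Q ∘ (I H0 ⊠ f) ∘ (I H0 ⊠ h).
Proof.
move=> [hh eh] [_ efh] hf.
transitivity (f ∘ (act N ∘ (I H0 ⊠ h))); first by diagram.
rewrite -eh; transitivity (f ∘ h ∘ act M); first by diagram.
by rewrite efh; diagram.
Qed.

Lemma aarr_disj_hom X Y Z l :
  is_disj_hom (part (T X (T Y Z)) l) (part (T (T X Y) Z) l) (aarr X Y Z l).
Proof.
have h := aarr_hom X Y Z l; case: l h => h; first exact: h.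
split; first exact: h.
have h1 := act_hom (T X (T Y Z)).1; have h2 := act_hom (T (T X Y) Z).1.
have h0 : aarr X Y Z false ∈ mob (T X (T Y Z)).1 ⇒ mob (T (T X Y) Z).1 := h.
apply: (@incl_ext3 H0 X Y Z (mob (T (T X Y) Z).1) false); [by hom | by hom |].
have b i j k : false = i (+) (j (+) k) -> is_disj_hom
    (disj_ten (part X i) (disj_ten (part Y j) (part Z k)))
    (part (T (T X Y) Z) false) (aarr X Y Z false ∘ incl3 X Y Z i j k).
  move=> e; rewrite (aarr_incl3 _ _ _ e).
  by have := is_disj_hom_comp (incl3'_disj_hom X Y Z i j k) (alpha_disj_hom P _ _ _); rewrite -addbA -e.
case=> [] [] [] // e; apply: modhom_cancel h0.
- exact: (incl3_disj_hom X Y Z true true false). - exact: (b true true false).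
- exact: (incl3_disj_hom X Y Z true false true). - exact: (b true false true).
- exact: (incl3_disj_hom X Y Z false true true). - exact: (b false true true).
- exact: (incl3_disj_hom X Y Z false false false). - exact: (b false false false).
Qed.

Lemma incl3_ext X Y Z V l f g :
  f ∈ pob (T X (T Y Z)) l ⇒ V -> g ∈ pob (T X (T Y Z)) l ⇒ V ->
  (forall i j k, l = i (+) (j (+) k) -> f ∘ incl3 X Y Z i j k = g ∘ incl3 X Y Z i j k) -> f = g.
Proof.
move=> hf hg e; apply: (@incl_ext3 𝟏 X Y Z V l); rewrite ?tob_unitl // => i j k el.
by rewrite tarr_unitl; apply: e.
Qed.

Lemma aarr_inverse X Y Z l : exists2 h, h ∈ pob (T (T X Y) Z) l ⇒ pob (T X (T Y Z)) l &
  h ∘ aarr X Y Z l = I (pob (T X (T Y Z)) l) /\ aarr X Y Z l ∘ h = I (pob (T (T X Y) Z) l).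
Proof.
have [|h hh eh] := @incl3'_case X Y Z (pob (T X (T Y Z)) l) l
  (fun i j k => incl3 X Y Z i j k ∘ alphaV gamV delV phiV (part X i) (part Y j) (part Z k)).
  move=> i j k ->; rewrite -addbA.
  by have h1 := incl3_hom X Y Z i j k; have h2 := alphaV_hom P (part X i) (part Y j) (part Z k); hom.
exists h => //; have ha := aarr_hom X Y Z l.
split.
- apply: (@incl3_ext X Y Z _ l); [by hom | by hom |] => i j k el.
  have h1 := incl3_hom X Y Z i j k; rewrite -el in h1.
  have h2 := incl3'_hom X Y Z i j k; rewrite -addbA -el in h2.
  have h3 := alphaV_hom P (part X i) (part Y j) (part Z k).
  have h4 := alpha_hom P (part X i) (part Y j) (part Z k).
  rewrite -comp_assoc; [|typ|typ].
  rewrite (aarr_incl3 _ _ _ el) comp_assoc; [|typ|typ].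
  rewrite eh; last by rewrite el addbA.
  rewrite -comp_assoc; [|typ|typ].
  by rewrite (alphaVK P) (idr_hom h1) // (idl_hom h1).
- apply: (@incl3'_ext X Y Z _ l); [by hom | by hom |] => i j k el.
  have h1 := incl3_hom X Y Z i j k; rewrite addbA -el in h1.
  have h2 := incl3'_hom X Y Z i j k; rewrite -el in h2.
  have h3 := alphaV_hom P (part X i) (part Y j) (part Z k).
  have h4 := alpha_hom P (part X i) (part Y j) (part Z k).
  rewrite -comp_assoc; [|typ|typ].
  rewrite eh // comp_assoc; [|typ|typ].
  rewrite aarr_incl3 ?addbA // -comp_assoc; [|typ|typ].
  by rewrite (alphaKV P) (idr_hom h2) // (idl_hom h2).
Qed.

Definition dassoc X Y Z : dchom (T X (T Y Z)) (T (T X Y) Z) :=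
  @to_dsum_hom (T X (T Y Z)) (T (T X Y) Z) _ (aarr_disj_hom X Y Z).

Lemma carr_dassoc X Y Z l : carr (dassoc X Y Z) l = aarr X Y Z l.
Proof. exact: carr_to. Qed.

Lemma dassoc_iso X Y Z : is_iso (dassoc X Y Z).
Proof.
have [k0 e0 [p0 q0]] := aarr_inverse X Y Z false; have [k1 e1 [p1 q1]] := aarr_inverse X Y Z true.
by apply: (@dsum_iso _ _ _ (fun l => if l then k1 else k0)) => -[]; rewrite ?carr_dassoc.
Qed.

Variable M : monoidalStr (Cdisj H).
Hypothesis hM : disj_built gam del phi M.

Lemma componentE X Y (f : dchom X Y) i : disj_arr (component f i) = carr f i.
Proof. by case: i. Qed.

(** The inclusions as morphisms of the disjoint union. Degrees are compared up
    to associativity of [(+)] only, hence the casts in [kassoc] and below. *)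
Definition kincl X Y i j : kchom (disj_ten (part X i) (part Y j)) (part (T X Y) (i (+) j)) :=
  to_disj_hom (incl_disj_hom X Y i j).

Lemma kinclE X Y i j : disj_arr (kincl X Y i j) = incl X Y i j.
Proof. exact: disj_arr_to. Qed.

Definition kassoc X Y Z i j k :
    kchom (part (T X (T Y Z)) (i (+) (j (+) k))) (part (T (T X Y) Z) (i (+) j (+) k)) :=
  cast_component (dassoc X Y Z) (addbA i j k).

Lemma kassocE X Y Z i j k : disj_arr (kassoc X Y Z i j k) = aarr X Y Z (i (+) (j (+) k)).
Proof. by rewrite /kassoc cast_componentE carr_dassoc. Qed.

Lemma kcompE (x y z : cob (Cdisj H)) (g : kchom y z) (f : kchom x y) :
  disj_arr (g ∘c f) = disj_arr g ∘ disj_arr f.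
Proof. exact: disj_arr_comp. Qed.

Lemma kmapE (x x' y y' : cob (Cdisj H)) (f : kchom x x') (g : kchom y y') :
  disj_arr (f ⊠c g) = disj_map_arr x y (disj_arr f) (disj_arr g).
Proof. exact: disj_arr_map. Qed.

Lemma kidE (x : cob (Cdisj H)) : disj_arr (cid x) = I (disj_ob x).
Proof. exact: disj_arr_id. Qed.

Lemma kincl3E X Y Z i j k :
  disj_arr (kincl X (T Y Z) i (j (+) k) ∘c (cid (part X i : cob (Cdisj H)) ⊠c kincl Y Z j k))
  = incl3 X Y Z i j k.
Proof. by rewrite kcompE kmapE kidE !kinclE. Qed.

Lemma kassoc_incl X Y Z i j k :
  kassoc X Y Z i j k
    ∘c (kincl X (T Y Z) i (j (+) k) ∘c (cid (part X i : cob (Cdisj H)) ⊠c kincl Y Z j k))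
  = kincl (T X Y) Z (i (+) j) k ∘c (kincl X Y i j ⊠c cid (part Z k : cob (Cdisj H)))
    ∘c assoc M (part X i) (part Y j) (part Z k).
Proof.
apply: disj_arr_inj; case: hM => hA _ _.
rewrite kcompE kassocE kincl3E (aarr_incl3 _ _ _ erefl).
by rewrite 2!kcompE kmapE kidE !kinclE hA.
Qed.

Lemma kincl_map X X' Y Y' (f : dchom X X') (g : dchom Y Y') i j :
  component (f ⊠c g) (i (+) j) ∘c kincl X Y i j
  = kincl X' Y' i j ∘c (component f i ⊠c component g j).
Proof.
apply: disj_arr_inj; rewrite 2!kcompE kmapE !componentE !kinclE.
exact: carr_map.
Qed.

Lemma dassoc_nat X X' Y Y' Z Z' (f : dchom X X') (g : dchom Y Y') (h : dchom Z Z') :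
  dassoc X' Y' Z' ∘c (f ⊠c (g ⊠c h)) = (f ⊠c g ⊠c h) ∘c dassoc X Y Z.
Proof.
apply: carr_inj => l; rewrite 2!carr_comp !carr_dassoc.
have h1 := aarr_hom X Y Z l; have h2 := aarr_hom X' Y' Z' l.
have h3 := carr_hom (f ⊠c (g ⊠c h)) l; have h4 := carr_hom (f ⊠c g ⊠c h) l.
apply: (@incl3_ext X Y Z (pob (T (T X' Y') Z') l) l); [by hom | by hom |] => i j k el.
have := natural_glue (kassoc_incl X Y Z i j k) (kassoc_incl X' Y' Z' i j k)
  (kincl_map g h j k) (kincl_map f g i j) (kincl_map f (g ⊠c h) i (j (+) k))
  (kincl_map (f ⊠c g) h (i (+) j) k).
move/(congr1 (@disj_arr _ _ _ _)); rewrite !kcompE kmapE kidE !kinclE !kassocE !componentE.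
by rewrite -/(incl3 X Y Z i j k) -addbA -el.
Qed.

Definition incl4 X Y Z W i j k m := incl X (T Y (T Z W)) i (j (+) (k (+) m))
  ∘ disj_map_arr (part X i) (disj_ten (part Y j) (disj_ten (part Z k) (part W m)))
     (I (pob X i)) (incl3 Y Z W j k m).

Lemma incl4_ext X Y Z W V l f g :
  f ∈ pob (T X (T Y (T Z W))) l ⇒ V -> g ∈ pob (T X (T Y (T Z W))) l ⇒ V ->
  (forall i j k m, l = i (+) (j (+) (k (+) m)) ->
     f ∘ incl4 X Y Z W i j k m = g ∘ incl4 X Y Z W i j k m) -> f = g.
Proof.
move=> hf hg e; apply: (@incl_ext 𝟏 X (T Y (T Z W)) V l); rewrite ?tob_unitl // => i n en.
rewrite tarr_unitl.
have hi := incl_hom X (T Y (T Z W)) i n; rewrite -en prefixE in hi.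
apply: (@incl_ext3 (prefix (part X i) n) Y Z W V n); [by hom | by hom |].
move=> j k m ejk.
have hyz := incl3_hom Y Z W j k m; rewrite -ejk in hyz.
have := e i j k m; rewrite -ejk => /(_ en); rewrite /incl4 -ejk.
have -> : disj_map_arr (part X i) (disj_ten (part Y j) (disj_ten (part Z k) (part W m)))
    (I (pob X i)) (incl3 Y Z W j k m) = I (prefix (part X i) n) ⊠ incl3 Y Z W j k m.
  by rewrite ejk; case: i {e en hi} => /=; case: j k m {ejk hyz} => [] [] [] //=;
    rewrite tarr_assoc tarr_idm.
by rewrite !comp_assoc //; typ.
Qed.

Lemma dassoc_pentagon X Y Z W :
  dassoc (T X Y) Z W ∘c dassoc X Y (T Z W)
  = (dassoc X Y Z ⊠c cid W) ∘c dassoc X (T Y Z) W ∘c (cid X ⊠c dassoc Y Z W).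
Proof.
apply: carr_inj => l; rewrite 3!carr_comp !carr_dassoc.
have h1 := aarr_hom (T X Y) Z W l; have h2 := aarr_hom X Y (T Z W) l.
have h3 := aarr_hom X (T Y Z) W l; have h4 := carr_hom (dassoc X Y Z ⊠c cid W) l.
have h5 := carr_hom (cid X ⊠c dassoc Y Z W) l.
apply: (@incl4_ext X Y Z W (pob (T (T (T X Y) Z) W) l) l); [by hom | by hom |] => i j k m el.
have F1 : cast_component (cid X ⊠c dassoc Y Z W) (congr1 (addb i) (addbA j k m))
     ∘c kincl X (T Y (T Z W)) i (j (+) (k (+) m))
   = kincl X (T (T Y Z) W) i (j (+) k (+) m)
     ∘c (cid (part X i : cob (Cdisj H)) ⊠c kassoc Y Z W j k m).
  apply: disj_arr_inj; rewrite 2!kcompE kmapE kidE cast_componentE kassocE !kinclE -(addbA j k m).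
  by rewrite carr_map carr_id carr_dassoc.
have F3 : cast_component (dassoc X Y Z ⊠c cid W) (congr1 (addb^~ m) (addbA i j k) : i (+) (j (+) k) (+) m = i (+) j (+) k (+) m)
     ∘c kincl (T X (T Y Z)) W (i (+) (j (+) k)) m
   = kincl (T (T X Y) Z) W (i (+) j (+) k) m
     ∘c (kassoc X Y Z i j k ⊠c cid (part W m : cob (Cdisj H))).
  apply: disj_arr_inj; rewrite 2!kcompE kmapE kidE cast_componentE kassocE !kinclE -(addbA i j k).
  by rewrite carr_map carr_id carr_dassoc.
have := pentagon_glue (kassoc_incl X Y Z i j k) (kassoc_incl Y Z W j k m)
  (kassoc_incl X Y (T Z W) i j (k (+) m)) (kassoc_incl (T X Y) Z W (i (+) j) k m)
  F1 (kassoc_incl X (T Y Z) W i (j (+) k) m) F3.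
move/(congr1 (@disj_arr _ _ _ _)); rewrite !kcompE !kmapE !kidE !kcompE !kmapE !kidE.
rewrite !kinclE !kassocE !cast_componentE.
by rewrite -/(incl3 Y Z W j k m) -/(incl4 X Y Z W i j k m) -!addbA -el.
Qed.

Local Notation one := (@tone (Cdsum H a)).

(** The part of degree 1 of the unit object is a zero object, so summands that
    involve it do not contribute. *)
Lemma null_ext A V f g : I A = zero a A A -> f ∈ A ⇒ V -> g ∈ A ⇒ V -> f = g.
Proof.
move=> e hf hg; rewrite -(idr_hom hf erefl) -(idr_hom hg erefl) e.
by rewrite (comp_zeror a _ hf) (comp_zeror a _ hg).
Qed.

Lemma null_tensor K L : I (K ⊗ zob a ⊗ L) = zero a (K ⊗ zob a ⊗ L) (K ⊗ zob a ⊗ L).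
Proof. by rewrite -!tarr_idm idm_zob tarr_zeror tarr_zerol. Qed.

Lemma null_ten (x : hmod H + ob S) : I (disj_ob (disj_ten (inr (zob a)) x))
  = zero a (disj_ob (disj_ten (inr (zob a)) x)) (disj_ob (disj_ten (inr (zob a)) x)).
Proof.
case: x => [N|B] /=; last by rewrite tob_assoc; apply: null_tensor.
by have := null_tensor 𝟏 (mob N); rewrite tob_unitl.
Qed.

Lemma null_ten' (x y : hmod H + ob S) : I (disj_ob (disj_ten x (disj_ten (inr (zob a)) y)))
  = zero a (disj_ob (disj_ten x (disj_ten (inr (zob a)) y)))
      (disj_ob (disj_ten x (disj_ten (inr (zob a)) y))).
Proof.
case: x y => [N|B] [Q|C] /=; rewrite ?tob_assoc; apply: null_tensor.
Qed.

Lemma null_ten_r (x : hmod H + ob S) : I (disj_ob (disj_ten x (inr (zob a))))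
  = zero a (disj_ob (disj_ten x (inr (zob a)))) (disj_ob (disj_ten x (inr (zob a)))).
Proof.
by case: x => [N|B] /=; rewrite ?tob_assoc -[X in I X]tob_unitr null_tensor tob_unitr.
Qed.

Lemma incl_ext0 X Y V l f g : f ∈ pob (T X Y) l ⇒ V -> g ∈ pob (T X Y) l ⇒ V ->
  (forall i j, l = i (+) j -> f ∘ incl X Y i j = g ∘ incl X Y i j) -> f = g.
Proof.
move=> hf hg e; apply: (@incl_ext 𝟏 X Y V l); rewrite ?tob_unitl // => i j el.
by rewrite tarr_unitl; apply: e.
Qed.

Lemma unitl_ext X V l f g : f ∈ pob (T one X) l ⇒ V -> g ∈ pob (T one X) l ⇒ V ->
  f ∘ incl one X false l = g ∘ incl one X false l -> f = g.
Proof.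
move=> hf hg e; apply: (incl_ext0 hf hg) => -[] j el; last by rewrite -[j]el.
have hi := incl_hom one X true j; rewrite -el in hi.
by apply: null_ext (null_ten (part X j)) _ _; hom.
Qed.

Lemma unitr_ext X V l f g : f ∈ pob (T X one) l ⇒ V -> g ∈ pob (T X one) l ⇒ V ->
  f ∘ incl X one l false = g ∘ incl X one l false -> f = g.
Proof.
move=> hf hg e; apply: (incl_ext0 hf hg) => i [] el; last by move: el e; rewrite addbF => ->.
have hi := incl_hom X one i true; rewrite -el in hi.
by apply: null_ext (null_ten_r (part X i)) _ _; hom.
Qed.

Definition larr X l : arr S :=
  if l then pr1 a (𝟏 ⊗ X.2) (zob a ⊗ mob X.1) else pr1 a (𝟏 ⊗ mob X.1) (H0 ⊗ (zob a ⊗ X.2)).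
Definition rarr X l : arr S :=
  if l then pr2 a (mob X.1 ⊗ zob a) (X.2 ⊗ 𝟏) else pr1 a (mob X.1 ⊗ 𝟏) (H0 ⊗ (X.2 ⊗ zob a)).

Lemma larr_hom X l : larr X l ∈ pob (T one X) l ⇒ pob X l.
Proof. by case: l; apply: hom_eq (pr1_hom a _ _) _ _ => //; rewrite /pob /= tob_unitl. Qed.

Lemma rarr_hom X l : rarr X l ∈ pob (T X one) l ⇒ pob X l.
Proof.
case: l; first by apply: hom_eq (pr2_hom a _ _) _ _ => //; rewrite /pob /= tob_unitr.
by apply: hom_eq (pr1_hom a _ _) _ _ => //; rewrite /pob /= tob_unitr.
Qed.

Lemma larr_incl X l : larr X l ∘ incl one X false l = I (pob X l).
Proof. by case: l; rewrite /= pr1_in1 tob_unitl. Qed.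

Lemma rarr_incl X l : rarr X l ∘ incl X one l false = I (pob X l).
Proof. by case: l; rewrite /= ?pr1_in1 ?pr2_in2 tob_unitr. Qed.

Lemma incl_unitl_hom X l : incl one X false l ∈ pob X l ⇒ pob (T one X) l.
Proof. by have := incl_hom one X false l; rewrite disj_unitl. Qed.

Lemma incl_unitr_hom X l : incl X one l false ∈ pob X l ⇒ pob (T X one) l.
Proof. by have := incl_hom X one l false; rewrite disj_unitr addbF. Qed.

Lemma larrK X l : incl one X false l ∘ larr X l = I (pob (T one X) l).
Proof.
have h1 := incl_unitl_hom X l; have h2 := larr_hom X l.
apply: (@unitl_ext X (pob (T one X) l)); [by hom | by hom |].
by rewrite -comp_assoc ?larr_incl ?(idr_hom h1) ?(idl_hom h1) //; typ.
Qed.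

Lemma rarrK X l : incl X one l false ∘ rarr X l = I (pob (T X one) l).
Proof.
have h1 := incl_unitr_hom X l; have h2 := rarr_hom X l.
apply: (@unitr_ext X (pob (T X one) l)); [by hom | by hom |].
by rewrite -comp_assoc ?rarr_incl ?(idr_hom h1) ?(idl_hom h1) //; typ.
Qed.

(** The projection to a summand whose complement is zero is inverse to the
    inclusion, hence a module map because the inclusion is one. *)
Lemma larr_disj_hom X l : is_disj_hom (part (T one X) l) (part X l) (larr X l).
Proof.
have hI : is_disj_hom (part X l) (disj_ten (part one false) (part X l)) (I (pob X l)).
  apply: (is_disj_hom_inv (disj_lunit_hom (part X l))).
  - by rewrite disj_unitl; hom.
  - by rewrite disj_unitl; compid.
  - by compid.
have h := is_disj_hom_comp (incl_disj_hom one X false l) hI.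
rewrite (idr_hom (incl_unitl_hom X l)) // in h.
exact: is_disj_hom_inv h (larr_hom X l) (larr_incl X l) (larrK X l).
Qed.

Lemma rarr_disj_hom X l : is_disj_hom (part (T X one) l) (part X l) (rarr X l).
Proof.
have hI : is_disj_hom (part X l) (disj_ten (part X l) (part one false)) (I (pob X l)).
  apply: (is_disj_hom_inv (disj_runit_hom (part X l))).
  - by rewrite disj_unitr; hom.
  - by rewrite disj_unitr; compid.
  - by compid.
have h := is_disj_hom_comp (incl_disj_hom X one l false) hI.
rewrite (idr_hom (incl_unitr_hom X l)) // addbF in h.
exact: is_disj_hom_inv h (rarr_hom X l) (rarr_incl X l) (rarrK X l).
Qed.

Definition dlunit X : dchom (T one X) X := @to_dsum_hom (T one X) X _ (larr_disj_hom X).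
Definition drunit X : dchom (T X one) X := @to_dsum_hom (T X one) X _ (rarr_disj_hom X).

Lemma carr_dlunit X l : carr (dlunit X) l = larr X l. Proof. exact: carr_to. Qed.

Lemma carr_drunit X l : carr (drunit X) l = rarr X l. Proof. exact: carr_to. Qed.

Lemma dlunit_iso X : is_iso (dlunit X).
Proof.
apply: (@dsum_iso _ _ _ (incl one X false)) => l; rewrite ?carr_dlunit.
- exact: incl_unitl_hom. - exact: larrK. - exact: larr_incl.
Qed.

Lemma drunit_iso X : is_iso (drunit X).
Proof.
apply: (@dsum_iso _ _ _ (fun l => incl X one l false)) => l; rewrite ?carr_drunit.
- exact: incl_unitr_hom. - exact: rarrK. - exact: rarr_incl.
Qed.

Lemma dlunit_nat X Y (f : dchom X Y) : dlunit Y ∘c (cid one ⊠c f) = f ∘c dlunit X.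
Proof.
apply: carr_inj => l; rewrite 2!carr_comp !carr_dlunit.
have h1 := larr_hom X l; have h2 := larr_hom Y l; have h3 := carr_hom (cid one ⊠c f) l.
have h4 := carr_hom f l; have h5 := incl_unitl_hom X l; have h6 := incl_unitl_hom Y l.
apply: (@unitl_ext X (pob Y l)); [by hom | by hom |].
rewrite -comp_assoc; [|typ|typ].
rewrite [carr _ l ∘ _](carr_map (cid one) f false l) carr_id.
have -> : disj_map_arr (part one false) (part X l) (I (pob one false)) (carr f l) = carr f l.
  by case: l {h1 h2 h3 h4 h5 h6}; rewrite /disj_map_arr /= tarr_unitl.
rewrite comp_assoc; [|typ|typ].
rewrite larr_incl -comp_assoc; [|typ|typ].
by rewrite larr_incl (idl_hom h4) // (idr_hom h4).
Qed.

Lemma drunit_nat X Y (f : dchom X Y) : drunit Y ∘c (f ⊠c cid one) = f ∘c drunit X.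
Proof.
apply: carr_inj => l; rewrite 2!carr_comp !carr_drunit.
have h1 := rarr_hom X l; have h2 := rarr_hom Y l; have h3 := carr_hom (f ⊠c cid one) l.
have h4 := carr_hom f l; have h5 := incl_unitr_hom X l; have h6 := incl_unitr_hom Y l.
apply: (@unitr_ext X (pob Y l)); [by hom | by hom |].
rewrite -comp_assoc; [|typ|typ].
have := carr_map f (cid one) l false; rewrite addbF => ->; rewrite carr_id.
have -> : disj_map_arr (part X l) (part one false) (carr f l) (I (pob one false)) = carr f l.
  by case: l {h1 h2 h3 h4 h5 h6}; rewrite /disj_map_arr /= tarr_unitr.
rewrite comp_assoc; [|typ|typ].
rewrite rarr_incl -comp_assoc; [|typ|typ].
by rewrite rarr_incl (idl_hom h4) // (idr_hom h4).
Qed.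

Lemma dassoc_triangle X Y : (drunit X ⊠c cid Y) ∘c dassoc X one Y = cid X ⊠c dlunit Y.
Proof.
apply: carr_inj => l; rewrite carr_comp carr_dassoc.
have h1 := aarr_hom X one Y l; have h2 := carr_hom (drunit X ⊠c cid Y) l.
have h3 := carr_hom (cid X ⊠c dlunit Y) l.
apply: (@incl3_ext X one Y (pob (T X Y) l)); [by hom | by hom |] => i j k el.
have h4 := incl3_hom X one Y i j k; rewrite -el in h4.
case: j el h4 => el h4; first by apply: null_ext (null_ten' (part X i) (part Y k)) _ _; hom.
have E1 : cast_component (drunit X) (addbF i) ∘c kincl X one i false = runit M (part X i).
  apply: disj_arr_inj; case: hM => _ _ ->.
  by rewrite kcompE cast_componentE kinclE addbF carr_drunit rarr_incl.
have E2 : component (dlunit Y) k ∘c kincl one Y false k = lunit M (part Y k).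
  apply: disj_arr_inj; case: hM => _ -> _.
  by rewrite kcompE componentE kinclE carr_dlunit larr_incl.
have E3 : cast_component (drunit X ⊠c cid Y) (congr1 (addb^~ k) (addbF i)
     : i (+) false (+) k = i (+) k) ∘c kincl (T X one) Y (i (+) false) k
   = kincl X Y i k
     ∘c (cast_component (drunit X) (addbF i) ⊠c cid (part Y k : cob (Cdisj H))).
  apply: disj_arr_inj; rewrite 2!kcompE kmapE kidE !cast_componentE !kinclE.
  by rewrite carr_map carr_id addbF.
have E4 : component (cid X ⊠c dlunit Y) (i (+) k) ∘c kincl X (T one Y) i k
   = kincl X Y i k ∘c (cid (part X i : cob (Cdisj H)) ⊠c component (dlunit Y) k).
  apply: disj_arr_inj; rewrite 2!kcompE kmapE kidE !componentE !kinclE.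
  by rewrite carr_map carr_id.
have := triangle_glue (kassoc_incl X one Y i false k) E1 E2 E3 E4.
move/(congr1 (@disj_arr _ _ _ _)); rewrite !kcompE kmapE kidE !kinclE kassocE.
rewrite cast_componentE componentE [disj_arr (kincl one Y false k)](kinclE one Y false k).
rewrite -/(incl3 X one Y i false k).
by move: el; rewrite addFb addbF => ->.
Qed.
End Structure.

Lemma dsum_monoidal gam del phi gamV delV phiV :
  associator_data H gam del phi gamV delV phiV ->
  exists M : monoidalStr (Cdsum H a), dsum_built gam del phi M.
Proof.
move=> P; have [M hM] := disj_monoidal P.
exists (@MonoidalStr (Cdsum H a) (dassoc P) dlunit drunit (dassoc_iso P) dlunit_iso drunit_iso
  (dassoc_nat P hM) dlunit_nat drunit_nat (dassoc_pentagon P hM) (dassoc_triangle P hM)).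
by split=> [X Y Z|X|X]; split.
Qed.
End Dsum.

(** * Transport along a Hopf algebra isomorphism *)

Section Duals.
Variable S : ribbonCat.
Implicit Types (A B C : ob S) (f g : arr S).

Lemma dualarr_idm A : dualarr (I A) = I A^∨.
Proof. rewrite (dualarrE (idm_hom A)); diagram (zigzag_dual (r:=S) A). Qed.

Lemma dualarr_comp A B C f g : f ∈ A ⇒ B -> g ∈ B ⇒ C ->
  dualarr (g ∘ f) = dualarr f ∘ dualarr g.
Proof.
move=> hf hg; have hgf : g ∘ f ∈ A ⇒ C by hom.
rewrite (dualarrE hf) (dualarrE hg) (dualarrE hgf).
diagram (zigzag_dual (r:=S) B, zigzag (r:=S) B).
Qed.

Lemma ev_dualarr A B f : f ∈ A ⇒ B -> ev A ∘ (dualarr f ⊠ I A) = ev B ∘ (I B^∨ ⊠ f).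
Proof. by move=> hf; rewrite (dualarrE hf); diagram (zigzag (r:=S) A). Qed.

Lemma coev_dualarr A B f : f ∈ A ⇒ B -> (I B ⊠ dualarr f) ∘ coev B = (f ⊠ I A^∨) ∘ coev A.
Proof. by move=> hf; rewrite (dualarrE hf); diagram (zigzag (r:=S) B). Qed.

Lemma twV_nat A B f : f ∈ A ⇒ B -> f ∘ twV A = twV B ∘ f.
Proof.
move=> hf; have [_ h1 k1 _] := tw_inverse A; have [_ h2 _ k2] := tw_inverse B.
have [hw hV hk hk'] := tw_inverse B.
have n : tw B ∘ f = f ∘ tw A by have := tw_nat f; case: hf => -> ->.
transitivity ((twV B ∘ tw B) ∘ f ∘ twV A); first by rewrite hk; diagram.
transitivity (twV B ∘ (tw B ∘ f) ∘ twV A); first by diagram.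
by rewrite n; diagram (twVK A).
Qed.

(** [piv] comes from the braiding and the twist, which are natural, and from the
    duality, which turns an arrow into its dual. *)
Lemma piv_nat A B f : f ∈ A ⇒ B -> dualarr (dualarr f) ∘ piv A = piv B ∘ f.
Proof.
move=> hf; have hD := dualarr_hom hf; rewrite (dualarrE hD).
have e := ev_dualarr hf; move: (dualarr f) hD e => D hD e.
have n : tw B ∘ f = f ∘ tw A by have := tw_nat f; case: hf => -> ->.
rewrite /piv.
transitivity (((ev A ∘ (D ⊠ I A) ∘ br A B^∨ ∘ (tw A ⊠ I B^∨)) ⊠ I B^∨^∨) ∘ (I A ⊠ coev B^∨)).
  diagram (zigzag (r:=S) A^∨, zigzag_dual (r:=S) A^∨).
rewrite e.
transitivity (((ev B ∘ br B B^∨ ∘ ((f ∘ tw A) ⊠ I B^∨)) ⊠ I B^∨^∨) ∘ (I A ⊠ coev B^∨)).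
  by diagram.
by rewrite -n; diagram.
Qed.
End Duals.

Section HopfMaps.
Variable S : ribbonCat.
Implicit Types K H : hopfAlg S.

Definition hopf_typed (L : hopfData S) : Prop :=
  [/\ mu L ∈ carrier L ⊗ carrier L ⇒ carrier L, eta L ∈ 𝟏 ⇒ carrier L,
      Delta L ∈ carrier L ⇒ carrier L ⊗ carrier L, eps L ∈ carrier L ⇒ 𝟏
    & antip L ∈ carrier L ⇒ carrier L].

Lemma dual_ops_hom H : hopf_typed (dualHopf H).
Proof.
have h1 := dualarr_hom (eps_hom H); have h2 := dualarr_hom (eta_hom H).
have h3 := dualarr_hom (antip_hom H).
by split; rewrite /=; hom.
Qed.

Lemma dual_hopf_morphism K H f : hopf_morphism K H f ->
  hopf_morphism (dualHopf H) (dualHopf K) (dualarr f).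
Proof.
move=> [hf [fm fe fD fs fS]]; have hd := dualarr_hom hf.
split; first exact: hd.
have ed := ev_dualarr hf; have cd := coev_dualarr hf.
have h1 := dualarr_hom (eps_hom H); have h2 := dualarr_hom (eps_hom K).
have h3 := dualarr_hom (eta_hom H); have h4 := dualarr_hom (eta_hom K).
split; rewrite /=.
- transitivity (((ev (carrier H) ∘ (I (carrier H)^∨ ⊠ ev (carrier H) ⊠ I (carrier H))
     ∘ (I ((carrier H)^∨ ⊗ (carrier H)^∨) ⊠ (Delta H ∘ f))) ⊠ I (carrier K)^∨)
     ∘ (I ((carrier H)^∨ ⊗ (carrier H)^∨) ⊠ coev (carrier K))).
    transitivity (((ev (carrier H) ∘ (I (carrier H)^∨ ⊠ ev (carrier H) ⊠ I (carrier H))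
     ∘ (I ((carrier H)^∨ ⊗ (carrier H)^∨) ⊠ Delta H)) ⊠ I (carrier K)^∨)
     ∘ (I ((carrier H)^∨ ⊗ (carrier H)^∨) ⊠ ((I (carrier H) ⊠ dualarr f) ∘ coev (carrier H)))).
      by diagram.
    by rewrite cd; diagram.
  rewrite fD; diagram ed.
- by rewrite -fs (dualarr_comp hf (eps_hom H)); diagram.
- transitivity (((ev (carrier H) ∘ (I (carrier H)^∨ ⊠ (f ∘ mu K))) ⊠ I ((carrier K)^∨ ⊗ (carrier K)^∨))
     ∘ (I (carrier H)^∨ ⊠ ((I (carrier K) ⊠ coev (carrier K) ⊠ I (carrier K)^∨) ∘ coev (carrier K)))).
    transitivity (((ev (carrier K) ∘ (dualarr f ⊠ I (carrier K)) ∘ (I (carrier H)^∨ ⊠ mu K))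
       ⊠ I ((carrier K)^∨ ⊗ (carrier K)^∨))
     ∘ (I (carrier H)^∨ ⊠ ((I (carrier K) ⊠ coev (carrier K) ⊠ I (carrier K)^∨) ∘ coev (carrier K)))).
      by diagram.
    by rewrite ed; diagram.
  rewrite fm; diagram cd.
- by rewrite -fe (dualarr_comp (eta_hom K) hf); diagram.
- by rewrite -(dualarr_comp hf (antip_hom H)) -(dualarr_comp (antip_hom K) hf) fS.
Qed.

(** Typing is a hypothesis because the dual Hopf algebra is given by its data
    only. *)
Lemma comp_hopf_morphism (K L N : hopfData S) f g :
  hopf_typed K -> hopf_typed L -> hopf_typed N ->
  hopf_morphism L N g -> hopf_morphism K L f -> hopf_morphism K N (g ∘ f).
Proof.
move=> [k1 k2 k3 k4 k5] [l1 l2 l3 l4 l5] [n1 n2 n3 n4 n5].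
move=> [hg [gm ge gD gs gS]] [hf [fm fe fD fs fS]]; split; first by hom.
split.
- transitivity (g ∘ (f ∘ mu K)); first by diagram.
  rewrite fm; transitivity ((g ∘ mu L) ∘ (f ⊠ f)); first by diagram.
  by rewrite gm; diagram.
- by rewrite -comp_assoc ?fe //; typ.
- rewrite comp_assoc; [|typ|typ].
  rewrite gD -comp_assoc; [|typ|typ].
  by rewrite fD; diagram.
- by rewrite comp_assoc ?gs //; typ.
- rewrite comp_assoc; [|typ|typ].
  rewrite gS -comp_assoc; [|typ|typ].
  by rewrite fS; diagram.
Qed.

Lemma inv_hopf_morphism K H f h : hopf_morphism K H f ->
  inverse_arrows (carrier K) (carrier H) f h -> hopf_morphism H K h.
Proof.
move=> [hf [fm fe fD fs fS]] [_ hh hK fK]; split; first exact: hh.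
split.
- transitivity (h ∘ (mu H ∘ (f ⊠ f)) ∘ (h ⊠ h)); first by diagram fK.
  by rewrite -fm; diagram hK.
- by rewrite -fe; diagram hK.
- transitivity ((h ⊠ h) ∘ ((f ⊠ f) ∘ Delta K) ∘ h); first by diagram hK.
  by rewrite -fD; diagram fK.
- by rewrite -fs; diagram fK.
- transitivity (h ∘ (f ∘ antip K) ∘ h); first by diagram hK.
  by rewrite -fS; diagram fK.
Qed.
End HopfMaps.

Section Transport.
Variables (S : ribbonCat) (K H : hopfAlg S) (f h : arr S).
Hypothesis Mf : hopf_morphism K H f.
Hypothesis inv : inverse_arrows (carrier K) (carrier H) f h.
Local Notation K0 := (carrier K).
Local Notation H0 := (carrier H).

Lemma transport_f_hom : f ∈ K0 ⇒ H0. Proof. by case: inv. Qed.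

Lemma transport_h_hom : h ∈ H0 ⇒ K0. Proof. by case: inv. Qed.

Lemma transport_hK : h ∘ f = I K0. Proof. by case: inv. Qed.

Lemma transport_fK : f ∘ h = I H0. Proof. by case: inv. Qed.
Hint Resolve transport_f_hom transport_h_hom : hom.

Variables (Gamma lam g gV : arr S).
Hypothesis (a : condition_a H Gamma) (b : condition_b H Gamma lam g).
Hypothesis (hgV : mult_inverse H g gV) (c : condition_c H Gamma g gV).
Local Notation Gamma' := (h ∘ Gamma ∘ dualarr h).
Local Notation lam' := (lam ∘ f).
Let hG := Gamma_hom a.
Let hg := g_hom b.
Let hlam := lam_hom b.
Hint Resolve hG hg hlam : hom.

(** The transported isomorphism is the one whose copairing is the image of the
    given copairing, so that [γ], [δ], [φ] are transported as well. *)
Lemma copair_transport : copair K Gamma' = (h ⊠ h) ∘ copair H Gamma.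
Proof.
rewrite /copair; have hd := dualarr_hom transport_h_hom.
transitivity ((I K0 ⊠ (h ∘ Gamma)) ∘ ((I K0 ⊠ dualarr h) ∘ coev K0)); first by diagram.
by rewrite (coev_dualarr transport_h_hom); diagram.
Qed.

Lemma hopf_ops_hom (L : hopfAlg S) :
  hopf_typed L.
Proof. by split; hom. Qed.

Lemma condition_a_transport : condition_a K Gamma'.
Proof.
have Mh := inv_hopf_morphism Mf inv.
have [MG [GV [_ hGV VK KV]]] := a.
split.
  apply: comp_hopf_morphism (dual_ops_hom K) (dual_ops_hom H) (hopf_ops_hom K) _ _.
    exact: comp_hopf_morphism (dual_ops_hom H) (hopf_ops_hom H) (hopf_ops_hom K) Mh MG.
  exact: dual_hopf_morphism Mh.
have hd := dualarr_hom transport_h_hom; have hd' := dualarr_hom transport_f_hom.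
have e1 : dualarr f ∘ dualarr h = I K0^∨.
  by rewrite -(dualarr_comp transport_f_hom transport_h_hom) transport_hK dualarr_idm.
have e2 : dualarr h ∘ dualarr f = I H0^∨.
  by rewrite -(dualarr_comp transport_h_hom transport_f_hom) transport_fK dualarr_idm.
have hGV0 : GV ∈ H0 ⇒ H0^∨ by exact: hGV.
have VK0 : GV ∘ Gamma = I H0^∨ := VK.
exists (dualarr f ∘ GV ∘ f); split=> /=; try by hom.
- by diagram (transport_fK, VK0, e1).
- by diagram (e2, KV, transport_hK).
Qed.

Let fK := transport_fK.
Let hK := transport_hK.

Lemma condition_b_transport : condition_b K Gamma' lam' (h ∘ g).
Proof.
have [[_ lr] [_ lg] ll] := b; have [_ [fm fe fD fs fS]] := Mf.
split; [split; first by hom | split; first by hom |].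
- transitivity (((lam ⊠ h) ∘ ((f ⊠ f) ∘ Delta K))); first by diagram hK.
  rewrite -fD; transitivity (h ∘ ((lam ⊠ I H0) ∘ Delta H) ∘ f); first by diagram.
  by rewrite lr -fe; diagram hK.
- transitivity (((h ⊠ lam) ∘ ((f ⊠ f) ∘ Delta K))); first by diagram hK.
  rewrite -fD; transitivity (h ∘ ((I H0 ⊠ lam) ∘ Delta H) ∘ f); first by diagram.
  by rewrite lg; diagram.
- rewrite copair_transport -ll; have hC := copair_homG a.
  by diagram fK.
Qed.

Lemma mult_inverse_transport : mult_inverse K (h ∘ g) (h ∘ gV).
Proof.
have [hgV' e1 e2] := hgV; have [_ [hm he _ _ _]] := inv_hopf_morphism Mf inv.
split; first by hom.
- transitivity (mu K ∘ (h ⊠ h) ∘ (g ⊠ gV)); first by diagram.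
  by rewrite -hm -he -e1; diagram.
- transitivity (mu K ∘ (h ⊠ h) ∘ (gV ⊠ g)); first by diagram.
  by rewrite -hm -he -e2; diagram.
Qed.

Lemma condition_c_transport : condition_c K Gamma' (h ∘ g) (h ∘ gV).
Proof.
have hd := dualarr_hom transport_h_hom; have hd2 := dualarr_hom hd.
have hG' := dualarr_hom hG; have [hgV' _ _] := hgV.
have [_ [hm _ _ _ hS]] := inv_hopf_morphism Mf inv.
have hhG : h ∘ Gamma ∈ H0^∨ ⇒ K0 by hom.
have hp := piv_hom H0; have hp' := piv_hom K0; have ht := twV_hom H0; have ht' := twV_hom K0.
rewrite /condition_c (dualarr_comp hd hhG) (dualarr_comp hG transport_h_hom) c /lmul /rmul.
set L := mu H ∘ _ ∘ _; have hL : L ∈ H0 ⇒ H0 by rewrite /L; hom.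
set L' := mu K ∘ _ ∘ _; have hL' : L' ∈ K0 ⇒ K0 by rewrite /L'; hom.
have eL : h ∘ L = L' ∘ h.
  rewrite /L /L'; transitivity ((h ∘ mu H) ∘ (gV ⊠ I H0) ∘ mu H ∘ (I H0 ⊠ g)); first by diagram.
  rewrite hm; transitivity (mu K ∘ ((h ∘ gV) ⊠ (h ∘ mu H)) ∘ (I H0 ⊠ g)); first by diagram.
  by rewrite hm; diagram.
transitivity ((dualarr (dualarr h) ∘ piv H0) ∘ twV H0 ∘ antip H ∘ antip H ∘ L ∘ Gamma ∘ dualarr h).
  by diagram.
rewrite (piv_nat transport_h_hom).
transitivity (piv K0 ∘ (h ∘ twV H0) ∘ antip H ∘ antip H ∘ L ∘ Gamma ∘ dualarr h); first by diagram.
rewrite (twV_nat transport_h_hom).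
transitivity (piv K0 ∘ twV K0 ∘ (h ∘ antip H) ∘ antip H ∘ L ∘ Gamma ∘ dualarr h); first by diagram.
rewrite -hS.
transitivity (piv K0 ∘ twV K0 ∘ antip K ∘ (h ∘ antip H) ∘ L ∘ Gamma ∘ dualarr h); first by diagram.
rewrite -hS.
transitivity (piv K0 ∘ twV K0 ∘ antip K ∘ antip K ∘ (h ∘ L) ∘ Gamma ∘ dualarr h); first by diagram.
by rewrite eL; diagram.
Qed.

Lemma gamma_transport : (f ⊠ f) ∘ gammaOf K Gamma' = gammaOf H Gamma.
Proof.
have hC := copair_homG a; have hC' : copair K Gamma' ∈ 𝟏 ⇒ K0 ⊗ K0 by rewrite copair_transport; hom.
have [_ [_ _ _ _ fS]] := Mf.
have fSv : f ∘ antipV K = antipV H ∘ f.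
  transitivity (antipV H ∘ (antip H ∘ f) ∘ antipV K); first by diagram (antipVK H).
  by rewrite fS; diagram (antipKV K).
transitivity ((f ⊠ f) ∘ (antipV K ⊠ I K0) ∘ copair K Gamma').
  have hd := dualarr_hom transport_h_hom.
  by rewrite /gammaOf /copair; diagram.
rewrite copair_transport; transitivity (((f ∘ antipV K) ⊠ f) ∘ (h ⊠ h) ∘ copair H Gamma).
  by diagram.
by rewrite fSv /gammaOf; transitivity ((antipV H ⊠ I H0) ∘ copair H Gamma);
  [diagram fK | rewrite /copair; diagram].
Qed.

Lemma delta_transport : (f ⊠ f) ∘ deltaOf K Gamma' (h ∘ g) = deltaOf H Gamma g.
Proof.
have hC := copair_homG a; have hC' : copair K Gamma' ∈ 𝟏 ⇒ K0 ⊗ K0 by rewrite copair_transport; hom.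
have [_ [fm _ _ _ fS]] := Mf; have hd := dualarr_hom transport_h_hom.
rewrite /deltaOf /rmul.
transitivity (((f ∘ antip K) ⊠ ((f ∘ mu K) ∘ (I K0 ⊠ (h ∘ g)))) ∘ copair K Gamma').
  by rewrite /copair; diagram.
rewrite -fS fm copair_transport.
transitivity ((antip H ⊠ (mu H ∘ (I H0 ⊠ g))) ∘ copair H Gamma); first by diagram fK.
by rewrite /copair; diagram.
Qed.

Lemma phi_transport : f ∘ phiOf K Gamma' lam' = phiOf H Gamma lam ∘ f.
Proof.
have hC := copair_homG a; have [_ [fm _ _ _ _]] := Mf.
rewrite /phiOf copair_transport.
transitivity ((I H0 ⊠ (lam ∘ (f ∘ mu K))) ∘ (I H0 ⊠ h ⊠ I K0) ∘ (copair H Gamma ⊠ I K0)).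
  by diagram fK.
by rewrite fm; diagram fK.
Qed.
End Transport.

(** * The monoidal equivalence given by pullback of modules *)

Section Pull.
Variables (S : ribbonCat) (K H : hopfAlg S) (f : arr S).
Hypothesis Mf : hopf_morphism K H f.
Local Notation K0 := (carrier K).
Local Notation H0 := (carrier H).

Lemma pull_arr_hom : f ∈ K0 ⇒ H0. Proof. by case: Mf. Qed.
Hint Resolve pull_arr_hom : hom.
Lemma pull_mu : f ∘ mu K = mu H ∘ (f ⊠ f). Proof. by case: Mf => _ []. Qed.

Lemma pull_eta : f ∘ eta K = eta H. Proof. by case: Mf => _ []. Qed.

Lemma pull_Delta : Delta H ∘ f = (f ⊠ f) ∘ Delta K. Proof. by case: Mf => _ []. Qed.

Lemma pull_eps : eps H ∘ f = eps K. Proof. by case: Mf => _ []. Qed.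

Lemma pull_antipV : antipV H ∘ f = f ∘ antipV K.
Proof.
have [_ [_ _ _ _ fS]] := Mf.
transitivity (antipV H ∘ f ∘ antip K ∘ antipV K); first by diagram (antipKV K).
transitivity (antipV H ∘ (f ∘ antip K) ∘ antipV K); first by diagram.
by rewrite -fS; diagram (antipVK H).
Qed.

Lemma pull_act_hom (M : hmod H) : act M ∘ (f ⊠ I (mob M)) ∈ K0 ⊗ mob M ⇒ mob M.
Proof. by hom. Qed.

Lemma pull_act_mu (M : hmod H) (r := act M ∘ (f ⊠ I (mob M))) :
  r ∘ (mu K ⊠ I (mob M)) = r ∘ (I K0 ⊠ r).
Proof. by rewrite /r; diagram (pull_mu, act_mu M). Qed.

Lemma pull_act_eta (M : hmod H) : act M ∘ (f ⊠ I (mob M)) ∘ (eta K ⊠ I (mob M)) = I (mob M).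
Proof. by diagram (pull_eta, act_eta M). Qed.

Definition pull (M : hmod H) : hmod K := HMod (pull_act_hom M) (pull_act_mu M) (pull_act_eta M).
Definition pull_ob (x : hmod H + ob S) : hmod K + ob S :=
  match x with inl M => inl (pull M) | inr A => inr A end.

Lemma pull_modhom M N u : is_modhom M N u -> is_modhom (pull M) (pull N) u.
Proof.
move=> [hu eu]; split=> //=.
transitivity ((u ∘ act M) ∘ (f ⊠ I (mob M))); first by diagram.
by rewrite eu; diagram.
Qed.

Lemma pull_disj_hom x y u : is_disj_hom x y u -> is_disj_hom (pull_ob x) (pull_ob y) u.
Proof. by case: x y => [M|A] [N|B] //; apply: pull_modhom. Qed.

Lemma disj_ob_pull x : disj_ob (pull_ob x) = disj_ob x.
Proof. by case: x. Qed.

(** Pullback preserves tensor products except for two objects of degree 1: the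
    product of their pullbacks is [K ⊗ A ⊗ B], the pullback of their product is
    [H ⊗ A ⊗ B]. *)
Definition comparison (x y : hmod H + ob S) : arr S :=
  match x, y with inr A, inr B => f ⊠ I (A ⊗ B) | _, _ => I (disj_ob (disj_ten x y)) end.

Lemma comparison_disj_hom x y :
  is_disj_hom (disj_ten (pull_ob x) (pull_ob y)) (pull_ob (disj_ten x y)) (comparison x y).
Proof.
case: x y => [M|A] [N|B] /=; try exact: idm_hom; split; rewrite /=; try by hom.
- by rewrite /act2 /=; diagram pull_Delta.
- by diagram pull_mu.
Qed.

Lemma comparison_hom x y : comparison x y ∈ disj_ob (disj_ten (pull_ob x) (pull_ob y))
  ⇒ disj_ob (disj_ten x y).
Proof. by rewrite -(disj_ob_pull (disj_ten x y)); exact: disj_hom_arr (comparison_disj_hom x y). Qed.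

Lemma comparison_nat x x' y y' u v : is_disj_hom x x' u -> is_disj_hom y y' v ->
  comparison x' y' ∘ disj_map_arr (pull_ob x) (pull_ob y) u v
  = disj_map_arr x y u v ∘ comparison x y.
Proof.
move=> pu pv; have hu := disj_hom_arr pu; have hv := disj_hom_arr pv.
case: x x' y y' pu pv hu hv => [M|A] [M'|A'] [N|B] [N'|B'] //= _ _ hu hv;
by rewrite /disj_map_arr /=; diagram.
Qed.

Section Assoc.
Variables gam del phi gam' del' phi' : arr S.
Hypothesis hgam' : gam' ∈ 𝟏 ⇒ K0 ⊗ K0.
Hypothesis hdel' : del' ∈ 𝟏 ⇒ K0 ⊗ K0.
Hypothesis hphi' : phi' ∈ K0 ⇒ K0.
Hypothesis hgam : gam ∈ 𝟏 ⇒ H0 ⊗ H0.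
Hypothesis hdel : del ∈ 𝟏 ⇒ H0 ⊗ H0.
Hypothesis hphi : phi ∈ H0 ⇒ H0.
Hypothesis egam : (f ⊠ f) ∘ gam' = gam.
Hypothesis edel : (f ⊠ f) ∘ del' = del.
Hypothesis ephi : f ∘ phi' = phi ∘ f.

(** The associators agree under the comparison because [f] carries the elements
    for [K] to the elements for [H]. *)
Lemma comparison_assoc x y z :
  disj_alpha gam del phi x y z ∘ comparison x (disj_ten y z)
    ∘ disj_map_arr (pull_ob x) (disj_ten (pull_ob y) (pull_ob z)) (I (disj_ob x)) (comparison y z)
  = comparison (disj_ten x y) z
    ∘ disj_map_arr (disj_ten (pull_ob x) (pull_ob y)) (pull_ob z) (comparison x y) (I (disj_ob z))
    ∘ disj_alpha gam' del' phi' (pull_ob x) (pull_ob y) (pull_ob z).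
Proof.
case: x y z => [M|A] [N|B] [Q|C]; rewrite /disj_alpha /disj_map_arr /=
  /alpha010 /alpha011 /alpha101 /alpha110 /alpha111 /act2 /= ?/act2 /=.
- by diagram.
- by diagram.
- by rewrite -egam; diagram.
- by diagram (pull_Delta, pull_antipV).
- by diagram.
- by rewrite -edel; diagram pull_mu.
- by diagram pull_Delta.
- by diagram ephi.
Qed.
End Assoc.

Definition pull_map (x y : cob (Cdisj H)) (u : chom x y) : @chom (Cdisj K) (pull_ob x) (pull_ob y) :=
  to_disj_hom (pull_disj_hom (disj_arrP u)).

Lemma pull_mapE (x y : cob (Cdisj H)) (u : chom x y) : disj_arr (pull_map u) = disj_arr u.
Proof. exact: disj_arr_to. Qed.

Lemma pull_map_id (x : cob (Cdisj H)) : pull_map (cid x) = cid (pull_ob x : cob (Cdisj K)).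
Proof. by apply: disj_arr_inj; rewrite pull_mapE !kidE disj_ob_pull. Qed.

Lemma pull_map_comp (x y z : cob (Cdisj H)) (v : chom y z) (u : chom x y) :
  pull_map (v ∘c u) = (pull_map v : @chom (Cdisj K) _ _) ∘c pull_map u.
Proof. by apply: disj_arr_inj; rewrite pull_mapE !kcompE !pull_mapE. Qed.

Definition pull_functor : functor (Cdisj H) (Cdisj K) :=
  @Functor (Cdisj H) (Cdisj K) pull_ob pull_map pull_map_id pull_map_comp.

Definition pull2 (a : additiveStr S) (X : cob (Cdsum H a)) : cob (Cdsum K a) := (pull X.1, X.2).

Lemma part_pull a (X : cob (Cdsum H a)) i : part (pull2 X) i = pull_ob (part X i).
Proof. by case: i. Qed.

Lemma pob_pull a (X : cob (Cdsum H a)) i : pob (pull2 X) i = pob X i.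
Proof. by case: i. Qed.

Lemma pull2_homP a (X Y : cob (Cdsum H a)) (u : chom X Y) i :
  is_disj_hom (part (pull2 X) i) (part (pull2 Y) i) (carr u i).
Proof. by rewrite !part_pull; apply: pull_disj_hom; apply: carrP. Qed.

Definition pull2_map a (X Y : cob (Cdsum H a)) (u : chom X Y) : @chom (Cdsum K a) (pull2 X) (pull2 Y) :=
  to_dsum_hom (pull2_homP u).

Lemma carr_pull2 a (X Y : cob (Cdsum H a)) (u : chom X Y) i : carr (pull2_map u) i = carr u i.
Proof. exact: carr_to. Qed.

Lemma pull2_map_id a (X : cob (Cdsum H a)) : pull2_map (cid X) = cid (pull2 X).
Proof. by apply: carr_inj => i; rewrite carr_pull2 !carr_id pob_pull. Qed.

Lemma pull2_map_comp a (X Y Z : cob (Cdsum H a)) (v : chom Y Z) (u : chom X Y) :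
  pull2_map (v ∘c u) = pull2_map v ∘c pull2_map u.
Proof. by apply: carr_inj => i; rewrite carr_pull2 !carr_comp !carr_pull2. Qed.

Definition pull2_functor a : functor (Cdsum H a) (Cdsum K a) :=
  @Functor (Cdsum H a) (Cdsum K a) (@pull2 a) (@pull2_map a) (@pull2_map_id a) (@pull2_map_comp a).
End Pull.

(** Pulling back along mutually inverse isomorphisms changes an object only by an
    identity arrow of [S]. *)
Section Inverse.
Variables (S : ribbonCat) (K H : hopfAlg S) (f h : arr S).
Hypothesis (Mf : hopf_morphism K H f) (Mh : hopf_morphism H K h).
Hypothesis fK : f ∘ h = I (carrier H).

Lemma pull_pull_hom (x : hmod H + ob S) :
  is_disj_hom x (pull_ob Mh (pull_ob Mf x)) (I (disj_ob x)).
Proof.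
have hf := pull_arr_hom Mf; have hh := pull_arr_hom Mh.
case: x => [M|A] /=; last exact: idm_hom.
by split=> /=; [hom | diagram fK].
Qed.

Lemma pull_pull_hom' (x : hmod H + ob S) :
  is_disj_hom (pull_ob Mh (pull_ob Mf x)) x (I (disj_ob x)).
Proof.
have e : disj_ob (pull_ob Mh (pull_ob Mf x)) = disj_ob x by rewrite !disj_ob_pull.
apply: (is_disj_hom_inv (pull_pull_hom x)); rewrite ?e; [by hom | by compid | by compid].
Qed.
End Inverse.

Section Equivalence.
Variables (S : ribbonCat) (K H : hopfAlg S) (f h : arr S).
Hypothesis (Mf : hopf_morphism K H f) (Mh : hopf_morphism H K h).
Hypothesis fK : f ∘ h = I (carrier H).
Hypothesis hK : h ∘ f = I (carrier K).

Lemma pull_equivalence : is_equivalence (pull_functor Mf).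
Proof.
exists (pull_functor Mh), (fun x => to_disj_hom (pull_pull_hom Mf Mh fK x)),
  (fun y => to_disj_hom (pull_pull_hom' Mh Mf hK y)); split.
- move=> x; apply: (@disj_iso _ _ x (pull_ob Mh (pull_ob Mf x)) _ (I (disj_ob x))).
  + by apply: hom_eq (idm_hom _) _ _; rewrite ?disj_ob_pull.
  + by rewrite disj_arr_to; compid.
  + by rewrite disj_arr_to !disj_ob_pull; compid.
- move=> y; apply: (@disj_iso _ _ (pull_ob Mf (pull_ob Mh y)) y _ (I (disj_ob y))).
  + by apply: hom_eq (idm_hom _) _ _; rewrite ?disj_ob_pull.
  + by rewrite disj_arr_to !disj_ob_pull; compid.
  + by rewrite disj_arr_to; compid.
- move=> x x' u; apply: disj_arr_inj; rewrite !kcompE !disj_arr_to.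
  have hu := disj_hom_arr (disj_arrP u); by rewrite (idl_hom hu) // (idr_hom hu).
- move=> x x' u; apply: disj_arr_inj; rewrite !kcompE !disj_arr_to.
  have hu := disj_hom_arr (disj_arrP u); by rewrite (idl_hom hu) // (idr_hom hu).
Qed.

Lemma pull2_pull_hom a (X : cob (Cdsum H a)) i :
  is_disj_hom (part X i) (part (pull2 Mh (pull2 Mf X)) i) (I (pob X i)).
Proof. by rewrite !part_pull; apply: pull_pull_hom. Qed.

Lemma pull2_pull_hom' a (Y : cob (Cdsum K a)) i :
  is_disj_hom (part (pull2 Mf (pull2 Mh Y)) i) (part Y i) (I (pob Y i)).
Proof. by rewrite !part_pull; apply: pull_pull_hom'. Qed.

Lemma pull2_equivalence a : is_equivalence (pull2_functor Mf a).
Proof.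
exists (pull2_functor Mh a), (fun X => to_dsum_hom (pull2_pull_hom X)),
  (fun Y => to_dsum_hom (pull2_pull_hom' Y)); split.
- move=> X; apply: (@dsum_iso _ _ _ _ _ _ (fun i => I (pob X i))) => i; rewrite ?carr_to ?pob_pull.
  + by hom.
  + by compid.
  + by compid.
- move=> X; apply: (@dsum_iso _ _ _ _ _ _ (fun i => I (pob X i))) => i; rewrite ?carr_to ?pob_pull.
  + by hom.
  + by compid.
  + by compid.
- move=> X X' u; apply: carr_inj => i; rewrite !carr_comp !carr_to.
  have hu := carr_hom u i; by rewrite (idl_hom hu) // (idr_hom hu).
- move=> X X' u; apply: carr_inj => i; rewrite !carr_comp !carr_to.
  have hu := carr_hom u i; by rewrite (idl_hom hu) // (idr_hom hu).
Qed.

Section Monoidal.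
Variables gam del phi gamV delV phiV gam' del' phi' gamV' delV' phiV' : arr S.
Hypothesis P : associator_data H gam del phi gamV delV phiV.
Hypothesis P' : associator_data K gam' del' phi' gamV' delV' phiV'.
Hypothesis egam : (f ⊠ f) ∘ gam' = gam.
Hypothesis edel : (f ⊠ f) ∘ del' = del.
Hypothesis ephi : f ∘ phi' = phi ∘ f.

Definition comparisonV (x y : hmod H + ob S) : arr S :=
  match x, y with inr A, inr B => h ⊠ I (A ⊗ B) | _, _ => I (disj_ob (disj_ten x y)) end.

Lemma comparisonV_inverse x y :
  [/\ comparisonV x y ∈ disj_ob (disj_ten x y) ⇒ disj_ob (disj_ten (pull_ob Mf x) (pull_ob Mf y)),
      comparisonV x y ∘ comparison f x y = I (disj_ob (disj_ten (pull_ob Mf x) (pull_ob Mf y)))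
    & comparison f x y ∘ comparisonV x y = I (disj_ob (disj_ten x y))].
Proof.
have hf := pull_arr_hom Mf; have hh := pull_arr_hom Mh.
case: x y => [M|A] [N|B]; split; rewrite /=; try by hom.
all: by diagram (fK, hK).
Qed.

Definition pull_mf2 (x y : cob (Cdisj H)) : @chom (Cdisj K)
    (@tten (Cdisj K) (pull_ob Mf x) (pull_ob Mf y)) (pull_ob Mf (x ⊗c y)) :=
  to_disj_hom (comparison_disj_hom Mf x y).

Lemma pull_mf2E x y : disj_arr (pull_mf2 x y) = comparison f x y.
Proof. exact: disj_arr_to. Qed.

Lemma unit_disj_hom : is_disj_hom (inl (unit_mod K)) (pull_ob Mf (inl (unit_mod H))) (I 𝟏).
Proof.
split; rewrite /=; first exact: idm_hom.
by have hf := pull_arr_hom Mf; diagram (pull_eps Mf).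
Qed.

Definition pull_mf0 : @chom (Cdisj K) (inl (unit_mod K)) (pull_ob Mf (inl (unit_mod H))) :=
  to_disj_hom unit_disj_hom.

Section Disj.
Variables (M : monoidalStr (Cdisj H)) (N : monoidalStr (Cdisj K)).
Hypotheses (hM : disj_built gam del phi M) (hN : disj_built gam' del' phi' N).

Lemma pull_assoc (x y z : cob (Cdisj H)) :
  fmap (pull_functor Mf) (assoc M x y z) ∘c pull_mf2 x (y ⊗c z)
    ∘c (cid (pull_functor Mf x) ⊠c pull_mf2 y z)
  = pull_mf2 (x ⊗c y) z ∘c (pull_mf2 x y ⊠c cid (pull_functor Mf z))
    ∘c assoc N (pull_functor Mf x) (pull_functor Mf y) (pull_functor Mf z).
Proof.
have [eM _ _] := hM; have [eN _ _] := hN; apply: disj_arr_inj.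
rewrite !kcompE !kmapE !kidE pull_mapE !pull_mf2E eM eN !disj_ob_pull.
exact: (comparison_assoc Mf (gam_hom P') (del_hom P') (phi_hom P') (phi_hom P) egam edel ephi).
Qed.

Lemma pull_mf2_iso x y : is_iso (pull_mf2 x y).
Proof.
have [h1 h2 h3] := comparisonV_inverse x y.
apply: (@disj_iso _ _ (disj_ten (pull_ob Mf x) (pull_ob Mf y)) (pull_ob Mf (disj_ten x y)) _
  (comparisonV x y)); rewrite ?pull_mf2E ?disj_ob_pull //.
Qed.

Lemma pull_mf0_iso : is_iso pull_mf0.
Proof.
apply: (@disj_iso _ _ (inl (unit_mod K)) (pull_ob Mf (inl (unit_mod H))) _ (I 𝟏)) => /=;
    [by hom | by compid | by compid].
Qed.

Lemma pull_mf2_nat (x x' y y' : cob (Cdisj H)) (u : chom x x') (v : chom y y') :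
  pull_mf2 x' y' ∘c (fmap (pull_functor Mf) u ⊠c fmap (pull_functor Mf) v)
  = fmap (pull_functor Mf) (u ⊠c v) ∘c pull_mf2 x y.
Proof.
apply: disj_arr_inj; rewrite !kcompE !kmapE !pull_mapE !pull_mf2E kmapE.
exact: comparison_nat (disj_arrP u) (disj_arrP v).
Qed.

Lemma pull_lunit (x : cob (Cdisj H)) :
  fmap (pull_functor Mf) (lunit M x) ∘c pull_mf2 tone x ∘c (pull_mf0 ⊠c cid (pull_functor Mf x))
  = lunit N (pull_functor Mf x).
Proof.
have [_ eM _] := hM; have [_ eN _] := hN; apply: disj_arr_inj.
rewrite !kcompE !kmapE !kidE pull_mapE !pull_mf2E eM eN disj_arr_to.
by case: x => [Q|A]; rewrite /disj_map_arr /= ?tarr_idm ?tob_unitl; rewrite !(idl_hom (idm_hom _) erefl).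
Qed.

Lemma pull_runit (x : cob (Cdisj H)) :
  fmap (pull_functor Mf) (runit M x) ∘c pull_mf2 x tone ∘c (cid (pull_functor Mf x) ⊠c pull_mf0)
  = runit N (pull_functor Mf x).
Proof.
have [_ _ eM] := hM; have [_ _ eN] := hN; apply: disj_arr_inj.
rewrite !kcompE !kmapE !kidE pull_mapE !pull_mf2E eM eN disj_arr_to.
by case: x => [Q|A]; rewrite /disj_map_arr /= ?tarr_idm ?tob_unitr; rewrite !(idl_hom (idm_hom _) erefl).
Qed.

Definition pull_monFunctor : monFunctor M N :=
  @MonFunctor _ _ M N (pull_functor Mf) pull_mf0 pull_mf2 pull_mf0_iso pull_mf2_iso
    pull_mf2_nat pull_assoc pull_lunit pull_runit.

Lemma disj_equivalent : monoidally_equivalent M N.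
Proof. by exists pull_monFunctor; exact: pull_equivalence. Qed.
End Disj.

Section Dsum.
Variable a : additiveStr S.
Implicit Types X Y Z : cob (Cdsum H a).
Local Notation TH := (@tten (Cdsum H a)).
Local Notation TK := (@tten (Cdsum K a)).
Local Notation F := (pull2 Mf).

Definition comparison2 X Y l : arr S :=
  if l then I (pob (TH X Y) true) else bsum a (I (mob X.1 ⊗ mob Y.1)) (f ⊠ I (X.2 ⊗ Y.2)).

Lemma comparison2_hom X Y l : comparison2 X Y l ∈ pob (TK (F X) (F Y)) l ⇒ pob (TH X Y) l.
Proof.
have hf := pull_arr_hom Mf.
case: l; first exact: idm_hom.
exact: (bsum_hom a (idm_hom _) (tarr_hom hf (idm_hom _))).
Qed.

Lemma comparison2_incl X Y i j : comparison2 X Y (i (+) j) ∘ incl (F X) (F Y) i j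
  = incl X Y i j ∘ comparison f (part X i) (part Y j).
Proof.
have hf := pull_arr_hom Mf; case: i j => [] [] /=.
- exact: (bsum_in2 a (idm_hom _) (tarr_hom hf (idm_hom _))).
- by rewrite (idl_hom (in2_hom a _ _) erefl) (idr_hom (in2_hom a _ _)).
- by rewrite (idl_hom (in1_hom a _ _) erefl) (idr_hom (in1_hom a _ _)).
- exact: (bsum_in1 a (idm_hom _) (tarr_hom hf (idm_hom _))).
Qed.

Lemma comparison2_disj_hom X Y l :
  is_disj_hom (part (TK (F X) (F Y)) l) (part (F (TH X Y)) l) (comparison2 X Y l).
Proof.
have ht := comparison2_hom X Y l; case: l ht => ht; first exact: ht.
split; first exact: ht.
have h1 := act_hom (TK (F X) (F Y)).1; have h2 := act_hom (F (TH X Y)).1.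
have h0 : comparison2 X Y false ∈ mob (TK (F X) (F Y)).1 ⇒ mob (F (TH X Y)).1 := ht.
have b i j : is_disj_hom (disj_ten (part (F X) i) (part (F Y) j)) (part (F (TH X Y)) (i (+) j))
    (comparison2 X Y (i (+) j) ∘ incl (F X) (F Y) i j).
  rewrite comparison2_incl !part_pull.
  exact: is_disj_hom_comp (pull_disj_hom Mf (incl_disj_hom X Y i j)) (comparison_disj_hom Mf _ _).
apply: (@incl_ext S K a (carrier K) (F X) (F Y) (mob (F (TH X Y)).1) false); [by hom | by hom |].
case=> [] [] // _; apply: modhom_cancel h0.
- exact: (incl_disj_hom (F X) (F Y) true true). - exact: (b true true).
- exact: (incl_disj_hom (F X) (F Y) false false). - exact: (b false false).
Qed.

Definition pull2_mf2 X Y : @chom (Cdsum K a) (TK (F X) (F Y)) (F (TH X Y)) :=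
  to_dsum_hom (comparison2_disj_hom X Y).

Lemma pull2_mf2E X Y l : carr (pull2_mf2 X Y) l = comparison2 X Y l.
Proof. exact: carr_to. Qed.

Lemma pull2_mf2_iso X Y : is_iso (pull2_mf2 X Y).
Proof.
have hf := pull_arr_hom Mf; have hh := pull_arr_hom Mh.
pose t l := if l then I (pob (TH X Y) true) else bsum a (I (mob X.1 ⊗ mob Y.1)) (h ⊠ I (X.2 ⊗ Y.2)).
have hI := idm_hom (mob X.1 ⊗ mob Y.1); have hJ := idm_hom (X.2 ⊗ Y.2).
apply: (@dsum_iso _ _ _ _ _ _ t) => -[]; rewrite ?pull2_mf2E /=.
- exact: idm_hom.
- exact: (bsum_hom a hI (tarr_hom hh hJ)).
- exact: idl_hom (idm_hom _) erefl.
- rewrite -(bsum_comp a hI hI (tarr_hom hh hJ) (tarr_hom hf hJ)) (idl_hom hI) // -whiskerr; last by typ.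
  by rewrite hK tarr_idm bsum_idm.
- exact: idl_hom (idm_hom _) erefl.
- rewrite -(bsum_comp a hI hI (tarr_hom hf hJ) (tarr_hom hh hJ)) (idl_hom hI) // -whiskerr; last by typ.
  by rewrite fK tarr_idm bsum_idm.
Qed.

Lemma pull2_mf2_nat X X' Y Y' (u : chom X X') (v : chom Y Y') :
  pull2_mf2 X' Y' ∘c (pull2_map Mf u ⊠c pull2_map Mf v) = pull2_map Mf (u ⊠c v) ∘c pull2_mf2 X Y.
Proof.
apply: carr_inj => l; rewrite 2!carr_comp carr_pull2 !pull2_mf2E.
have h1 := comparison2_hom X Y l; have h2 := comparison2_hom X' Y' l.
have h3 := carr_hom (u ⊠c v) l; have h4 := carr_hom (pull2_map Mf u ⊠c pull2_map Mf v) l.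
apply: (@incl_ext0 S K a (F X) (F Y) (pob (TH X' Y') l) l); [by hom | by hom |] => i j el.
have h5 := incl_hom (F X) (F Y) i j; rewrite -el in h5.
have h6 := incl_hom X Y i j; rewrite -el in h6.
have h7 := incl_hom (F X') (F Y') i j; rewrite -el in h7.
have h8 := incl_hom X' Y' i j; rewrite -el in h8.
have h9 := disj_hom_arr (is_disj_hom_map (carrP u i) (carrP v j)).
have h10 := disj_hom_arr (is_disj_hom_map (carrP (pull2_map Mf u) i) (carrP (pull2_map Mf v) j)).
have h11 := comparison_hom Mf (part X i) (part Y j).
have h12 := comparison_hom Mf (part X' i) (part Y' j).
rewrite -!part_pull in h11 h12.
rewrite -comp_assoc; [|typ|typ].
rewrite [in carr _ _]el carr_map !carr_pull2 comp_assoc; [|typ|typ].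
rewrite [in comparison2 _ _ _]el comparison2_incl -comp_assoc; [|typ|typ].
rewrite !part_pull (comparison_nat Mf (carrP u i) (carrP v j)).
rewrite -[RHS]comp_assoc; [|typ|typ].
rewrite [in comparison2 _ _ _]el comparison2_incl [RHS]comp_assoc; [|typ|typ].
by rewrite [in RHS]el carr_map comp_assoc //; typ.
Qed.

Section Structures.
Variables (M0 : monoidalStr (Cdisj H)) (N0 : monoidalStr (Cdisj K)).
Hypotheses (hM0 : disj_built gam del phi M0) (hN0 : disj_built gam' del' phi' N0).

Lemma kcomparison2 X Y i j : disj_arr
    (component (pull2_mf2 X Y) (i (+) j) ∘c kincl (F X) (F Y) i j)
  = disj_arr (pull_map Mf (kincl X Y i j) ∘c pull_mf2 (part X i) (part Y j)).
Proof.
rewrite !kcompE componentE pull2_mf2E pull_mapE !kinclE pull_mf2E; exact: comparison2_incl.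
Qed.

(** The parts of a pullback are the pullbacks of the parts by computation, but
    only once the degrees are known; hence one instance of [functor_glue] for
    each choice of degrees. *)
Ltac glue_case G X Y Z i j k :=
  have := (@functor_glue _ _ _ _ G (part X i) (part Y j) (part Z k)
    (part (TH Y Z) (j (+) k)) (part (TH X Y) (i (+) j)) (part (TH X (TH Y Z)) (i (+) (j (+) k)))
    (part (TH (TH X Y) Z) (i (+) j (+) k))
    (part (TK (F Y) (F Z)) (j (+) k)) (part (TK (F X) (F Y)) (i (+) j))
    (part (TK (F X) (TK (F Y) (F Z))) (i (+) (j (+) k)))
    (part (TK (TK (F X) (F Y)) (F Z)) (i (+) j (+) k))
    (part (TK (F X) (F (TH Y Z))) (i (+) (j (+) k)))
    (part (TK (F (TH X Y)) (F Z)) (i (+) j (+) k))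
    _ _ _ _ _ _ _ _ _ _
    (component (pull2_mf2 Y Z) (j (+) k)) (component (pull2_mf2 X Y) (i (+) j))
    (kincl (pull2 Mf X) (pull2 Mf (Y ⊗c Z)) i (j (+) k))
    (kincl (pull2 Mf (X ⊗c Y)) (pull2 Mf Z) (i (+) j) k)
    (component (cid (pull2 Mf X) ⊠c pull2_mf2 Y Z) (i (+) (j (+) k)))
    (component (pull2_mf2 X Y ⊠c cid (pull2 Mf Z)) (i (+) j (+) k))
    (component (pull2_mf2 X (Y ⊗c Z)) (i (+) (j (+) k)))
    (component (pull2_mf2 (X ⊗c Y) Z) (i (+) j (+) k))
    (kassoc_incl P hM0 X Y Z i j k)
    (kassoc_incl P' hN0 (pull2 Mf X) (pull2 Mf Y) (pull2 Mf Z) i j k)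
    (disj_arr_inj (kcomparison2 Y Z j k)) (disj_arr_inj (kcomparison2 X Y i j))
    (kincl_map (cid (F X)) (pull2_mf2 Y Z) i (j (+) k))
    (kincl_map (pull2_mf2 X Y) (cid (F Z)) (i (+) j) k)
    (disj_arr_inj (kcomparison2 X (TH Y Z) i (j (+) k)))
    (disj_arr_inj (kcomparison2 (TH X Y) Z (i (+) j) k))); move/(congr1 (@disj_arr _ _ _ _)); exact.

Lemma comparison2_assoc X Y Z i j k (l := i (+) (j (+) k)) :
  aarr gam del phi X Y Z l ∘ comparison2 X (TH Y Z) l ∘ carr (cid (F X) ⊠c pull2_mf2 Y Z) l
    ∘ incl3 (F X) (F Y) (F Z) i j k
  = comparison2 (TH X Y) Z l ∘ carr (pull2_mf2 X Y ⊠c cid (F Z)) l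
    ∘ aarr gam' del' phi' (F X) (F Y) (F Z) l ∘ incl3 (F X) (F Y) (F Z) i j k.
Proof.
rewrite {}/l -(kassocE P X Y Z i j k) -(kassocE P' (F X) (F Y) (F Z) i j k).
pose G := pull_monFunctor hM0 hN0.
case: i j k => [] [] [].
- glue_case G X Y Z true true true.
- glue_case G X Y Z true true false.
- glue_case G X Y Z true false true.
- glue_case G X Y Z true false false.
- glue_case G X Y Z false true true.
- glue_case G X Y Z false true false.
- glue_case G X Y Z false false true.
- glue_case G X Y Z false false false.
Qed.

Variables (M : monoidalStr (Cdsum H a)) (N : monoidalStr (Cdsum K a)).
Hypotheses (hM : dsum_built gam del phi M) (hN : dsum_built gam' del' phi' N).

Lemma pull2_assoc X Y Z :
  fmap (pull2_functor Mf a) (assoc M X Y Z) ∘c pull2_mf2 X (TH Y Z)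
    ∘c (cid (F X) ⊠c pull2_mf2 Y Z)
  = pull2_mf2 (TH X Y) Z ∘c (pull2_mf2 X Y ⊠c cid (F Z)) ∘c assoc N (F X) (F Y) (F Z).
Proof.
have eM l : carr (assoc M X Y Z) l = aarr gam del phi X Y Z l.
  by case: hM => /(_ X Y Z) [e0 e1] _ _; case: l.
have eN l : carr (assoc N (F X) (F Y) (F Z)) l = aarr gam' del' phi' (F X) (F Y) (F Z) l.
  by case: hN => /(_ (F X) (F Y) (F Z)) [e0 e1] _ _; case: l.
apply: carr_inj => l; rewrite 4!carr_comp carr_pull2 !pull2_mf2E eM eN.
have h1 := aarr_hom P X Y Z l; have h2 := aarr_hom P' (F X) (F Y) (F Z) l.
have h3 := comparison2_hom X (TH Y Z) l; have h4 := comparison2_hom (TH X Y) Z l.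
have h5 := carr_hom (cid (F X) ⊠c pull2_mf2 Y Z) l.
have h6 := carr_hom (pull2_mf2 X Y ⊠c cid (F Z)) l.
apply: (@incl3_ext S K a (F X) (F Y) (F Z) (pob (TH (TH X Y) Z) l) l); [by hom | by hom |].
by move=> i j k ->; exact: comparison2_assoc.
Qed.

Local Notation oneH := (@tone (Cdsum H a)).
Local Notation oneK := (@tone (Cdsum K a)).

Lemma unit2_disj_hom l : is_disj_hom (part oneK l) (part (F oneH) l) (I (pob oneK l)).
Proof. by case: l; [exact: idm_hom | exact: unit_disj_hom]. Qed.

Definition pull2_mf0 : @chom (Cdsum K a) oneK (F oneH) := to_dsum_hom unit2_disj_hom.

Lemma pull2_mf0_iso : is_iso pull2_mf0.
Proof.
by apply: (@dsum_iso _ _ _ _ _ _ (fun l => I (pob oneK l))) => -[]; rewrite ?carr_to;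
  [exact: idm_hom | exact: idm_hom | compid | compid | compid | compid].
Qed.

Lemma pull2_lunit X : fmap (pull2_functor Mf a) (lunit M X) ∘c pull2_mf2 oneH X
    ∘c (pull2_mf0 ⊠c cid (F X)) = lunit N (F X).
Proof.
have eM l : carr (lunit M X) l = larr X l by case: hM => _ /(_ X) [e0 e1] _; case: l.
have eN l : carr (lunit N (F X)) l = larr (F X) l by case: hN => _ /(_ (F X)) [e0 e1] _; case: l.
apply: carr_inj => l; rewrite 2!carr_comp carr_pull2 pull2_mf2E eM eN.
have h1 := larr_hom X l; have h2 := larr_hom (F X) l; have h3 := comparison2_hom oneH X l.
have h4 := carr_hom (pull2_mf0 ⊠c cid (F X)) l; have h5 := incl_unitl_hom (F X) l.
have h6 := incl_unitl_hom X l; have h7 := incl_hom (F oneH) (F X) false l.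
rewrite addFb in h7.
rewrite pob_pull in h2 h5.
have e0 : carr (pull2_mf0 ⊠c cid (F X)) l ∘ incl oneK (F X) false l = incl (F oneH) (F X) false l.
  rewrite [LHS](carr_map pull2_mf0 (cid (F X)) false l) carr_to carr_id.
  rewrite -[X in _ ∘ X = _]/(disj_map_arr (part oneK false) (part (F X) l) (I 𝟏) (I (pob (F X) l))).
  rewrite (_ : disj_map_arr _ _ _ _ = I (pob (F X) l)).
    by rewrite pob_pull; apply: (idr_hom h7); rewrite /= part_pull;
        case: l {h1 h2 h3 h4 h5 h6 h7} => /=; rewrite tob_unitl.
  by case: l {h1 h2 h3 h4 h5 h6 h7}; rewrite /disj_map_arr /= tarr_idm tob_unitl.
apply: (@unitl_ext S K a (F X) (pob X l) l); [by hom | by hom |].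
rewrite -comp_assoc; [|typ|typ].
rewrite e0 -comp_assoc; [|exact: (hom_composable h7 h3 erefl)|typ].
rewrite [comparison2 _ _ _ ∘ _](comparison2_incl oneH X false l) larr_incl.
have -> : comparison f (part oneH false) (part X l) = I (pob X l).
  by case: l {h1 h2 h3 h4 h5 h6 h7 e0} => /=; rewrite tob_unitl.
rewrite comp_assoc; [|typ|typ].
by rewrite larr_incl pob_pull (idl_hom (idm_hom _)).
Qed.

Lemma pull2_runit X : fmap (pull2_functor Mf a) (runit M X) ∘c pull2_mf2 X oneH
    ∘c (cid (F X) ⊠c pull2_mf0) = runit N (F X).
Proof.
have eM l : carr (runit M X) l = rarr X l by case: hM => _ _ /(_ X) [e0 e1]; case: l.
have eN l : carr (runit N (F X)) l = rarr (F X) l by case: hN => _ _ /(_ (F X)) [e0 e1]; case: l.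
apply: carr_inj => l; rewrite 2!carr_comp carr_pull2 pull2_mf2E eM eN.
have h1 := rarr_hom X l; have h2 := rarr_hom (F X) l; have h3 := comparison2_hom X oneH l.
have h4 := carr_hom (cid (F X) ⊠c pull2_mf0) l; have h5 := incl_unitr_hom (F X) l.
have h6 := incl_unitr_hom X l; have h7 := incl_hom (F X) (F oneH) l false.
rewrite pob_pull in h2 h5; rewrite addbF in h7.
have e0 : carr (cid (F X) ⊠c pull2_mf0) l ∘ incl (F X) oneK l false = incl (F X) (F oneH) l false.
  have := carr_map (cid (F X)) pull2_mf0 l false; rewrite addbF => ->; rewrite carr_to carr_id.
  rewrite (_ : disj_map_arr _ _ _ _ = I (pob (F X) l)).
    by rewrite pob_pull; apply: (idr_hom h7); rewrite /= part_pull;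
        case: l {h1 h2 h3 h4 h5 h6 h7} => /=; rewrite tob_unitr.
  by case: l {h1 h2 h3 h4 h5 h6 h7}; rewrite /disj_map_arr /= tarr_idm tob_unitr.
apply: (@unitr_ext S K a (F X) (pob X l) l); [by hom | by hom |].
rewrite -comp_assoc; [|exact: (hom_composable h5 h4 erefl)|typ].
rewrite e0 -comp_assoc; [|exact: (hom_composable h7 h3 erefl)|typ].
have := comparison2_incl X oneH l false; rewrite addbF => ->.
have -> : comparison f (part X l) (part oneH false) = I (pob X l).
  by case: l {h1 h2 h3 h4 h5 h6 h7 e0} => /=; rewrite tob_unitr.
rewrite comp_assoc; [|typ|typ].
by rewrite !rarr_incl pob_pull (idl_hom (idm_hom _)).
Qed.

Definition pull2_monFunctor : monFunctor M N :=
  @MonFunctor _ _ M N (pull2_functor Mf a) pull2_mf0 pull2_mf2 pull2_mf0_iso pull2_mf2_iso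
    pull2_mf2_nat pull2_assoc pull2_lunit pull2_runit.

Lemma dsum_equivalent_over : monoidally_equivalent M N.
Proof. by exists pull2_monFunctor; exact: pull2_equivalence. Qed.
End Structures.

Lemma dsum_equivalent (M : monoidalStr (Cdsum H a)) (N : monoidalStr (Cdsum K a)) :
  dsum_built gam del phi M -> dsum_built gam' del' phi' N -> monoidally_equivalent M N.
Proof.
have [M0 hM0] := disj_monoidal P; have [N0 hN0] := disj_monoidal P'.
by move=> hM hN; apply: (dsum_equivalent_over hM0 hN0 hM hN).
Qed.
End Dsum.
End Monoidal.
End Equivalence.

(** * The theorem *)

Theorem theorem2p5 (S : ribbonCat) :
  (* (i) *)
  (forall (H : hopfAlg S) (Gamma lam g : arr S),
     condition_a H Gamma -> condition_b H Gamma lam g ->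
     [/\ forall g' : arr S, distinguished H lam g' -> g' = g,
         exists gV : arr S, mult_inverse H g gV
       & forall gV : arr S, mult_inverse H g gV -> condition_c H Gamma g gV ->
           (exists M : monoidalStr (Cdisj H), is_Cdisj Gamma lam g M)
           /\ (forall a : additiveStr S,
                 exists M : monoidalStr (Cdsum H a), is_Cdsum Gamma lam g M)])
  /\
  (* (ii) *)
  (forall (H : hopfAlg S) (Gamma lam g gV : arr S),
     condition_a H Gamma -> condition_b H Gamma lam g ->
     mult_inverse H g gV -> condition_c H Gamma g gV ->
   forall (H' : hopfAlg S) (f fV : arr S),
     hopf_isomorphism H' H f ->
     inverse_arrows (carrier H') (carrier H) f fV ->
     let Gamma' := fV ∘ Gamma ∘ dualarr fV in
     let lam' := lam ∘ f in
     exists g' gV' : arr S,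
       [/\ condition_a H' Gamma', condition_b H' Gamma' lam' g',
           mult_inverse H' g' gV', condition_c H' Gamma' g' gV'
         & (forall (M : monoidalStr (Cdisj H)) (M' : monoidalStr (Cdisj H')),
              is_Cdisj Gamma lam g M -> is_Cdisj Gamma' lam' g' M' ->
              monoidally_equivalent M M')
           /\ (forall (a : additiveStr S)
                 (M : monoidalStr (Cdsum H a)) (M' : monoidalStr (Cdsum H' a)),
                 is_Cdsum Gamma lam g M -> is_Cdsum Gamma' lam' g' M' ->
                 monoidally_equivalent M M')]).
Proof.
split.
  move=> H Gamma lam g a b; split.
  - exact: distinguished_unique b.
  - by exists (antip H ∘ g); exact: g_inverse a b.
  move=> gV hgV c; have [gamV [delV [phiV P]]] := associator_of_Gamma a b hgV c.
  by split=> [|A]; [exact: disj_monoidal P | exact: dsum_monoidal P].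
move=> H Gamma lam g gV a b hgV c H' f fV [Mf _] inv /=.
have a' := condition_a_transport Mf inv a.
have b' := condition_b_transport Mf inv a b.
have i' := mult_inverse_transport Mf inv b hgV.
have c' := condition_c_transport Mf inv a b hgV c.
have Mh := inv_hopf_morphism Mf inv; have [_ _ hK fK] := inv.
have [gamV [delV [phiV P]]] := associator_of_Gamma a b hgV c.
have [gamV' [delV' [phiV' P']]] := associator_of_Gamma a' b' i' c'.
have eg := gamma_transport Mf inv a.
have ed := delta_transport Mf inv a b.
have ep := phi_transport Mf inv a b.
exists (fV ∘ g), (fV ∘ gV); split=> //; split=> [M M' hM hM'|A M M' hM hM'].
- exact: (disj_equivalent Mf Mh fK hK P P' eg ed ep hM hM').
- exact: (dsum_equivalent Mf Mh fK hK P P' eg ed ep hM hM').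
Qed.
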